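(* Let $(\pi,V)$ be a continuous representation of a Banach--Lie group $G$ on a Banach space $V$. Then the space $V^\infty$ of smooth vectors, endowed with the locally convex topology described in the context, is complete, i.e., a Fréchet space.
   Context: Calculus: for locally convex spaces $E,F$ and $U\subseteq E$ open, a map $f:U\to F$ is $C^k$ ($k\in\mathbb{N}\cup\{\infty\}$) if it is continuous, the iterated directional derivatives $\mathrm{d}^jf(x)(h_1,\dots,h_j)$ exist for all integers $j\le k$ and all maps $\mathrm{d}^jf:U\times E^j\to F$ are continuous; smooth means $C^\infty$. A Banach--Lie group is a Lie group modeled on a Banach space; $\mathfrak g$ denotes its Lie algebra and $\exp_G$ its exponential function. A representation $\pi:G\to\mathrm{GL}(V)$ is continuous if the action $G\times V\to V$, $(g,v)\mapsto\pi(g)v$, is continuous. A vector $v\in V$ is smooth if its orbit map $\pi^v:G\to V$, $g\mapsto\pi(g)v$, is smooth; $V^\infty$ is the space of smooth vectors. For $x\in\mathfrak g$, $v\in V^\infty$ put $\mathrm{d}\pi(x)v:=\frac{d}{dt}\big|_{t=0}\pi(\exp_G(tx))v\in V^\infty$. Topology on $V^\infty$: fix a norm on $\mathfrak g$ defining its topology with $\|[x,y]\|\le\|x\|\,\|y\|$. For each continuous seminorm $p$ on $V$ and $n\in\mathbb{N}_0$ let $p_n(v):=\sup\{p(\mathrm{d}\pi(x_1)\cdots\mathrm{d}\pi(x_n)v): x_i\in\mathfrak g,\ \|x_i\|\le1\}$. The topology on $V^\infty$ is the locally convex topology defined by all the seminorms $p_n$. *)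

(* Defs.v *)
From HB Require Import structures.
From mathcomp Require Import all_boot all_order all_algebra.
From mathcomp Require Import all_classical all_reals all_analysis.

Set Implicit Arguments.
Unset Strict Implicit.
Unset Printing Implicit Defensive.

Import Order.TTheory GRing.Theory Num.Theory.
Import numFieldNormedType.Exports.

Local Open Scope classical_set_scope.
Local Open Scope ring_scope.

Section SmoothOn.
Context {R : realType} {E F : normedModType R}.
Implicit Types (U : set E) (f : E -> F).

(* [iter_derive f [:: h_1; ...; h_j] x] is d^j f (x)(h_1, ..., h_j):
   the derivative along h_1 is taken first. *)
Definition iter_derive f (hs : seq E) : E -> F :=
  foldl (fun g h => 'D_h g) f hs.

(* E^j is 'rV[E]_j, whose topology is the product topology; the case j = 0 of
   the second clause is the continuity of f. Only the values of f on the open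
   set U matter. *)
Definition smooth_on U f : Prop :=
  (forall (hs : seq E) (h x : E), U x -> derivable (iter_derive f hs) x h) /\
  (forall j : nat, {within [set z : E * 'rV[E]_j | U z.1],
     continuous (fun z => iter_derive f [seq z.2 0 i | i <- enum 'I_j] z.1)}).

End SmoothOn.

Record chart (M E : Type) := Chart {
  cdom : set M;
  ccod : set E;
  cmap : M -> E;
  cinv : E -> M }.

Record is_chart (R : realType) (M : topologicalType) (E : normedModType R)
    (c : chart M E) : Prop := IsChart {
  cdom_open : open (cdom c);
  ccod_open : open (ccod c);
  cmap_cod : forall p, cdom c p -> ccod c (cmap c p);
  cinv_dom : forall u, ccod c u -> cdom c (cinv c u);
  cmapK : forall p, cdom c p -> cinv c (cmap c p) = p;
  cinvK : forall u, ccod c u -> cmap c (cinv c u) = u;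
  cmap_continuous : {within cdom c, continuous (cmap c)};
  cinv_continuous : {within ccod c, continuous (cinv c)} }.

(* A smooth structure is given by an atlas indexed by the points of M, the
   chart with index p being a chart around p. *)
Record smooth_atlas (R : realType) (M : topologicalType) (E : normedModType R)
    (A : M -> chart M E) : Prop := SmoothAtlas {
  atlas_chart : forall p, is_chart (A p);
  atlas_mem : forall p, cdom (A p) p;
  atlas_compat : forall p q,
    smooth_on (ccod (A p) `&` cinv (A p) @^-1` cdom (A q))
              (cmap (A q) \o cinv (A p)) }.

Definition model_atlas (E : Type) (_ : E) : chart E E :=
  Chart setT setT id id.

Definition prod_atlas (M N E F : Type) (A : M -> chart M E)
    (B : N -> chart N F) (p : M * N) : chart (M * N) (E * F) :=
  Chart (cdom (A p.1) `*` cdom (B p.2)) (ccod (A p.1) `*` ccod (B p.2))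
        (fun x => (cmap (A p.1) x.1, cmap (B p.2) x.2))
        (fun u => (cinv (A p.1) u.1, cinv (B p.2) u.2)).

Definition smooth_map (R : realType) (M N : topologicalType)
    (E F : normedModType R) (A : M -> chart M E) (B : N -> chart N F)
    (f : M -> N) : Prop :=
  continuous f /\
  forall p q, smooth_on (ccod (A p) `&` (f \o cinv (A p)) @^-1` cdom (B q))
                        (cmap (B q) \o f \o cinv (A p)).

HB.mixin Record isBanachLieGroup (R : realType) (E : completeNormedModType R)
    G of Topological G & Group G := {
  chart_at : G -> chart G E;
  chart_at_smooth : smooth_atlas chart_at;
  lie_hausdorff : hausdorff_space G;
  lie_mul_smooth : smooth_map (prod_atlas chart_at chart_at) chart_at
                     (fun p : G * G => (p.1 * p.2)%g);
  lie_inv_smooth : smooth_map chart_at chart_at (fun g : G => (g^-1)%g) }.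

#[short(type="banachLieGroupType")]
HB.structure Definition BanachLieGroup (R : realType)
    (E : completeNormedModType R) :=
  {G of isBanachLieGroup R E G & Topological G & Group G}.

(* The Lie algebra T_1 G is identified with the model space E by means of the
   chart at 1. *)
Section LieAlgebra.
Context {R : realType} {E : completeNormedModType R}
  (G : banachLieGroupType E).

Let c : chart G E := chart_at (1%g : G).

Definition chart_one : E := cmap c 1%g.

Definition chart_mul (u v : E) : E := cmap c (cinv c u * cinv c v)%g.

(* Left invariant vector field with value y at 1, read in the chart at 1. *)
Definition left_invariant_field (y u : E) : E := 'D_y (chart_mul u) chart_one.

(* [X, Y] = dY(X) - dX(Y) for vector fields on an open subset of E. *)
Definition lie_bracket (x y : E) : E :=
  'D_x (left_invariant_field y) chart_one
  - 'D_y (left_invariant_field x) chart_one.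

Record one_parameter_subgroup (x : E) (gamma : R^o -> G) : Prop :=
  OneParameterSubgroup {
    ops_smooth : smooth_map (@model_atlas R^o) chart_at gamma;
    ops_morph : forall s t, gamma (s + t) = (gamma s * gamma t)%g;
    ops_deriv : is_derive (0 : R^o) 1 (cmap c \o gamma) x }.

(* exp_G(x) = gamma(1), where gamma is the one-parameter subgroup of G with
   gamma'(0) = x; the default value 1 is never used, as gamma exists (and is
   unique) in every Banach-Lie group. *)
Definition lie_exp (x : E) : G :=
  xget 1%g [set g | exists2 gamma, one_parameter_subgroup x gamma
                                 & gamma 1 = g].

Record lie_algebra_norm (N : E -> R) : Prop := LieAlgebraNorm {
  lnorm_triangle : forall x y, N (x + y) <= N x + N y;
  lnormZ : forall a x, N (a *: x) = `|a| * N x;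
  lnorm_eq0 : forall x, N x = 0 -> x = 0;
  lnorm_nbhs0 : forall A : set E,
    nbhs (0 : E) A <-> exists2 e : R, 0 < e & [set x | N x < e] `<=` A;
  lnorm_bracket : forall x y, N (lie_bracket x y) <= N x * N y }.

End LieAlgebra.

Section Representation.
Context {R : realType} {E : completeNormedModType R}
  {G : banachLieGroupType E} {V : completeNormedModType R}.

Record continuous_representation (pi : G -> {linear V -> V}) : Prop :=
  ContinuousRepresentation {
    rep1 : forall v, pi 1%g v = v;
    repM : forall g h v, pi (g * h)%g v = pi g (pi h v);
    rep_continuous : continuous (fun z : G * V => pi z.1 z.2) }.

Variable pi : G -> {linear V -> V}.

Definition smooth_vector (v : V) : Prop :=
  smooth_map (@chart_at R E G) (@model_atlas V) (fun g => pi g v).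

Definition dpi (x : E) (v : V) : V :=
  derive1 (fun t : R => pi (lie_exp G (t *: x)) v) 0.

Record continuous_seminorm (p : V -> R) : Prop := ContinuousSeminorm {
  cseminorm_triangle : forall v w, p (v + w) <= p v + p w;
  cseminormZ : forall a v, p (a *: v) = `|a| * p v;
  cseminorm_continuous : continuous p }.

Definition dseminorm (N : E -> R) (p : V -> R) (n : nat) (v : V) : \bar R :=
  ereal_sup [set (p (foldr dpi v x))%:E
            | x in [set x : n.-tuple E | forall i, N (tnth x i) <= 1]].

End Representation.

Lemma iter_derive_cst0 (R : realType) (E F : normedModType R) (hs : seq E) :
  iter_derive (fun=> 0 : F) hs = fun=> 0.
Proof.
elim/last_ind: hs => [//|hs h IH].
rewrite /iter_derive foldl_rcons -/(iter_derive _ _) IH.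
by apply/funext => x; exact: derive_cst.
Qed.

Lemma smooth_on_cst0 (R : realType) (E F : normedModType R) (U : set E) :
  smooth_on U (fun=> 0 : F).
Proof.
split=> [hs h x _|j].
  by rewrite iter_derive_cst0; exact: derivable_cst.
rewrite [X in continuous X](_ : _ = fun=> 0); first by move=> z; exact: cvg_cst.
by apply/funext => z; rewrite /from_subspace iter_derive_cst0.
Qed.

Section SmoothClosed.
Context {R : realType} {E F : normedModType R}.
Variables (U : set E) (f g : E -> F) (a : R).
Hypotheses (oU : open U) (sf : smooth_on U f) (sg : smooth_on U g).

Lemma iter_deriveD_Z (hs : seq E) (x : E) : U x ->
  iter_derive (fun y => a *: f y + g y) hs x =
  a *: iter_derive f hs x + iter_derive g hs x.
Proof.
elim/last_ind: hs x => [//|hs h IH] x Ux.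
rewrite /iter_derive !foldl_rcons -!/(iter_derive _ _).
rewrite (@near_eq_derive _ _ _ _
  ((a \*: iter_derive f hs) \+ iter_derive g hs)); last first.
  by apply: filterS (open_nbhs_nbhs (conj oU Ux)) => y /IH.
have df := sf.1 hs h x Ux; have dg := sg.1 hs h x Ux.
have dZ : derivable (a \*: iter_derive f hs) x h by exact: derivableZ.
by rewrite deriveD// deriveZ.
Qed.

Lemma smooth_onD_Z : smooth_on U (fun y => a *: f y + g y).
Proof.
split=> [hs h x Ux|j].
  apply: (@near_eq_derivable _ _ _
    ((a \*: iter_derive f hs) \+ iter_derive g hs)).
    apply: filterS (open_nbhs_nbhs (conj oU Ux)) => y Uy.
    by rewrite iter_deriveD_Z.
  by apply: derivableD; [apply: derivableZ; exact: sf.1|exact: sg.1].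
pose X := [set z : E * 'rV[E]_j | U z.1].
pose hs (z : E * 'rV[E]_j) := [seq z.2 0 i | i <- enum 'I_j].
pose k (z : subspace X) : F :=
  a *: iter_derive f (hs z) z.1 + iter_derive g (hs z) z.1.
apply: (@subspace_eq_continuous _ X F k).
  by move=> z; rewrite inE => Uz; rewrite /from_subspace iter_deriveD_Z.
by move=> z; apply: cvgD; [apply: cvgZr; exact: sf.2|exact: sg.2].
Qed.

End SmoothClosed.

Section SmoothVectors.
Context {R : realType} {E : completeNormedModType R}
  {G : banachLieGroupType E} {V : completeNormedModType R}.
Variable pi : G -> {linear V -> V}.

Let chart_open (p : G) : open (ccod (chart_at p : chart G E)).
Proof. exact: (ccod_open (atlas_chart chart_at_smooth p)). Qed.

Definition smooth_pred : {pred V} := fun v => `[<smooth_vector pi v>].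

Fact smooth_pred_closed : submod_closed smooth_pred.
Proof.
split=> [|a v w /asboolP[cv sv] /asboolP[cw sw]]; apply/asboolP; split.
- by under eq_fun do rewrite linear0; move=> z; exact: cvg_cst.
- move=> p q; rewrite [X in smooth_on _ X](_ : _ = fun=> 0).
    exact: smooth_on_cst0.
  by apply/funext => u /=; rewrite linear0.
- under eq_fun do rewrite linearP.
  by move=> z; apply: cvgD; [apply: cvgZr; exact: cv|exact: cw].
move=> p q; have := sv p q; have := sw p q.
rewrite /= !preimage_setT !setIT => {}sw {}sv.
rewrite [X in smooth_on _ X](_ : _ = fun u =>
  a *: pi (cinv (chart_at p) u) v + pi (cinv (chart_at p) u) w).
  exact: smooth_onD_Z.
by apply/funext => u /=; rewrite linearP.
Qed.

HB.instance Definition _ :=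
  GRing.isSubmodClosed.Build R V smooth_pred smooth_pred_closed.

Record smooth_space := SmoothSpace {
  smooth_val :> V;
  smooth_valP : smooth_val \in smooth_pred }.

HB.instance Definition _ := [isSub for smooth_val].
HB.instance Definition _ := [Choice of smooth_space by <:].
HB.instance Definition _ := [SubChoice_isSubLmodule of smooth_space by <:].

End SmoothVectors.

(* The locally convex topology on W defined by a set P of seminorms, carried by
   a copy of W: A is open if around each of its points it contains a
   ball of finitely many seminorms of P. *)
Definition lc_space (R : realType) (W : lmodType R) (P : set (W -> \bar R)) :
  Type := W.

Section LocallyConvexTopology.
Context {R : realType} {W : lmodType R} (P : set (W -> \bar R)).

HB.instance Definition _ := GRing.Lmodule.on (lc_space P).

Definition lc_open (A : set (lc_space P)) : Prop :=
  forall v, A v -> exists (S : set (W -> \bar R)) (e : R),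
    [/\ finite_set S, S `<=` P, 0 < e &
        forall w : W, (forall q, S q -> (q (w - v)%R < e%:E)%E) -> A w].

Fact lc_openT : lc_open setT.
Proof.
by move=> v _; exists set0, 1; split => //; exact: finite_set0.
Qed.

Fact lc_openI : setI_closed lc_open.
Proof.
move=> A B oA oB v [Av Bv].
have [S [e [fS SP e0 SA]]] := oA v Av.
have [T [d [fT TP d0 TB]]] := oB v Bv.
exists (S `|` T), (Order.min e d); split.
- by rewrite finite_setU.
- by move=> q [/SP|/TP].
- by rewrite lt_min e0.
- move=> w STw; split.
    apply: SA => q Sq; apply: (lt_le_trans (STw q (or_introl Sq))).
    by rewrite lee_fin ge_min lexx.
  apply: TB => q Tq; apply: (lt_le_trans (STw q (or_intror Tq))).
  by rewrite lee_fin ge_min lexx orbT.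
Qed.

Fact lc_open_bigU (I : Type) (f : I -> set (lc_space P)) :
  (forall i, lc_open (f i)) -> lc_open (\bigcup_i f i).
Proof.
move=> of_ v [i _ fiv]; have [S [e [fS SP e0 Sf]]] := of_ i v fiv.
by exists S, e; split => // w /Sf fw; exists i.
Qed.

HB.instance Definition _ :=
  isOpenTopological.Build (lc_space P) lc_openT lc_openI lc_open_bigU.

End LocallyConvexTopology.

(* Cauchy filters are those of the translation-invariant uniform structure of
   a topological vector space. *)
Record frechet_space (R : realType) (W : preTopologicalLmodType R) : Prop :=
  FrechetSpace {
    frechet_add : continuous (fun z : W * W => z.1 + z.2);
    frechet_scale : continuous (fun z : R^o * W => z.1 *: z.2);
    frechet_locally_convex : exists2 B : set_system W,
      (forall b, b \in B -> convex_set b) & basis B;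
    frechet_metrizable : exists d : W -> W -> R,
      [/\ forall v, d v v = 0,
          forall v w, d v w = 0 -> v = w,
          forall v w, d v w = d w v,
          forall u v w, d v w <= d v u + d u w &
          forall (v : W) (A : set W), nbhs v A <->
            exists2 e : R, 0 < e & [set w | d v w < e] `<=` A];
    frechet_complete : forall F : set_system W, ProperFilter F ->
      (forall U, nbhs (0 : W) U -> exists2 A, F A &
         forall v w, A v -> A w -> U (v - w)) ->
      exists l : W, F --> l }.

Definition smooth_vectors (R : realType) (E : completeNormedModType R)
    (G : banachLieGroupType E) (V : completeNormedModType R) (N : E -> R)
    (pi : G -> {linear V -> V}) : preTopologicalLmodType R :=
  lc_space [set q | exists (p : V -> R) (n : nat), continuous_seminorm p /\
    q = (fun v : smooth_space pi => dseminorm pi N p n v)].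

(* Main.v *)
(* Let v_k be a Cauchy net of smooth vectors. Its words dpi(x_1)...dpi(x_n) v_k
   converge in V, uniformly for bounded x_i, to multilinear maps tau(x_1,...,x_n).
   In a chart g = g(u) of G with left logarithmic derivative theta, the functions
   Phi_n(u; x_1,...,x_n) = pi(g(u)) tau(x_1,...,x_n) are continuous and satisfy
     D_h Phi_n(u; x) = Phi_{n+1}(u; theta(u) h, x),
   because the corresponding functions of v_k do and the convergence is locally
   uniform. Since Phi_n is linear in the x_i, the tangent map of each Phi_n is a
   finite sum of functions Phi_m composed with smooth maps, so that all Phi_n are
   C^k for every k, by induction on k simultaneously for all n. For n = 0 this is
   the smoothness of the limit vector tau(), and its words are the tau(x).

   The formula for D_h Phi_n needs dpi(x) v to be the derivative of the orbit map
   of v in direction x, hence the existence and uniqueness of one-parameter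
   subgroups. These are constructed in the chart at 1 as limits of the powers
   (x / 2^n)^[2^n t]; a homomorphism of R with a velocity at 0 solves the
   equation of a left invariant field, hence is smooth. *)
Require Import Defs.
From HB Require Import structures.
From mathcomp Require Import all_boot all_order all_algebra.
From mathcomp Require Import all_classical all_reals all_analysis.
From mathcomp Require Import ring lra.
Set Implicit Arguments.
Unset Strict Implicit.
Unset Printing Implicit Defensive.
Import Order.TTheory GRing.Theory Num.Theory.
Import numFieldNormedType.Exports.
Local Open Scope classical_set_scope.
Local Open Scope ring_scope.

(** * Mean value inequality *)

(** Differentiability is only asked for directional derivatives with joint continuity, so no
    continuity of differentials in operator norm is at hand. Two devices replace it: the mean value
    inequality, which yields strict differentiability in each direction, and homogeneity, which
    turns continuity at 0 of a multilinear expression into a bound on bounded sets. The latter also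
    makes every p_n finite. The exponential function is a choice among one-parameter subgroups.
    Uniqueness is proved for small generators, because only the germ of t -> exp(t x) at 0 enters
    [dpi]. The induction behind the smoothness of the limit is isolated in the notion [ladder]. The
    iterated derivatives of a smooth function form a ladder too, so the same lemma shows that
    [smooth_on] implies the recursive classes [Ck], for which the chain rule is proved. As V is
    normed, the seminorms p_n built from its norm already define the topology, which reduces
    metrizability and completeness to a sequence of seminorms. *)

Ltac zmod_step :=
  match goal with
  | |- ?s - ?t = 0 =>
    rewrite ?(addrAC _ _ t); rewrite ?(addrAC _ _ (- t));
    rewrite ?(addrNK t) ?(addrK t) ?subrr ?addNr ?add0r
  | |- ?s + ?t = 0 =>
    rewrite ?(addrAC _ _ (- t)); rewrite ?(addrAC _ _ t);
    rewrite ?(addrNK t) ?(addrK t) ?subrr ?addNr ?add0r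
  end.
(** Equalities in abelian groups: all terms are moved to the left, and the last summand is
    repeatedly cancelled against its opposite. [lmod] first distributes the scalars. *)
Ltac zmod :=
  apply/eqP; rewrite -subr_eq0; apply/eqP;
  rewrite ?(opprD, opprK, addrA, oppr0, addr0, add0r); repeat (zmod_step; try done).
Ltac lmod := rewrite ?(scalerDr, scalerBr, scalerDl, scalerBl, scalerN, scaleNr); zmod.

Lemma nbhs_normP (R : realType) (E : normedModType R) (x : E) (A : set E) :
  nbhs x A <-> exists2 r : R, 0 < r & forall y, `|y - x| < r -> A y.
Proof.
split=> [/nbhs_ballP[r r0 rA]|[r r0 rA]].
  by exists r => // y yr; apply: rA; rewrite -ball_normE /ball_ /= distrC.
apply/nbhs_ballP; exists r => // y; rewrite -ball_normE /ball_ /= distrC.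
exact: rA.
Qed.

(** * Directional derivatives as first-order expansions *)

Section Derive.
Context {R : realType} {E F : normedModType R}.

Lemma continuous_atP (f : E -> F) (x : E) :
  {for x, continuous f} <->
  forall e, 0 < e -> exists2 r : R, 0 < r &
    forall y, `|y - x| < r -> `|f y - f x| <= e.
Proof.
split=> [/cvgrPdist_le cf e /cf /nbhs_normP[r r0 rf]|cf].
  by exists r => // y /rf; rewrite distrC.
apply/cvgrPdist_le => e /cf[r r0 rf]; apply/nbhs_normP; exists r => // y yr.
by rewrite distrC; exact: rf.
Qed.

(** The o(t) form involves no division and includes t = 0, so expansions can be added, rescaled and
    estimated directly. *)
Lemma is_deriveP (f : E -> F) (x v : E) (d : F) :
  is_derive x v f d <->
  forall e, 0 < e -> exists2 r : R, 0 < r &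
    forall t, `|t| < r -> `|f (x + t *: v) - f x - t *: d| <= e * `|t|.
Proof.
split=> [[df <-] e e0|H].
  move: df => /cvg_ex[l dl]; rewrite /derive (cvg_lim _ dl)//.
  move/cvgrPdist_le : dl => /(_ e e0); rewrite near_withinE.
  move=> /nbhs_normP[r r0 rf]; exists r => // t tr.
  have [->|t0] := eqVneq t 0.
    by rewrite !scale0r addr0 !subr0 subrr !normr0 mulr0.
  have := rf t; rewrite subr0 => /(_ tr t0) /=.
  rewrite (addrC _ x) => h.
  have -> : f (x + t *: v) - f x - t *: l =
            - (t *: (l - t^-1 *: (f (x + t *: v) - f x))).
    by rewrite scalerBr scalerA divff// scale1r opprB.
  by rewrite normrN normrZ mulrC ler_wpM2r.
have dl : (fun h => h^-1 *: ((f \o shift x) (h *: v) - f x)) @ 0^' --> d.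
  apply/cvgrPdist_le => e /H[r r0 rf]; rewrite near_withinE.
  apply/nbhs_normP; exists r => // t; rewrite subr0 => tr t0 /=.
  have := rf t tr; rewrite (addrC _ x) => h.
  have -> : d - t^-1 *: (f (x + t *: v) - f x) =
           - (t^-1 *: (f (x + t *: v) - f x - t *: d)).
    by rewrite (scalerBr _ (f _ - f x)) scalerA mulVf// scale1r opprB.
  by rewrite normrN normrZ normfV ler_pdivrMl ?normr_gt0// mulrC.
by split; [apply/cvg_ex; exists d|exact: cvg_lim dl].
Qed.

Lemma is_derive_scale (f : E -> F) (x v : E) (d : F) (a : R) :
  is_derive x v f d -> is_derive x (a *: v) f (a *: d).
Proof.
move=> /is_deriveP df; apply/is_deriveP => e e0.
have a1 : 0 < `|a| + 1 by rewrite ltr_wpDl.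
have [r r0 rf] := df _ (divr_gt0 e0 a1).
exists (r / (`|a| + 1)); first exact: divr_gt0.
move=> t; rewrite ltr_pdivlMr// => tr.
have ta : `|t * a| < r.
  by apply: le_lt_trans tr; rewrite normrM ler_wpM2l// lerDl.
rewrite !scalerA; apply: (le_trans (rf _ ta)).
rewrite normrM mulrAC ler_pdivrMr//; have := normr_ge0 t; have := normr_ge0 a.
move=> ? ?; rewrite -mulrA ler_wpM2l ?(ltW e0)// ler_wpM2l// lerDl.
exact: ler01.
Qed.

Lemma is_deriveE (f : E -> F) (x v : E) (d : F) :
  is_derive x v f d -> 'D_v f x = d.
Proof. by case. Qed.

End Derive.

Section MeanValue.
Context {R : realType} {F : normedModType R}.

(** In a normed target there is no intermediate point. Instead the bound with slope M + e is
    propagated from 0 to b by a supremum argument, for which a pointwise Lipschitz condition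
    suffices. *)
Lemma mean_value_bound (f : R -> F) (b M : R) : 0 <= b -> 0 <= M ->
  (forall t, 0 <= t <= b -> forall e, 0 < e -> exists2 r : R, 0 < r &
     forall s, `|s| < r -> `|f (t + s) - f t| <= (M + e) * `|s|) ->
  `|f b - f 0| <= M * b.
Proof.
move=> b0 M0 H; apply/ler_addgt0Pr => e' e'0.
(* This gives e b <= e', with a positive denominator even for b = 0. *)
pose e := e' / (b + 1).
have b1 : 0 < b + 1 by rewrite ltr_wpDl.
have e0 : 0 < e by exact: divr_gt0.
suff : `|f b - f 0| <= (M + e) * b.
  move=> /le_trans; apply; rewrite mulrDl lerD2l /e mulrAC ler_pdivrMr//.
  by rewrite ler_pM2l// lerDl.
pose S := [set t | 0 <= t <= b /\ `|f t - f 0| <= (M + e) * t].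
have S0 : S 0 by split; rewrite ?lexx// subrr normr0 mulr0.
have ubS : has_ubound S by exists b => t [/andP[]].
have hsS : has_sup S by split; [exists 0|].
set c := sup S.
have c0 : 0 <= c by exact: ub_le_sup.
have cb : c <= b by apply: ge_sup; [exists 0|move=> t [/andP[]]].
have [|r r0 rf] := H c _ e e0; first by rewrite c0.
have Me : 0 <= M + e by rewrite addr_ge0// ltW.
(* Points s of S close to c satisfy the bound, and the hypothesis at c carries it from s to c. *)
have Sc : S c.
  split; first by rewrite c0.
  have [s Ss /= cs] := sup_adherent r0 hsS; rewrite -/c in cs.
  have sc : s <= c by exact: ub_le_sup.
  have scr : `|s - c| < r by rewrite ler0_norm ?subr_le0//; lra.
  have := rf _ scr; rewrite [c + _]addrC subrK => h1; have [_ h2] := Ss.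
  have -> : f c - f 0 = (f c - f s) + (f s - f 0) by rewrite addrA subrK.
  apply: (le_trans (ler_normD _ _)); rewrite distrC.
  move: h1; rewrite ler0_norm ?subr_le0// => h1.
  apply: (le_trans (lerD h1 h2)); rewrite -mulrDr ler_wpM2l//; lra.
have [->|cNb] := eqVneq b c; first by case: Sc.
have cltb : c < b by rewrite lt_neqAle eq_sym cNb.
(* If c < b, a further step to the right stays in S, against the choice of c. *)
pose s := Num.min (r / 2) (b - c).
have s0 : 0 < s by rewrite lt_min divr_gt0// subr_gt0.
have sr : `|s| < r.
  rewrite gtr0_norm//; have : s <= r / 2 by rewrite ge_min lexx.
  by move=> ?; lra.
have sb : s <= b - c by rewrite ge_min lexx orbT.
have Scs : S (c + s).
  split; first by apply/andP; split; lra.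
  have -> : f (c + s) - f 0 = (f (c + s) - f c) + (f c - f 0).
    by rewrite addrA subrK.
  have [_ h2] := Sc; have h1 := rf _ sr; rewrite gtr0_norm// in h1.
  by apply: (le_trans (ler_normD _ _)); rewrite mulrDr addrC lerD.
have : c + s <= c by exact: ub_le_sup.
by rewrite gerDl leNgt s0.
Qed.

Context {E : normedModType R}.

(** The mean value inequality for t -> f (x + t h) - t D, whose derivative is d t - D. With D a
    derivative at a reference point this is a first-order Taylor estimate. *)
Lemma mean_value_segment (f : E -> F) (x h : E) (d : R -> F) (D : F) (M : R) :
  (forall t, 0 <= t <= 1 -> is_derive (x + t *: h) h f (d t)) ->
  (forall t, 0 <= t <= 1 -> `|d t - D| <= M) ->
  `|f (x + h) - f x - D| <= M.
Proof.
move=> df dM.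
have M0 : 0 <= M by apply: le_trans (dM 0 _); rewrite ?normr_ge0 ?lexx ?ler01.
have := @mean_value_bound (fun t => f (x + t *: h) - t *: D) 1 M ler01 M0.
rewrite scale1r scale0r !scale1r scale0r addr0 subr0 mulr1 -addrA (addrC (- D)).
rewrite addrA; apply => t t01 e e0.
have /is_deriveP/(_ e e0)[r r0 rf] := df t t01.
exists r => // s sr; have := rf s sr; rewrite -(addrA x) -scalerDl => h1.
have -> : f (x + (t + s) *: h) - (t + s) *: D - (f (x + t *: h) - t *: D)
   = (f (x + (t + s) *: h) - f (x + t *: h) - s *: d t) + s *: (d t - D).
  rewrite scalerBr addrA subrK [(t + s) *: D]scalerDl opprB opprD !addrA.
  by rewrite (addrAC _ _ (t *: D)) subrK addrAC.
rewrite mulrDl addrC; apply: (le_trans (ler_normD _ _)); rewrite lerD//.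
by rewrite normrZ mulrC ler_wpM2r// dM.
Qed.

End MeanValue.

(** * Differentiability classes in the sense of Bastiani *)

Lemma prod_norm_lt (R : realType) (E F : normedModType R) (z : E * F) (r : R) :
  (`|z| < r) = (`|z.1| < r) && (`|z.2| < r).
Proof. by rewrite prod_normE gt_max. Qed.

Lemma prod_norm_le (R : realType) (E F : normedModType R) (z : E * F) (r : R) :
  (`|z| <= r) = (`|z.1| <= r) && (`|z.2| <= r).
Proof. by rewrite prod_normE ge_max. Qed.

Lemma open_setX (S T : topologicalType) (A : set S) (B : set T) :
  open A -> open B -> open (A `*` B).
Proof.
move=> oA oB; apply: openI.
  by apply: open_comp oA => z _; exact: cvg_fst.
by apply: open_comp oB => z _; exact: cvg_snd.
Qed.

Lemma open_setXT (S T : topologicalType) (A : set S) :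
  open A -> open (A `*` [set: T]).
Proof. by move=> oA; apply: open_setX => //; exact: openT. Qed.

(** The differential is one function on U x E, not a map into bounded operators, so continuity is
    joint in point and direction. The recursion changes the space, hence inductions on k range over
    all normed spaces. *)
Fixpoint Ck (k : nat) (R : realType) (E F : normedModType R) (U : set E)
    (f : E -> F) : Prop :=
  match k with
  | 0 => forall x, U x -> {for x, continuous f}
  | k'.+1 => [/\ forall x, U x -> {for x, continuous f},
                forall x h, U x -> derivable f x h &
                Ck k' (U `*` [set: E]) (fun z => 'D_z.2 f z.1)]
  end.

Arguments Ck : simpl never.

Section CkBasic.
Context {R : realType}.
Implicit Types (k : nat).

Lemma Ck_continuous k (E F : normedModType R) (U : set E) (f : E -> F) x :
  Ck k U f -> U x -> {for x, continuous f}.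
Proof. by case: k => [|k [+ _ _]]; exact. Qed.

Lemma CkS k (E F : normedModType R) (U : set E) (f : E -> F) :
  Ck k.+1 U f -> Ck k U f.
Proof.
by elim: k E F U f => [|k IH] E F U f [cf df Df]//; split=> //; exact: IH.
Qed.

Lemma Ck_le m k (E F : normedModType R) (U : set E) (f : E -> F) :
  (m <= k)%N -> Ck k U f -> Ck m U f.
Proof.
elim: k => [|k IH]; first by rewrite leqn0 => /eqP ->.
by rewrite leq_eqVlt ltnS => /predU1P[->//|/IH mk /CkS].
Qed.

Lemma Ck_ext k (E F : normedModType R) (U : set E) (f g : E -> F) : open U ->
  (forall x, U x -> f x = g x) -> Ck k U f -> Ck k U g.
Proof.
elim: k E F U f g => [|k IH] E F U f g oU fg.
  move=> cf x Ux; rewrite /prop_for /continuous_at -fg//.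
  apply: (cvg_trans _ (cf x Ux)); apply: near_eq_cvg.
  by apply: filterS (open_nbhs_nbhs (conj oU Ux)) => y /fg.
have near_fg x : U x -> \near x, f x = g x.
  by move=> Ux; apply: filterS (open_nbhs_nbhs (conj oU Ux)) => y /fg.
move=> [cf df Df]; split.
- move=> x Ux; rewrite /prop_for /continuous_at -fg//.
  by apply: (cvg_trans _ (cf x Ux)); apply: near_eq_cvg; exact: near_fg.
- by move=> x h Ux; apply: near_eq_derivable (df x h Ux); exact: near_fg.
- apply: IH Df; first exact: open_setXT.
  by move=> z [/= Uz _]; apply: near_eq_derive; exact: near_fg.
Qed.

(** Every clause of [Ck] is a condition at single points of a function defined everywhere, so any
    set U' containing x will do. *)
Lemma Ck_local k (E F : normedModType R) (U : set E) (f : E -> F) :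
  (forall x, U x -> exists2 U', U' x & Ck k U' f) -> Ck k U f.
Proof.
elim: k E F U f => [|k IH] E F U f fU; first by move=> x /fU[U' U'x]; exact.
split.
- by move=> x /fU[U' U'x [+ _ _]]; exact.
- by move=> x h /fU[U' U'x [_ + _]]; exact.
- apply: IH => z [/fU[U' U'x [_ _ Df]] _].
  by exists (U' `*` [set: E]).
Qed.

Lemma Ck_sub k (E F : normedModType R) (U U' : set E) (f : E -> F) :
  U' `<=` U -> Ck k U f -> Ck k U' f.
Proof. by move=> U'U fU; apply: Ck_local => x /U'U Ux; exists U. Qed.

(** Strict differentiability along v: base point and direction may both move. It follows from the
    mean value inequality and the continuity of the tangent map at (x, v), and takes the place of
    Frechet differentiability in the chain rule. *)
Lemma C1_strict (E F : normedModType R) (U : set E) (f : E -> F) x v :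
  open U -> Ck 1 U f -> U x -> forall e, 0 < e -> exists2 r : R, 0 < r &
  forall x' v' t, `|x' - x| < r -> `|v' - v| < r -> `|t| < r ->
    `|f (x' + t *: v') - f x' - t *: 'D_v f x| <= e * `|t|.
Proof.
move=> oU [_ df Df] Ux e e0.
have /continuous_atP/(_ e e0)[r1 r10 rf] := Df (x, v) (conj Ux I).
have /nbhs_normP[r2 r20 rU] := open_nbhs_nbhs (conj oU Ux).
pose r0 := Num.min r1 r2; have r00 : 0 < r0 by rewrite lt_min r10.
(* The segment from x' to x' + t v' stays within r + r (|v| + 1) of x, which is at most r (|v| + 3)
   <= r0. *)
pose r := Num.min 1 (r0 / (`|v| + 3)).
have v3 : 0 < `|v| + 3 by rewrite ltr_wpDl.
have rp : 0 < r by rewrite lt_min ltr01 divr_gt0.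
have r_le1 : r <= 1 by rewrite ge_min lexx.
have rv : r * (`|v| + 3) <= r0 by rewrite -ler_pdivlMr// ge_min lexx orbT.
exists r => // x' v' t x'r v'r tr.
have near_x s : 0 <= s <= 1 -> `|x' + s *: (t *: v') - x| < r0.
  move=> /andP[s0 s1]; apply: lt_le_trans rv.
  have -> : x' + s *: (t *: v') - x = (x' - x) + (s * t) *: v'.
    by rewrite scalerA addrAC.
  apply: (le_lt_trans (ler_normD _ _)).
  have v'v : `|v'| <= `|v| + 1.
    have -> : v' = v + (v' - v) by rewrite addrC subrK.
    by apply: (le_trans (ler_normD _ _)); rewrite lerD2l; lra.
  have : `|(s * t) *: v'| <= r * (`|v| + 1).
    rewrite normrZ; apply: ler_pM => //; rewrite normrM (ger0_norm s0).
    by apply: (le_trans _ (ltW tr)); rewrite ler_piMl.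
  by lra.
apply: (mean_value_segment (d := fun s => t *: 'D_v' f (x' + s *: (t *: v')))).
  move=> s s01; apply: is_derive_scale; apply: DeriveDef => //; apply: df.
  apply: rU; apply: lt_le_trans (near_x s s01) _.
  by rewrite ge_min lexx orbT.
move=> s s01; rewrite -scalerBr normrZ mulrC ler_wpM2r//.
apply: (rf (_, v')); rewrite prod_norm_lt /=; apply/andP; split.
  by apply: lt_le_trans (near_x s s01) _; rewrite ge_min lexx.
have : r0 <= r1 by rewrite ge_min lexx.
have : r <= r * (`|v| + 3) by rewrite ler_peMr ?(ltW rp)//; have := normr_ge0 v; lra.
by lra.
Qed.

(** The increment of g is t times a direction that tends to d; [C1_strict] absorbs this moving
    direction. *)
Lemma is_derive_comp (W E F : normedModType R) (U : set E) (f : E -> F)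
    (g : W -> E) w h d : open U -> Ck 1 U f -> U (g w) ->
  is_derive w h g d -> is_derive w h (f \o g) ('D_d f (g w)).
Proof.
move=> oU fU Ugw /is_deriveP dg; apply/is_deriveP => e e0.
have [r r0 rf] := C1_strict d oU fU Ugw e0.
have [r' r'0 rg] := dg _ (divr_gt0 r0 (ltr0Sn R 1)).
exists (Num.min r r'); first by rewrite lt_min r0.
move=> t; rewrite lt_min => /andP[tr tr'] /=.
have [->|t0] := eqVneq t 0.
  by rewrite !scale0r addr0 subrr subr0 !normr0 mulr0.
have -> : f (g (w + t *: h)) =
          f (g w + t *: (t^-1 *: (g (w + t *: h) - g w))).
  by rewrite scalerA divff// scale1r subrKC.
apply: rf => //; first by rewrite subrr normr0.
have -> : t^-1 *: (g (w + t *: h) - g w) - d =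
          t^-1 *: (g (w + t *: h) - g w - t *: d).
  by rewrite [RHS]scalerBr scalerA mulVf// scale1r.
rewrite normrZ normfV ltr_pdivrMl ?normr_gt0//.
apply: le_lt_trans (rg t tr') _; rewrite mulrC ltr_pM2l ?normr_gt0//.
by lra.
Qed.

(** By strictness the increment along v2 may start at x + t v1 and still has the derivative at x as
    first-order term. Adding the increment along v1 gives additivity. *)
Lemma C1_derive_linear (E F : normedModType R) (U : set E) (f : E -> F) x a v w :
  open U -> Ck 1 U f -> U x ->
  'D_(a *: v + w) f x = a *: 'D_v f x + 'D_w f x.
Proof.
move=> oU fU Ux.
have DD v1 v2 : 'D_(v1 + v2) f x = 'D_v1 f x + 'D_v2 f x.
  apply: is_deriveE; apply/is_deriveP => e e0.
  have e2 : 0 < e / 2 by rewrite divr_gt0.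
  have [r1 r10 H1] := C1_strict v1 oU fU Ux e2.
  have [r2 r20 H2] := C1_strict v2 oU fU Ux e2.
  have v1p : 0 < `|v1| + 1 by rewrite ltr_wpDl.
  exists (Num.min r1 (Num.min r2 (r2 / (`|v1| + 1)))).
    by rewrite !lt_min r10 r20 divr_gt0.
  move=> t; rewrite !lt_min => /and3P[tr1 tr2 tr3].
  have h1 := H1 x v1 t; rewrite !subrr !normr0 in h1.
  have h2 := H2 (x + t *: v1) v2 t; rewrite subrr normr0 in h2.
  have x't : `|x + t *: v1 - x| < r2.
    rewrite addrC addKr normrZ; apply: le_lt_trans (_ : `|t| * (`|v1| + 1) < _).
      by rewrite ler_wpM2l// lerDl.
    by rewrite -ltr_pdivlMr.
  have {}h1 := h1 r10 r10 tr1; have {}h2 := h2 x't r20 tr2.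
  have -> : f (x + t *: (v1 + v2)) - f x - t *: ('D_v1 f x + 'D_v2 f x) =
    (f (x + t *: v1 + t *: v2) - f (x + t *: v1) - t *: 'D_v2 f x) +
    (f (x + t *: v1) - f x - t *: 'D_v1 f x).
    by rewrite !scalerDr (addrA x); zmod.
  apply: (le_trans (ler_normD _ _)); lra.
rewrite DD; congr (_ + _); apply: is_deriveE; apply: is_derive_scale.
by case: fU => _ df _; apply: DeriveDef => //; exact: df.
Qed.

Lemma Ck_lin k (E F : normedModType R) (U : set E) (f : E -> F) :
  continuous f -> linear f -> Ck k U f.
Proof.
elim: k E F U f => [|k IH] E F U f cf lf; first by move=> x _; exact: cf.
have df x h : is_derive x h f (f h).
  apply/is_deriveP => e e0; exists 1 => // t _.
  by rewrite (addrC x) lf addrK subrr normr0 mulr_ge0// ltW.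
split.
- by move=> x _; exact: cf.
- by move=> x h _; have [] := df x h.
- rewrite [X in Ck _ _ X](_ : _ = f \o snd); last first.
    by apply/funext => z; exact: is_deriveE.
  apply: IH; last by move=> a x y /=; exact: lf.
  by move=> z; apply: continuous_comp => //; [exact: cvg_snd|exact: cf].
Qed.

Lemma Ck_cst k (E F : normedModType R) (U : set E) (c : F) :
  Ck k U (fun=> c).
Proof.
elim: k E U c => [|k IH] E U c; first by move=> x _; exact: cvg_cst.
split; first by move=> x _; exact: cvg_cst.
  by move=> x h _; exact: derivable_cst.
rewrite [X in Ck _ _ X](_ : _ = fun=> 0) //.
by apply/funext => z; exact: derive_cst.
Qed.

Lemma is_derive_pair (W E F : normedModType R) (f : W -> E) (g : W -> F) w h
    df dg : is_derive w h f df -> is_derive w h g dg ->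
  is_derive w h (fun x => (f x, g x)) (df, dg).
Proof.
move=> /is_deriveP Df /is_deriveP Dg; apply/is_deriveP => e e0.
have [r r0 rf] := Df e e0; have [s s0 sg] := Dg e e0.
exists (Num.min r s); first by rewrite lt_min r0.
by move=> t; rewrite lt_min => /andP[/rf ? /sg ?]; rewrite prod_norm_le; apply/andP.
Qed.

Lemma Ck_pair k (W E F : normedModType R) (U : set W) (f : W -> E) (g : W -> F) :
  open U -> Ck k U f -> Ck k U g -> Ck k U (fun x => (f x, g x)).
Proof.
elim: k W E F U f g => [|k IH] W E F U f g oU.
  by move=> cf cg x Ux; apply: cvg_pair; [exact: cf|exact: cg].
move=> [cf df Df] [cg dg Dg].
have dfg x h : U x -> is_derive x h (fun x => (f x, g x)) ('D_h f x, 'D_h g x).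
  by move=> Ux; apply: is_derive_pair; apply: DeriveDef => //; [exact: df|exact: dg].
split.
- by move=> x Ux; apply: cvg_pair; [exact: cf|exact: cg].
- by move=> x h Ux; have [] := dfg x h Ux.
- apply: Ck_ext (IH _ _ _ _ _ _ _ Df Dg); try exact: open_setXT.
  by move=> z [/= Uz _]; apply/esym/is_deriveE; exact: dfg.
Qed.

Lemma Ck_fst k (E F : normedModType R) (U : set (E * F)) : Ck k U fst.
Proof. by apply: Ck_lin => // z; exact: cvg_fst. Qed.

Lemma Ck_snd k (E F : normedModType R) (U : set (E * F)) : Ck k U snd.
Proof. by apply: Ck_lin => // z; exact: cvg_snd. Qed.

(** Functoriality of the tangent map: the differential of f o g is the differential of f composed
    with (g, Dg), and the induction hypothesis applies to that composite. *)
Lemma Ck_comp k (W E F : normedModType R) (U : set W) (V : set E) (f : E -> F)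
    (g : W -> E) : open U -> open V -> (forall w, U w -> V (g w)) ->
  Ck k V f -> Ck k U g -> Ck k U (f \o g).
Proof.
elim: k W E F U V f g => [|k IH] W E F U V f g oU oV gUV.
  move=> cf cg x Ux; apply: continuous_comp; first exact: cg.
  by apply: cf; exact: gUV.
move=> fV gU; have f1 : Ck 1 V f by exact: Ck_le fV.
have [_ _ Df] := fV; have [cg dg Dg] := gU.
have dfg w h : U w -> is_derive w h (f \o g) ('D_('D_h g w) f (g w)).
  move=> Uw; apply: (is_derive_comp oV) => //; first exact: gUV.
  by apply: DeriveDef => //; exact: dg.
split.
- move=> x Ux; apply: continuous_comp; first exact: cg.
  by apply: (Ck_continuous fV); exact: gUV.
- by move=> w h Uw; have [] := dfg w h Uw.
- have oUT : open (U `*` [set: W]) by exact: open_setXT.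
  have oVT : open (V `*` [set: E]) by exact: open_setXT.
  apply: (@Ck_ext _ _ _ _ ((fun z : E * E => 'D_z.2 f z.1) \o
             (fun z : W * W => (g z.1, 'D_z.2 g z.1)))) => //.
    by move=> z [/= Uz _]; apply/esym/is_deriveE; exact: dfg.
  apply: (IH _ _ _ _ _ _ _ oUT oVT _ Df).
    by move=> z [Uz _]; split => //; exact: gUV.
  apply: Ck_pair => //; apply: (IH _ _ _ _ U g fst) => //; last exact: Ck_fst.
    by move=> z [].
  exact: CkS.
Qed.

Lemma Ck_add k (E F : normedModType R) (U : set E) (f g : E -> F) : open U ->
  Ck k U f -> Ck k U g -> Ck k U (fun x => f x + g x).
Proof.
move=> oU fU gU.
apply: (@Ck_comp k E (F * F)%type F U setT (fun z => z.1 + z.2)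
  (fun x => (f x, g x)) oU) => //; first exact: openT.
  apply: Ck_lin.
    by move=> z; apply: cvgD; [exact: cvg_fst|exact: cvg_snd].
  by move=> a x y /=; rewrite scalerDr addrACA.
exact: Ck_pair.
Qed.

End CkBasic.

(** * Smoothness of multilinear families *)

Fixpoint alls (T : Type) (P : T -> Prop) (s : seq T) : Prop :=
  if s is x :: s' then P x /\ alls P s' else True.

Lemma alls_map (S T : Type) (f : S -> T) (P : S -> Prop) (Q : T -> Prop)
    (s : seq S) : (forall x, P x -> Q (f x)) -> alls P s -> alls Q (map f s).
Proof. by move=> PQ; elim: s => [//|x s IH] /= [/PQ ? /IH ?]. Qed.

Lemma alls_cat (T : Type) (P : T -> Prop) (s t : seq T) :
  alls P s -> alls P t -> alls P (s ++ t).
Proof. by elim: s => [//|x s IH] /= [Px /IH st /st]. Qed.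

Definition Cinf (R : realType) (E F : normedModType R) (U : set E) (f : E -> F) :=
  forall k, Ck k U f.

Section Cinf.
Context {R : realType}.

Lemma Cinf_derive (E F : normedModType R) (U : set E) (f : E -> F) :
  Cinf U f -> Cinf (U `*` [set: E]) (fun z => 'D_z.2 f z.1).
Proof. by move=> fU k; have [] := fU k.+1. Qed.

Lemma Cinf_is_derive (E F : normedModType R) (U : set E) (f : E -> F) x h :
  Cinf U f -> U x -> is_derive x h f ('D_h f x).
Proof. by move=> /(_ 1)[_ df _] Ux; apply: DeriveDef => //; exact: df. Qed.

Lemma Cinf_comp (W E F : normedModType R) (U : set W) (V : set E) (f : E -> F)
    (g : W -> E) : open U -> open V -> (forall w, U w -> V (g w)) ->
  Cinf V f -> Cinf U g -> Cinf U (f \o g).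
Proof.
by move=> oU oV gUV fV gU k; exact: (Ck_comp oU oV).
Qed.

Lemma Cinf_fst (E F : normedModType R) (U : set (E * F)) : Cinf U fst.
Proof. by move=> k; exact: Ck_fst. Qed.

Lemma Cinf_snd (E F : normedModType R) (U : set (E * F)) : Cinf U snd.
Proof. by move=> k; exact: Ck_snd. Qed.

Lemma Cinf_pair (W E F : normedModType R) (U : set W) (f : W -> E) (g : W -> F) :
  open U -> Cinf U f -> Cinf U g -> Cinf U (fun x => (f x, g x)).
Proof. by move=> oU fU gU k; exact: Ck_pair. Qed.

Lemma Cinf_comp_fst (W E F : normedModType R) (U : set W) (f : W -> F) :
  open U -> Cinf U f -> Cinf (U `*` [set: E]) (f \o fst).
Proof.
move=> oU fU; apply: (Cinf_comp (V := U)) => //; first exact: open_setXT.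
  by move=> z [].
exact: Cinf_fst.
Qed.

Lemma Cinf_cst (E F : normedModType R) (U : set E) (c : F) : Cinf U (fun=> c).
Proof. by move=> k; exact: Ck_cst. Qed.

Lemma Cinf_id (E : normedModType R) (U : set E) : Cinf U (@id E).
Proof. by move=> k; apply: Ck_lin => // z; exact: cvg_id. Qed.

End Cinf.

Section Ladder.
Context {R : realType} {E F : normedModType R}.
Variables (U : set E) (theta : E * E -> E).

(* The arguments [xs] stand for the slots of a multilinear map; differentiating
   in the base point [u] fills one more slot with [theta (u, h)]. *)
Record ladder (Phi : E -> seq E -> F) : Prop := Ladder {
  ladder_lin : forall u xs ys a x y, U u ->
    Phi u (xs ++ (a *: x + y) :: ys) =
    a *: Phi u (xs ++ x :: ys) + Phi u (xs ++ y :: ys);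
  ladder_derive : forall u h xs, U u ->
    is_derive u h (Phi^~ xs) (Phi u (rcons xs (theta (u, h))));
  ladder_continuous : forall (W : normedModType R) (O : set W) (kappa : W -> E)
      (as_ : seq (W -> E)), open O -> Cinf O kappa ->
    (forall w, O w -> U (kappa w)) -> alls (Cinf O) as_ ->
    forall w, O w -> {for w, continuous (fun w => Phi (kappa w) [seq a w | a <- as_])} }.

(** Freezing the first slot gives a ladder again, so slots can be differentiated one at a time by
    induction. *)
Lemma ladder_cons Phi x0 :
  ladder Phi -> ladder (fun u xs => Phi u (x0 :: xs)).
Proof.
move=> [lin der cont]; split.
- by move=> u xs ys a x y Uu; have := lin u (x0 :: xs) ys a x y Uu.
- by move=> u h xs Uu; have := der u h (x0 :: xs) Uu.
- move=> W O kappa as_ oO ck kU ca.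
  apply: (cont W O kappa ((fun=> x0) :: as_)) => //.
  by split => //; exact: Cinf_cst.
Qed.

Section TangentWords.
Context {W : normedModType R}.
Variables (O : set W) (kappa : W -> E).

(** The terms of the Leibniz rule: each slot is differentiated in turn, and differentiating the base
    point contributes the word with a new last slot. *)
Fixpoint tangent_words (as_ : seq (W -> E)) : seq (seq (W * W -> E)) :=
  if as_ is b :: bs then
    ((fun z => 'D_z.2 b z.1) :: [seq a \o fst | a <- bs]) ::
    [seq (b \o fst) :: l | l <- tangent_words bs]
  else [:: [:: fun z => theta (kappa z.1, 'D_z.2 kappa z.1)]].

Hypotheses (oU : open U) (ctheta : Cinf (U `*` [set: E]) theta).
Hypotheses (oO : open O) (ckappa : Cinf O kappa).
Hypothesis kappaU : forall w, O w -> U (kappa w).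

Let oOT : open (O `*` [set: W]). Proof. exact: open_setXT. Qed.

Lemma tangent_words_Cinf as_ : alls (Cinf O) as_ ->
  alls (alls (Cinf (O `*` [set: W]))) (tangent_words as_).
Proof.
elim: as_ => [_|b bs IH [cb cbs]] /=.
  split => //; split => //.
  apply: (Cinf_comp (V := U `*` [set: E]) (f := theta)) => //.
  - exact: open_setXT.
  - by move=> z [Oz _]; split => //; exact: kappaU.
  - apply: Cinf_pair => //; last exact: Cinf_derive.
    exact: Cinf_comp_fst.
split; first split.
- exact: Cinf_derive.
- by apply: alls_map cbs => a ca; exact: Cinf_comp_fst.
- apply: alls_map (IH cbs) => l cl /=; split => //; exact: Cinf_comp_fst.
Qed.

(** Induction on the slots. The first slot b w' is split as b w + (b w' - b w): the first summand is
    frozen and falls under the induction hypothesis, the second vanishes at w, so its derivative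
    needs only continuity of the remaining arguments. *)
Lemma ladder_is_derive Phi as_ w h : ladder Phi -> alls (Cinf O) as_ -> O w ->
  is_derive w h (fun w => Phi (kappa w) [seq a w | a <- as_])
    (\sum_(l <- tangent_words as_) Phi (kappa w) [seq a (w, h) | a <- l]).
Proof.
elim: as_ Phi => [|b bs IH] Phi L.
  move=> _ Ow /=; rewrite big_seq1 /=.
  rewrite -[[:: _]]/(rcons [::] _).
  rewrite -(is_deriveE (ladder_derive L ('D_h kappa w) [::] (kappaU Ow))).
  (* The chain rule asks that u -> Phi u [::] be C^1; its tangent map (u, v) -> Phi u
     [:: theta (u, v)] is continuous because Phi is a ladder. *)
  apply: (is_derive_comp (f := Phi^~ [::]) oU); last exact: Cinf_is_derive.
    split.
    - by move=> u Uu; apply: (ladder_continuous L (O := U) (kappa := id) (as_ := [::])) => //; exact: Cinf_id.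
    - by move=> u v Uu; have [] := ladder_derive L v [::] Uu.
    apply: (@Ck_ext _ _ _ _ _ (fun z => Phi z.1 [:: theta z])).
    - exact: open_setXT.
    - by move=> [u v] [Uu _]; apply/esym/is_deriveE; exact: (ladder_derive L).
    - apply: (ladder_continuous L (kappa := fst) (as_ := [:: theta])).
      + exact: open_setXT.
      + exact: Cinf_fst.
      + by move=> z [].
      + by [].
  exact: kappaU.
move=> [cb cbs] Ow /=; rewrite big_cons big_map /=.
set phi := fun w' => Phi (kappa w') (b w :: [seq a w' | a <- bs]).
set rho := fun w' => Phi (kappa w') ((b w' - b w) :: [seq a w' | a <- bs]).
have dphi := IH _ (ladder_cons (b w) L) cbs Ow; rewrite -/phi in dphi.
have lin0 w' x y : O w' -> Phi (kappa w') ((x + y) :: [seq a w' | a <- bs]) =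
    Phi (kappa w') (x :: [seq a w' | a <- bs]) +
    Phi (kappa w') (y :: [seq a w' | a <- bs]).
  move=> Ow'; have := ladder_lin L [::] [seq a w' | a <- bs] 1 x y (kappaU Ow').
  by rewrite /= !scale1r.
have lin0Z w' t x : O w' -> Phi (kappa w') ((t *: x) :: [seq a w' | a <- bs]) =
    t *: Phi (kappa w') (x :: [seq a w' | a <- bs]).
  move=> Ow'.
  have := ladder_lin L [::] [seq a w' | a <- bs] t x 0 (kappaU Ow').
  rewrite /= addr0 => ->.
  have := lin0 w' 0 0 Ow'; rewrite addr0 => /eqP; rewrite addrC -subr_eq subrr.
  by move=> /eqP <-; rewrite addr0.
have drho : is_derive w h rho
    (Phi (kappa w) ('D_h b w :: [seq a w | a <- bs])).
  apply/is_deriveP => e e0.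
  (* The first slot becomes an independent variable, to be evaluated at the difference quotient of
     b, which tends to the derivative of b at w. *)
  have := ladder_continuous L (O := O `*` [set: E]) (kappa := kappa \o fst)
    (as_ := snd :: [seq a \o fst | a <- bs]).
  case/(_ _ _ _ _ (w, 'D_h b w) _)/continuous_atP/(_ e e0) => //.
  - exact: open_setXT.
  - exact: Cinf_comp_fst.
  - by move=> z [/= /kappaU].
  - split; first exact: Cinf_snd.
    by apply: alls_map cbs => a ca; exact: Cinf_comp_fst.
  move=> r r0 /= Hr.
  have /is_deriveP db := Cinf_is_derive h cb Ow.
  have [s s0 Hs] := db _ (divr_gt0 r0 (ltr0Sn R 1)).
  have /nbhs_normP[q q0 qO] := open_nbhs_nbhs (conj oO Ow).
  have h1 : 0 < `|h| + 1 by rewrite ltr_wpDl.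
  exists (Num.min s (Num.min (r / (`|h| + 1)) (q / (`|h| + 1)))).
    by rewrite !lt_min s0 !divr_gt0.
  move=> t; rewrite !lt_min !ltr_pdivlMr// => /and3P[ts tr tq].
  have [->|t0] := eqVneq t 0.
    by rewrite !scale0r addr0 subrr subr0 !normr0 mulr0.
  have th : `|w + t *: h - w| <= `|t| * (`|h| + 1).
    by rewrite addrC addKr normrZ ler_wpM2l// lerDl.
  have Owth : O (w + t *: h) by apply: qO; exact: le_lt_trans tq.
  rewrite /rho subrr.
  have -> : b (w + t *: h) - b w = t *: (t^-1 *: (b (w + t *: h) - b w)).
    by rewrite scalerA divff// scale1r.
  have -> : Phi (kappa w) (0 :: [seq a w | a <- bs]) = 0.
    by have := lin0Z w 0 0 Ow; rewrite !scale0r.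
  rewrite lin0Z// subr0 -scalerBr normrZ.
  rewrite mulrC ler_wpM2r//.
  have := Hr (w + t *: h, t^-1 *: (b (w + t *: h) - b w)).
  rewrite -!map_comp /=; apply; rewrite prod_norm_lt /=; apply/andP; split.
    exact: le_lt_trans tr.
  have -> : t^-1 *: (b (w + t *: h) - b w) - 'D_h b w =
            t^-1 *: (b (w + t *: h) - b w - t *: 'D_h b w).
    by rewrite [RHS]scalerBr scalerA mulVf// scale1r.
  rewrite normrZ normfV ltr_pdivrMl ?normr_gt0//.
  apply: le_lt_trans (Hs t ts) _; rewrite mulrC ltr_pM2l ?normr_gt0//.
  by lra.
rewrite addrC -map_comp /=.
apply: near_eq_is_derive (is_deriveD dphi drho) => //.
apply: filterS (open_nbhs_nbhs (conj oO Ow)) => w' Ow'.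
by rewrite -[LHS]/(phi w' + rho w') /phi /rho -lin0// subrKC.
Qed.

End TangentWords.

(** The parametrizations [kappa] and [as_] are arbitrary because the tangent map of one such term is
    a sum of terms parametrized by W x W. *)
Lemma ladder_Ck k Phi (W : normedModType R) (O : set W) (kappa : W -> E) as_ :
  open U -> Cinf (U `*` [set: E]) theta -> ladder Phi ->
  open O -> Cinf O kappa -> (forall w, O w -> U (kappa w)) ->
  alls (Cinf O) as_ -> Ck k O (fun w => Phi (kappa w) [seq a w | a <- as_]).
Proof.
move=> oU cth L; elim: k W O kappa as_ => [|k IH] W O kappa as_ oO ck kU ca.
  exact: (ladder_continuous L).
have d w h := @ladder_is_derive W O kappa oU cth oO ck kU Phi as_ w h L ca.
split.
- exact: (ladder_continuous L).
- by move=> w h Ow; have [] := d w h Ow.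
have oOT : open (O `*` [set: W]) by exact: open_setXT.
apply: (@Ck_ext _ _ _ _ _ (fun z => \sum_(l <- tangent_words kappa as_)
  Phi ((kappa \o fst) z) [seq a z | a <- l])) => //.
  by move=> [w h] [Ow _]; apply/esym/is_deriveE; exact: d.
have := tangent_words_Cinf oU cth oO ck kU ca.
elim: (tangent_words kappa as_) => [_|l ls IHl [cl cls]].
  by under eq_fun do rewrite big_nil; exact: Ck_cst.
under eq_fun do rewrite big_cons; apply: Ck_add => //; last exact: IHl.
apply: IH => //; first exact: Cinf_comp_fst.
by move=> z [/= /kU].
Qed.

End Ladder.

(** * Equivalence of smooth_on with iterated tangent maps *)

Lemma within_openP (S T : topologicalType) (A : set S) (f : S -> T) : open A ->
  {within A, continuous f} <-> (forall x, A x -> {for x, continuous f}).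
Proof.
move=> oA; rewrite continuous_open_subspace//.
by split => cf x; [move=> Ax; apply: cf|]; rewrite inE//; exact: cf.
Qed.

(** * Continuity in row vectors and partial derivatives *)

Section RowTopology.
Context {T E : topologicalType} {n : nat}.

Lemma continuous_row (f : 'I_n -> T -> E) (w : T) :
  (forall i, {for w, continuous (f i)}) ->
  {for w, continuous (fun w => \row_i f i w : 'rV[E]_n)}.
Proof.
move=> cf A [P nP PA].
have : \forall w' \near w, forall i, P 0 i (f i w').
  by apply: filter_forall => i; apply: (cf i); have := nP 0 i; rewrite mxE.
by apply: filterS => w' Pw'; apply: PA => i j; rewrite mxE (ord1 i).
Qed.

Lemma continuous_row_coord (i : 'I_n) : continuous (fun M : 'rV[E]_n => M 0 i).
Proof.
move=> M A nA; exists (fun _ k => if k == i then A else setT).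
  by move=> j k; rewrite (ord1 j); case: eqVneq => [->//|_]; exact: filterT.
by move=> N /(_ 0 i); rewrite eqxx.
Qed.

End RowTopology.

Lemma continuous_snd_coord (S T : topologicalType) n (i : 'I_n) :
  continuous (fun z : S * 'rV[T]_n => z.2 0 i).
Proof.
move=> z A nA; have := @continuous_row_coord T n i z.2 A nA.
exact: (@cvg_snd _ _ (nbhs z.1) (nbhs z.2)).
Qed.

Lemma derive_snd (R : realType) (W E F : normedModType R) (H : W * E -> F) w u h :
  'D_(0, h) H (w, u) = 'D_h (fun u => H (w, u)) u.
Proof.
rewrite /derive (_ : (fun t => _) = (fun t => t^-1 *:
  (((fun u => H (w, u)) \o shift u) (t *: h) - H (w, u))))//.
apply/funext => t /=; congr (_ *: (H _ - _)).
by rewrite -[LHS]/(t *: 0 + w, t *: h + u) scaler0 add0r.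
Qed.

Lemma iter_derive_rcons (R : realType) (E F : normedModType R) (f : E -> F) hs h x :
  iter_derive f (rcons hs h) x = 'D_h (iter_derive f hs) x.
Proof. by rewrite /iter_derive foldl_rcons. Qed.

Section SmoothOnCinf.
Context {R : realType} {E F : normedModType R}.
Variables (U : set E) (f : E -> F).
Hypothesis oU : open U.

(** Continuity in row vectors becomes continuity along any continuous family of points and
    directions, by composition with the row formed by the a w. *)
Lemma smooth_on_continuous (W : normedModType R) (O : set W) (kappa : W -> E)
    (as_ : seq (W -> E)) : smooth_on U f -> Ck 0 O kappa ->
  (forall w, O w -> U (kappa w)) -> alls (Ck 0 O) as_ ->
  Ck 0 O (fun w => iter_derive f [seq a w | a <- as_] (kappa w)).
Proof.
move=> [_ /(_ (size as_))]; set j := size as_.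
have oX : open [set z : E * 'rV[E]_j | U z.1].
  by apply: open_comp oU => z _; exact: cvg_fst.
move=> + ck kU ca w Ow; move=> /(within_openP _ oX) cg.
pose g (z : E * 'rV[E]_j) := iter_derive f [seq z.2 0 i | i <- enum 'I_j] z.1.
pose r w : E * 'rV[E]_j := (kappa w, \row_i nth (fun=> 0) as_ i w).
rewrite (_ : (fun w => _) = g \o r); last first.
  apply/funext => w'; rewrite /g /r /=; congr iter_derive.
  rewrite -[in LHS](mkseq_nth (fun=> 0) as_) /mkseq -val_enum_ord -!map_comp.
  by apply: eq_map => i /=; rewrite mxE.
apply: continuous_comp; last exact: (cg (r w) (kU w Ow)).
have cr : {for w, continuous (fun w => \row_i nth (fun=> 0) as_ i w : 'rV[E]_j)}.
  apply: continuous_row => i.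
  have : (i < size as_)%N by exact: ltn_ord.
  move: (nat_of_ord i); elim: (as_) ca => [//|a s IH] /= [ca cas] [|k] /=.
    by move=> _; exact: ca.
  by rewrite ltnS; exact: IH.
exact: (cvg_pair (ck w Ow) cr).
Qed.

Lemma alls_Ck0_cst (W : normedModType R) (O : set W) (hs : seq E) :
  alls (Ck 0 O) [seq (fun=> h) | h <- hs].
Proof. by elim: hs => //= h hs IH; split => //; exact: Ck_cst. Qed.

Lemma iter_derive_C1 hs : smooth_on U f -> Ck 1 U (iter_derive f hs).
Proof.
move=> sf; split.
- move=> x Ux; have := @smooth_on_continuous E U id [seq (fun=> h) | h <- hs] sf.
  rewrite /= (_ : (fun w : E => _) = iter_derive f hs).
    apply => //; last exact: alls_Ck0_cst.
    by move=> y _; exact: cvg_id.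
  by apply/funext => y; rewrite -map_comp map_id.
- by move=> x h Ux; exact: sf.1.
- move=> z [Uz _].
  have := @smooth_on_continuous (E * E)%type (U `*` setT) fst
            (rcons [seq (fun=> h) | h <- hs] snd) sf.
  rewrite (_ : (fun w : E * E => _) = fun z => 'D_z.2 (iter_derive f hs) z.1).
    apply => //.
    + by move=> y _; exact: cvg_fst.
    + by move=> w [].
    + rewrite -cats1; apply: alls_cat; first exact: alls_Ck0_cst.
      by split => // y _; exact: cvg_snd.
  by apply/funext => y; rewrite map_rcons -map_comp map_id iter_derive_rcons.
Qed.

(** Here [theta] (u, h) = h. Linearity holds in the last direction by [C1_derive_linear]; for an
    earlier one the identity is differentiated along the directions that follow it. *)
Lemma iter_derive_ladder : smooth_on U f ->
  ladder U snd (fun u hs => iter_derive f hs u).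
Proof.
move=> sf; split.
- move=> u xs ys a x y Uu.
  elim/last_ind: ys u Uu => [|ys h IH] u Uu.
    rewrite !cats1 !iter_derive_rcons.
    exact: (C1_derive_linear a x y oU (iter_derive_C1 xs sf) Uu).
  rewrite -!rcons_cons -!rcons_cat !iter_derive_rcons.
  have d hs : derivable (iter_derive f hs) u h by exact: sf.1.
  rewrite -deriveZ//.
  rewrite -(deriveD (derivableZ (d _)))//; apply: near_eq_derive.
  by apply: filterS (open_nbhs_nbhs (conj oU Uu)) => v; exact: IH.
- move=> u h xs Uu; rewrite iter_derive_rcons; apply: DeriveDef => //.
  exact: sf.1.
- move=> W O kappa as_ oO ck kU ca w Ow.
  apply: (smooth_on_continuous (O := O)) => //.
  by elim: (as_) ca => //= a s IH [ca cas]; split; [exact: (ca 0)|exact: IH].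
Qed.

Lemma smooth_on_Cinf : smooth_on U f -> Cinf U f.
Proof.
move=> sf k; apply: (ladder_Ck k (kappa := id) (as_ := [::]) oU _
  (iter_derive_ladder sf) oU) => //; first exact: Cinf_snd.
exact: Cinf_id.
Qed.

(** Directions are added one at a time, each as a partial derivative of a function already known to
    be smooth. *)
Lemma Cinf_iter_derive (W : normedModType R) (O : set W) (kappa : W -> E) as_ :
  Cinf U f -> open O -> Cinf O kappa -> (forall w, O w -> U (kappa w)) ->
  alls (Cinf O) as_ ->
  Cinf O (fun w => iter_derive f [seq a w | a <- as_] (kappa w)).
Proof.
move=> cf; have [n] : exists n, size as_ = n by exists (size as_).
elim: n W O kappa as_ => [|n IH] W O kappa as_ sz oO ck kU ca.
  by rewrite (size0nil sz); exact: (Cinf_comp (V := U)).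
case/lastP: as_ sz ca => // as_ a; rewrite size_rcons => -[sz] ca.
have [{}ca cas] : alls (Cinf O) as_ /\ Cinf O a.
  by elim: (as_) ca => /= [[]//|b s IHs [? /IHs[]]].
(* The base point is a variable of its own, so that differentiating in it leaves the earlier
   directions fixed. *)
pose H (z : W * E) := iter_derive f [seq a z | a <- [seq a \o fst | a <- as_]] z.2.
have oOU : open (O `*` U) by exact: open_setX.
have cH : Cinf (O `*` U) H.
  apply: IH => //.
  - by rewrite size_map.
  - exact: Cinf_snd.
  - by move=> z [].
  apply: alls_map ca => b cb; apply: (Cinf_comp (V := O)) => //.
    by move=> z [].
  exact: Cinf_fst.
rewrite (_ : (fun w => _) = (fun z => 'D_z.2 H z.1) \o
   (fun w => ((w, kappa w), (0, a w)))); last first.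
  apply/funext => w /=; rewrite derive_snd map_rcons iter_derive_rcons.
  have -> // : (fun u => H (w, u)) = iter_derive f [seq a w | a <- as_].
  by apply/funext => u; rewrite /H -map_comp.
apply: (Cinf_comp (V := (O `*` U) `*` setT)) => //.
- exact: open_setXT.
- by move=> w Ow; do !split => //; exact: kU.
- exact: Cinf_derive.
- apply: Cinf_pair => //; apply: Cinf_pair => //.
    exact: Cinf_id.
  exact: Cinf_cst.
Qed.

(** The base point and n slots as nested pairs: a universal parameter space for words of length n,
    to which the calculus above applies. *)
Fixpoint slot_space (n : nat) : normedModType R :=
  if n is m.+1 then (slot_space m * E)%type else E.

Fixpoint slot_base n : slot_space n -> E :=
  if n is m.+1 then fun z => slot_base z.1 else id.

Fixpoint slots n : seq (slot_space n -> E) :=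
  if n is m.+1 then rcons [seq (fun z : slot_space m.+1 => a z.1) | a <- slots m] snd
  else [::].

Fixpoint slot_point n (u : E) (r : nat -> E) : slot_space n :=
  if n is m.+1 then (slot_point m u r, r m) else u.

Lemma slot_base_point n u r : slot_base (slot_point n u r) = u.
Proof. by elim: n => /=. Qed.

Lemma slots_point n u r :
  [seq a (slot_point n u r) | a <- slots n] = mkseq r n.
Proof.
by elim: n => [//|n IH]; rewrite mkseqS -IH /= map_rcons -map_comp.
Qed.

Lemma slot_base_Cinf n (O : set (slot_space n)) : Cinf O (@slot_base n).
Proof.
suff : Cinf setT (@slot_base n) by move=> c k; apply: (Ck_sub _ (c k)).
elim: n {O} => [|n IH] /=; first exact: Cinf_id.
apply: (Cinf_comp (V := setT) (f := @slot_base n) (g := fst)) => //.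
- exact: openT.
- exact: openT.
- exact: Cinf_fst.
Qed.

Lemma slots_Cinf n : alls (Cinf setT) (slots n).
Proof.
elim: n => [//|n IH] /=; rewrite -cats1; apply: alls_cat.
  apply: alls_map IH => a ca.
  apply: (Cinf_comp (V := setT) (f := a) (g := fst)) => //.
  - exact: openT.
  - exact: openT.
  - exact: Cinf_fst.
by split => //; exact: Cinf_snd.
Qed.

Lemma slot_point_continuous (T : topologicalType) n (u : T -> E)
    (r : nat -> T -> E) (t : T) : {for t, continuous u} ->
  (forall i, {for t, continuous (r i)}) ->
  {for t, continuous (fun t => slot_point n (u t) (r^~ t))}.
Proof.
by move=> cu cr; elim: n => [//|n IH] /=; apply: cvg_pair => //; exact: cr.
Qed.

Lemma Cinf_smooth_on : Cinf U f -> smooth_on U f.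
Proof.
move=> cf; split=> [hs h x Ux|j].
  have := @Cinf_iter_derive E U id [seq (fun=> h) | h <- hs] cf oU.
  rewrite /= (_ : (fun w : E => _) = iter_derive f hs).
    case/(_ _ _ _ 1) => //; first exact: Cinf_id.
      by elim: (hs) => //= k ks IH; split => //; exact: Cinf_cst.
    by move=> _ + _; apply.
  by apply/funext => y; rewrite -map_comp map_id.
apply/within_openP; first by apply: open_comp oU => z _; exact: cvg_fst.
move=> z /= Uz.
(* The default 0 is never read: [slot_point] j uses the indices i < j. *)
pose r (i : nat) (z : E * 'rV[E]_j) : E := if insub i is Some k then z.2 0 k else 0.
pose g (y : slot_space j) := iter_derive f [seq a y | a <- slots j] (slot_base y).
rewrite (_ : (fun z => _) = g \o (fun z => slot_point j z.1 (r^~ z))); last first.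
  apply/funext => y; rewrite /g /= slot_base_point slots_point; congr iter_derive.
  rewrite /mkseq -val_enum_ord -map_comp; apply: eq_map => i /=.
  by rewrite /r valK.
apply: continuous_comp.
  apply: slot_point_continuous; first exact: cvg_fst.
  move=> i; rewrite /r; case: insub => [k|]; last exact: cvg_cst.
  exact: (@continuous_snd_coord E E j (k : 'I_j)).
have oO : open (@slot_base j @^-1` U).
  apply: open_comp oU => y _.
  by apply: (Ck_continuous (@slot_base_Cinf j setT 0%N)).
have := Cinf_iter_derive (O := @slot_base j @^-1` U) cf oO.
move=> /(_ (@slot_base j) (slots j)) /(_ _ _ _ 0%N).
apply => //.
- exact: slot_base_Cinf.
- have := slots_Cinf j; elim: (slots j) => //= a s IH [ca /IH cs]; split => // k.
  exact: Ck_sub (ca k).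
- by rewrite /= slot_base_point.
Qed.

End SmoothOnCinf.

(** * One-parameter subgroups of a local group *)

Lemma norm_triangle3 (R : realType) (E : normedModType R) (a b c : E) (x y : R) :
  `|a - b| <= x -> `|b - c| <= y -> `|a - c| <= x + y.
Proof.
move=> ab bc; have -> : a - c = (a - b) + (b - c) by rewrite subrKA.
by apply: (le_trans (ler_normD _ _)); exact: lerD.
Qed.

Lemma norm_le_sub (R : realType) (E : normedModType R) (a b : E) (x y : R) :
  `|a - b| <= x -> `|b| <= y -> `|a| <= x + y.
Proof. by move=> ab bb; have := norm_triangle3 (c := 0) ab; rewrite !subr0; apply. Qed.

Lemma le_geometric (R : realType) (a b A : R) : 0 <= A ->
  (forall n, a <= b + A / 2 ^+ n) -> a <= b.
Proof.
move=> A0 H; apply/ler_addgt0Pr => e e0.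
pose n := Num.truncn (A / e); apply: (le_trans (H n)); rewrite lerD2l.
rewrite ler_pdivrMr ?exprn_gt0// -ler_pdivrMl// mulrC.
apply: (le_trans (ltW (truncnS_gt _))); rewrite -natrX ler_nat.
exact: ltn_expl.
Qed.

Lemma geometric_cvg (R : realType) (E : completeNormedModType R) (q : nat -> E)
    (A : R) : 0 <= A -> (forall n, `|q n.+1 - q n| <= A / 2 ^+ n.+1) ->
  exists l : E, forall n, `|q n - l| <= A / 2 ^+ n.
Proof.
move=> A0 H.
have qq n k : `|q (n + k)%N - q n| <= A / 2 ^+ n - A / 2 ^+ (n + k).
  elim: k => [|k IH]; first by rewrite addn0 !subrr normr0.
  rewrite addnS; apply: (le_trans (norm_triangle3 (H (n + k)%N) IH)).
  rewrite exprS invfM [A * (_ * _)]mulrCA; lra.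
have qq' n k : (n <= k)%N -> `|q k - q n| <= A / 2 ^+ n.
  move=> nk; rewrite -(subnKC nk); apply: (le_trans (qq _ _)).
  by rewrite gerBl divr_ge0 ?exprn_ge0.
have /cvg_ex[l ql] : cvg (q @ \oo).
  apply/cauchy_cvgP/cauchy_exP => e e0; rewrite /cauchy_ex.
  pose n := Num.truncn (A / e); exists (q n).
  exists n => // k /= nk; rewrite -ball_normE /ball_ /= distrC.
  apply: (le_lt_trans (qq' _ _ nk)).
  rewrite ltr_pdivrMr ?exprn_gt0// -ltr_pdivrMl// mulrC.
  apply: (lt_le_trans (truncnS_gt _)); rewrite -natrX ler_nat.
  exact: ltn_expl.
exists l => n; apply/ler_addgt0Pr => e e0.
have /cvgrPdist_le/(_ e e0)[N _ HN] := ql.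
have h := HN (maxn N n) (leq_maxl _ _); rewrite /= distrC in h.
have h' := qq' n (maxn N n) (leq_maxr _ _); rewrite distrC in h'.
exact: norm_triangle3 h' h.
Qed.

(** * Extension of a local homomorphism from [0, 1] to the real line *)

Section ExtendHom.
Context {R : realType} {G : groupType}.
Variable f : R -> G.
Hypothesis fD : forall s t, 0 <= s -> 0 <= t -> s + t <= 1 ->
  f (s + t) = (f s * f t)%g.

Lemma local_hom0 : f 0 = 1%g.
Proof.
have := fD (lexx 0) (lexx 0); rewrite addr0 => /(_ ler01) /esym h.
by apply: (mulgI (f 0)); rewrite h mulg1.
Qed.

Lemma local_homX b k : 0 <= b -> k%:R * b <= 1 -> f (k%:R * b) = (f b ^+ k)%g.
Proof.
move=> b0; elim: k => [|k IH]; first by rewrite mul0r local_hom0.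
rewrite -natr1 mulrDl mul1r => h; have kb : 0 <= k%:R * b by rewrite mulr_ge0.
by rewrite fD// IH ?expgSr//; apply: le_trans h; rewrite lerDl.
Qed.

Definition local_hom_pos (a : R) : G :=
  (f (a / (Num.truncn a).+1%:R) ^+ (Num.truncn a).+1)%g.

(** Independence of the number of parts: with N parts on one side and M on the other, both sides are
    the (N M)-th power of f (a / (N M)). *)
Lemma local_hom_posE a M : 0 <= a -> (0 < M)%N -> a <= M%:R ->
  local_hom_pos a = (f (a / M%:R) ^+ M)%g.
Proof.
move=> a0 M0 aM; rewrite /local_hom_pos; set N := (Num.truncn a).+1.
have aN : a <= N%:R by rewrite ltW// truncnS_gt.
have NM0 : (0 : R) < (N * M)%:R by rewrite ltr0n muln_gt0.
have N0 : (0 : R) < N%:R by rewrite ltr0n.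
have {}M0 : (0 : R) < M%:R by rewrite ltr0n.
have c0 : 0 <= a / (N * M)%:R by rewrite divr_ge0.
have eN : a / N%:R = M%:R * (a / (N * M)%:R).
  by rewrite natrM; field; rewrite !gt_eqF.
have eM : a / M%:R = N%:R * (a / (N * M)%:R).
  by rewrite natrM; field; rewrite !gt_eqF.
rewrite eN eM !local_homX//.
- by rewrite -!expgnA mulnC.
- by rewrite -eM ler_pdivrMr// mul1r.
- by rewrite -eN ler_pdivrMr// mul1r.
Qed.

Lemma local_hom_posD a b : 0 <= a -> 0 <= b ->
  local_hom_pos (a + b) = (local_hom_pos a * local_hom_pos b)%g.
Proof.
move=> a0 b0; pose M := (Num.truncn (a + b)).+1.
have abM : a + b <= M%:R by rewrite ltW// truncnS_gt.
have aM : a <= M%:R by apply: le_trans abM; rewrite lerDl.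
have bM : b <= M%:R by apply: le_trans abM; rewrite lerDr.
have M0 : (0 : R) < M%:R by rewrite ltr0n.
have ab1 : a / M%:R + b / M%:R <= 1 by rewrite -mulrDl ler_pdivrMr// mul1r.
rewrite (local_hom_posE (addr_ge0 a0 b0) _ abM)// (local_hom_posE a0 _ aM)//.
rewrite (local_hom_posE b0 _ bM)// mulrDl fD ?divr_ge0//.
rewrite expgMn// /commute -!fD ?divr_ge0//; first by rewrite addrC.
by rewrite addrC.
Qed.

Lemma local_hom_posC a b : 0 <= a -> 0 <= b ->
  commute (local_hom_pos a) (local_hom_pos b).
Proof. by move=> a0 b0; rewrite /commute -!local_hom_posD// addrC. Qed.

(** The reals are the group of differences of the nonnegative reals. H a b stands for the value at a
    - b and depends only on this difference, since the values of [local_hom_pos] commute. *)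
Lemma extend_local_hom : exists gamma : R -> G,
  (forall s t, gamma (s + t) = (gamma s * gamma t)%g) /\
  (forall t, 0 <= t <= 1 -> gamma t = f t).
Proof.
pose H a b := (local_hom_pos a * (local_hom_pos b)^-1)%g.
have H_eq a b a' b' : 0 <= a -> 0 <= b -> 0 <= a' -> 0 <= b' ->
    a + b' = a' + b -> H a b = H a' b'.
  move=> a0 b0 a'0 b'0 ab; have := congr1 local_hom_pos ab.
  rewrite !local_hom_posD// => h; rewrite /H.
  have -> : local_hom_pos a =
      (local_hom_pos a' * local_hom_pos b * (local_hom_pos b')^-1)%g.
    by rewrite -h mulgK.
  have cb := commuteV (local_hom_posC b0 b'0).
  by rewrite -(mulgA (local_hom_pos a')) cb mulgA mulgK.
have H_mul a b a' b' : 0 <= a -> 0 <= b -> 0 <= a' -> 0 <= b' ->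
    H (a + a') (b + b') = (H a b * H a' b')%g.
  move=> a0 b0 a'0 b'0; rewrite /H !local_hom_posD//.
  rewrite (local_hom_posC b0 b'0) invgM -!mulgA; congr (_ * _)%g; rewrite !mulgA.
  by rewrite (commuteV (local_hom_posC a'0 b0)).
have max0 (a : R) : 0 <= Num.max a 0 by rewrite le_max lexx orbT.
exists (fun t => H (Num.max t 0) (Num.max (- t) 0)); split=> [s t|t t01].
  rewrite -H_mul//; apply: H_eq => //; rewrite ?addr_ge0//.
  have maxB (a : R) : Num.max a 0 = a + Num.max (- a) 0.
    by rewrite addr_maxr addr0 subrr maxC.
  by rewrite (maxB (s + t)) (maxB s) (maxB t); ring.
have /andP[t0 t1] := t01; rewrite /H (max_l t0) max_r ?oppr_le0// (local_hom_posE (lexx 0) (ltn0Sn 0))//.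
rewrite mul0r local_hom0 expg1 invg1 mulg1 (local_hom_posE t0 (ltn0Sn 0))//.
by rewrite divr1.
Qed.

End ExtendHom.

(** * Dyadic powers in a local group and their limits *)

Section LocalGroup.
Context {R : realType} {E : completeNormedModType R} {G : groupType}.
Variables (phi : E -> G) (m : E -> E -> E) (r C : R).
Implicit Types (a b u x : E) (k l n : nat) (s t : R).

(* [phi] parametrizes a neighborhood of 1 by a ball, in which the multiplication
   reads [m]. The two Lipschitz conditions express that [m] is C^2 with
   [m a b = a + b + O(|a| |b|)]. *)
Record local_group : Prop := LocalGroup {
  lg_r : 0 < r;
  lg_C : 0 <= C;
  lg_m0 : forall a, `|a| < r -> m a 0 = a;
  lg_0m : forall a, `|a| < r -> m 0 a = a;
  lg_M : forall a b, `|a| < r -> `|b| < r -> phi (m a b) = (phi a * phi b)%g;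
  lg_inj : forall a b, `|a| < r -> `|b| < r -> phi a = phi b -> a = b;
  lg_lipl : forall a a' b, `|a| < r -> `|a'| < r -> `|b| < r ->
    `|m a b - m a' b - (a - a')| <= C * `|b| * `|a - a'|;
  lg_lipr : forall a b b', `|a| < r -> `|b| < r -> `|b'| < r ->
    `|m a b - m a b' - (b - b')| <= C * `|a| * `|b - b'| }.

Hypothesis L : local_group.
(** The scale of the construction: 16 rho < r keeps the products formed below inside the ball of
    radius r, and 16 C rho <= 1 makes their quadratic errors small against the linear terms. *)
Variable rho : R.
Hypotheses (rho0 : 0 < rho) (rho_r : 16 * rho < r) (rho_C : 16 * (C * rho) <= 1).

Ltac gen_vars :=
  generalize dependent rho; generalize dependent C; generalize dependent r; intros.
Ltac lra_gen := gen_vars; lra.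
Ltac nra_gen := gen_vars; nra.

Lemma lg_phi0 : phi 0 = 1%g.
Proof.
have r0 : `|0 : E| < r by rewrite normr0 (lg_r L).
have := lg_M L r0 r0; rewrite (lg_m0 L r0) => /esym h.
by apply: (mulgI (phi 0)); rewrite h mulg1.
Qed.

(** The Lipschitz condition in the first argument with a' = 0, where m 0 b = b. *)
Lemma lg_m_add a b : `|a| < r -> `|b| < r -> `|m a b - (a + b)| <= C * `|a| * `|b|.
Proof.
move=> ar br; have r0 : `|0 : E| < r by rewrite normr0 (lg_r L).
have := lg_lipl L ar r0 br; rewrite (lg_0m L br) subr0.
by rewrite -addrA -opprD (addrC b) mulrAC.
Qed.

Lemma lg_m_lipl a a' b : `|a| < r -> `|a'| < r -> `|b| <= 2 * rho ->
  `|m a b - m a' b| <= (1 + C * `|b|) * `|a - a'|.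
Proof.
have C0 := lg_C L.
move=> ar a'r br; have br' : `|b| < r by lra_gen.
rewrite mulrDl mul1r [leRHS]addrC.
exact: norm_le_sub (lg_lipl L ar a'r br') (lexx _).
Qed.

Lemma lg_m_lipr a b b' : `|a| <= 2 * rho -> `|b| < r -> `|b'| < r ->
  `|m a b - m a b'| <= 2 * `|b - b'|.
Proof.
have C0 := lg_C L.
move=> ar br b'r; have ar' : `|a| < r by lra_gen.
have h : C * `|a| <= 1.
  by apply: le_trans rho_C; rewrite mulrCA; apply: ler_wpM2l => //; lra_gen.
have := norm_le_sub (lg_lipr L ar' br b'r) (lexx _).
move/le_trans; apply; have : C * `|a| * `|b - b'| <= 1 * `|b - b'| by apply: ler_wpM2r.
lra_gen.
Qed.

Definition pw (u : E) (k : nat) : E := iter k (m^~ u) 0.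

(** The bounds are proved together: the second keeps the power in the ball, so that the error 2 C k
    |u|^2 of the next product can be added to the first. The sum stays below C ((k + 1) |u|)^2. *)
Lemma pw_bound u k : k%:R * `|u| <= rho ->
  `|pw u k - k%:R *: u| <= C * (k%:R * `|u|) ^+ 2 /\
  `|pw u k| <= 2 * (k%:R * `|u|).
Proof.
have C0 := lg_C L.
have X0 := normr_ge0 u; set X := `|u| in X0 *.
elim: k => [_|k IH]; first by rewrite /pw /= scale0r subr0 normr0 mul0r expr0n /= !mulr0.
rewrite -natr1 mulrDl mul1r; set K := k%:R in IH *; have K0 : 0 <= K by exact: ler0n.
have KX : 0 <= K * X by exact: mulr_ge0.
move=> Yrho; have [] := IH; first lra_gen.
move=> h1 h2; have pr : `|pw u k| < r by lra_gen.
have ur : `|u| < r by rewrite -/X; lra_gen.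
have h3 : `|pw u k.+1 - (K + 1) *: u| <= C * (K * X + X) ^+ 2.
  have ma := lg_m_add pr ur; rewrite -/X in ma.
  have -> : pw u k.+1 - (K + 1) *: u =
      (m (pw u k) u - (pw u k + u)) + (pw u k - K *: u).
    by rewrite /pw /=; rewrite scalerDl scale1r; zmod.
  apply: (le_trans (ler_normD _ _)); apply: (le_trans (lerD ma h1)).
  have : C * `|pw u k| * X <= C * (2 * (K * X)) * X.
    by apply: ler_wpM2r => //; exact: ler_wpM2l.
  have : 0 <= C * (X * X) by rewrite !mulr_ge0.
  nra_gen.
split => //.
have h4 : `|(K + 1) *: u| <= K * X + X.
  by rewrite normrZ ger0_norm ?addr_ge0// mulrDl mul1r.
have := norm_le_sub h3 h4; set Y := K * X + X in Yrho *.
have Y0 : 0 <= Y by rewrite addr_ge0.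
have : C * Y ^+ 2 <= Y.
  rewrite expr2 mulrA ler_piMl//; apply: le_trans rho_C.
  have : C * Y <= C * rho by exact: ler_wpM2l.
  have : 0 <= C * Y by exact: mulr_ge0.
  lra_gen.
lra_gen.
Qed.

Lemma phi_pw u k : k%:R * `|u| <= rho -> phi (pw u k) = (phi u ^+ k)%g.
Proof.
have C0 := lg_C L.
elim: k => [|k IH]; first by rewrite lg_phi0.
rewrite -natr1 mulrDl mul1r => h; have X0 := normr_ge0 u.
have K0 : 0 <= k%:R * `|u| by rewrite mulr_ge0.
have h' : k%:R * `|u| <= rho by lra_gen.
have [_ p2] := pw_bound h'.
rewrite expgSr -IH// -(lg_M L)//; lra_gen.
Qed.

(** Associativity comes from G: both sides lie in the ball on which [phi] is injective and have the
    same image. *)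
Lemma pw_add u k l : (k + l)%:R * `|u| <= rho ->
  pw u (k + l) = m (pw u k) (pw u l).
Proof.
have C0 := lg_C L.
move=> h; have X0 := normr_ge0 u; have := h; rewrite natrD mulrDl => h'.
have K0 : 0 <= k%:R * `|u| by rewrite mulr_ge0.
have L0 : 0 <= l%:R * `|u| by rewrite mulr_ge0.
have hk : k%:R * `|u| <= rho by lra_gen.
have hl : l%:R * `|u| <= rho by lra_gen.
have [_ pk] := pw_bound hk; have [_ pl] := pw_bound hl; have [_ pkl] := pw_bound h.
have kr : `|pw u k| < r by lra_gen.
have lr : `|pw u l| < r by lra_gen.
apply: (lg_inj L); first lra_gen; last first.
  by rewrite (lg_M L)// !phi_pw// expgnDr.
have := norm_le_sub (lg_m_add kr lr) (ler_normD _ _).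
have : C * `|pw u k| * `|pw u l| <= 1 * `|pw u l|.
  apply: ler_wpM2r => //; apply: le_trans rho_C; rewrite mulrCA.
  by apply: ler_wpM2l => //; lra_gen.
lra_gen.
Qed.

Lemma pw_mul u k l : 2 * ((k * l)%:R * `|u|) <= rho -> (0 < k)%N ->
  pw u (k * l) = pw (pw u k) l.
Proof.
have C0 := lg_C L.
move=> h k0; have X0 := normr_ge0 u.
have kl0 : 0 <= (k * l)%:R * `|u| by rewrite mulr_ge0.
have [->|l0] := posnP l; first by rewrite muln0.
have hkl : (k * l)%:R * `|u| <= rho by lra_gen.
have hk : k%:R * `|u| <= rho.
  by apply: le_trans hkl; apply: ler_wpM2r => //; rewrite ler_nat leq_pmulr.
have [_ pk] := pw_bound hk; have [_ pkl] := pw_bound hkl.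
have hl : l%:R * `|pw u k| <= rho.
  apply: le_trans h.
  have -> : 2 * ((k * l)%:R * `|u|) = l%:R * (2 * (k%:R * `|u|)).
    by rewrite natrM; ring.
  exact: ler_wpM2l.
have [_ pl] := pw_bound hl.
apply: (lg_inj L); [lra_gen|lra_gen|].
by rewrite !phi_pw// expgnA.
Qed.

(** A step from k to k + 1 adds 2 |u - u'| and the loss 4 k C |u| |u - u'|. As k |u| <= rho, this
    loss is at most |u - u'| / 4, so the growth is linear in k. *)
Lemma pw_lip u u' k : k%:R * `|u| <= rho -> k%:R * `|u'| <= rho ->
  `|pw u k - pw u' k| <= 4 * (k%:R * `|u - u'|).
Proof.
have C0 := lg_C L.
have X0 := normr_ge0 u; have X'0 := normr_ge0 u'; have D0 := normr_ge0 (u - u').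
elim: k => [|k IH]; first by rewrite /pw /= subrr normr0 !mul0r mulr0.
rewrite -natr1 !mulrDl !mul1r; set K := k%:R in IH *; have K0 : 0 <= K by exact: ler0n.
have KX : 0 <= K * `|u| by exact: mulr_ge0.
have KX' : 0 <= K * `|u'| by exact: mulr_ge0.
move=> h h'; have hk : K * `|u| <= rho by lra_gen.
have hk' : K * `|u'| <= rho by lra_gen.
have [_ p] := pw_bound hk; have [_ p'] := pw_bound hk'.
rewrite -/K in p p'.
have {}IH := IH hk hk'.
have ur : `|u| < r by lra_gen.
have u'r : `|u'| < r by lra_gen.
have pr : `|pw u k| < r by lra_gen.
have pr' : `|pw u' k| < r by lra_gen.
have u2 : `|u| <= 2 * rho by lra_gen.
have p2 : `|pw u' k| <= 2 * rho by lra_gen.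
have := norm_triangle3 (lg_m_lipl pr pr' u2) (lg_m_lipr p2 ur u'r).
move/le_trans; apply; set D := `|u - u'| in D0 IH *.
have h1 : (1 + C * `|u|) * `|pw u k - pw u' k| <= (1 + C * `|u|) * (4 * (K * D)).
  by apply: ler_wpM2l => //; rewrite addr_ge0 ?mulr_ge0.
have h2 : C * (K * `|u|) <= C * rho by exact: ler_wpM2l.
have h3 : C * (K * `|u|) * D <= C * rho * D by exact: ler_wpM2r.
have h4 : 16 * (C * rho) * D <= 1 * D by exact: ler_wpM2r.
nra_gen.
Qed.

Lemma pwS_sub u k : k%:R * `|u| <= rho -> `|u| <= rho ->
  `|pw u k.+1 - pw u k| <= 2 * `|u|.
Proof.
have C0 := lg_C L.
move=> h ur; have [_ pk] := pw_bound h; have X0 := normr_ge0 u.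
have kr : `|pw u k| < r by lra_gen.
have ur' : `|u| < r by lra_gen.
have -> : pw u k.+1 - pw u k = (m (pw u k) u - (pw u k + u)) + u.
  by rewrite /pw /=; zmod.
apply: (le_trans (ler_normD _ _)); apply: (le_trans (lerD (lg_m_add kr ur') (lexx _))).
have : C * `|pw u k| * `|u| <= 1 * `|u|.
  apply: ler_wpM2r => //; apply: le_trans rho_C; rewrite mulrCA.
  by apply: ler_wpM2l => //; lra_gen.
lra_gen.
Qed.

Definition approx (x : E) (t : R) (n : nat) : E :=
  pw (2^-n *: x) (Num.truncn (t * 2 ^+ n)).

Lemma approx_index x t n : 0 <= t ->
  (Num.truncn (t * 2 ^+ n))%:R * `|2^-n *: x| <= t * `|x| /\
  `|(Num.truncn (t * 2 ^+ n))%:R *: (2^-n *: x) - t *: x| <= `|x| / 2 ^+ n.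
Proof.
move=> t0; have p0 : 0 < 2 ^+ n :> R by exact: exprn_gt0.
have /andP[] := truncn_itv (mulr_ge0 t0 (ltW p0)).
rewrite -natr1; set k := (Num.truncn _)%:R => k1 k2.
rewrite scalerA -scalerBl !normrZ; split.
  rewrite gtr0_norm ?invr_gt0// mulrA ler_wpM2r// ler_pdivrMr//.
rewrite mulrC ler_wpM2l// -[leRHS]mul1r ler_pdivlMr//.
rewrite -{2}(gtr0_norm p0) -normrM mulrBl divfK ?gt_eqF//.
rewrite distrC ger0_norm ?subr_ge0//; move: k1 k2; set y := t * _; lra.
Qed.

(** Let u = x / 2^(n+1). The new exponent is 2 k or 2 k + 1. The square of u differs from 2 u by at
    most 4 C |u|^2, so the k-th powers of both differ by at most 16 C k |u|^2 <= |u|. An odd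
    exponent costs another 2 |u|. *)
Lemma approx_step x t n : 4 * `|x| <= rho -> 0 <= t <= 1 ->
  `|approx x t n.+1 - approx x t n| <= 3 * `|x| / 2 ^+ n.+1.
Proof.
have C0 := lg_C L.
move=> xr /andP[t0 t1]; have X0 := normr_ge0 x.
have p0 : 0 < 2 ^+ n :> R by exact: exprn_gt0.
have [kn _] := approx_index x n.+1 t0.
have tx : t * `|x| <= `|x| by rewrite ler_piMl.
set k' := Num.truncn (t * 2 ^+ n.+1) in kn *; set u := 2^-n.+1 *: x in kn *.
rewrite /approx -/u -/k'.
set k := Num.truncn (t * 2 ^+ n).
have -> : 2^-n *: x = 2 *: u :> E.
  by rewrite scalerA exprS invfM mulrA divff// mul1r.
have U0 := normr_ge0 u.
have ux : `|u| <= `|x|.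
  rewrite normrZ gtr0_norm ?invr_gt0 ?exprn_gt0// ler_piMl//.
  by rewrite invf_le1 ?exprn_gt0// -natrX ler1n expn_gt0.
have -> : 3 * `|x| / 2 ^+ n.+1 = 3 * `|u|.
  by rewrite normrZ gtr0_norm ?invr_gt0 ?exprn_gt0// [2^-_ * _]mulrC mulrA.
have kk' : k' = (2 * k)%N \/ k' = (2 * k).+1.
  have /andP[k1 k2] := truncn_itv (mulr_ge0 t0 (ltW p0)).
  have p0' : 0 < 2 ^+ n.+1 :> R by exact: exprn_gt0.
  have /andP[k1' k2'] := truncn_itv (mulr_ge0 t0 (ltW p0')).
  rewrite -/k in k1 k2; rewrite -/k' exprS mulrCA in k1' k2'.
  have a1 : (2 * k <= k')%N.
    have : (2 * k)%:R < k'.+1%:R :> R.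
      by apply: le_lt_trans k2'; rewrite natrM ler_pM2l.
    by rewrite ltr_nat ltnS.
  have a2 : (k' <= (2 * k).+1)%N.
    have : k'%:R < (2 * k.+1)%:R :> R.
      by apply: (le_lt_trans k1'); rewrite natrM ltr_pM2l.
    by rewrite ltr_nat mulnS.
  by move: a1; rewrite leq_eqVlt => /predU1P[->|a1]; [left|right; apply/eqP; rewrite eqn_leq a2].
have k2u : (2 * k)%:R * `|u| <= `|x|.
  have k2k' : (2 * k <= k')%N by case: kk' => ->.
  apply: le_trans tx; apply: le_trans kn.
  by apply: ler_wpM2r => //; rewrite ler_nat.
have k2r : (2 * k)%:R * `|u| <= rho by lra_gen.
have even_step : `|pw u (2 * k) - pw (2 *: u) k| <= `|u|.
  have [->|k0] := posnP k; first by rewrite muln0 /pw /= subrr normr0.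
  have u2 : (2%:R : R) * `|u| <= rho by lra_gen.
  have [b2 b2'] := pw_bound u2.
  have K0 : 0 <= k%:R * `|u| by rewrite mulr_ge0.
  have ku : 2 * (k%:R * `|u|) <= `|x| by move: k2u; rewrite natrM mulrA.
  rewrite pw_mul//; last by lra_gen.
  have c1 : k%:R * `|pw u 2| <= rho.
    have := ler_wpM2l (ler0n R k) b2'; rewrite [k%:R * (2 * (2 * _))](_ : _ = 2 * (2 * (k%:R * `|u|))); last by ring.
    lra_gen.
  have c2 : k%:R * `|2 *: u| <= rho.
    by rewrite normrZ normr_nat mulrCA; lra_gen.
  apply: (le_trans (pw_lip c1 c2)).
  have := ler_wpM2l (ler0n R k) b2; set D := `|_ - _| => hD.
  have e1 : k%:R * (C * (2 * `|u|) ^+ 2) = 4 * (C * (k%:R * `|u|)) * `|u| by ring.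
  rewrite e1 in hD.
  have : C * (k%:R * `|u|) * `|u| <= 1 / 16 * `|u|.
    apply: ler_wpM2r => //; have : C * (k%:R * `|u|) <= C * rho.
      by apply: ler_wpM2l => //; lra_gen.
    by lra_gen.
  by lra_gen.
case: kk' => ->; first by lra_gen.
have ur : `|u| <= rho by lra_gen.
have := norm_triangle3 (pwS_sub k2r ur) even_step.
by lra_gen.
Qed.

(** The limit inherits the quadratic estimate from [pw_bound]. It is a homomorphism because the
    approximants are one up to an error O(2^-n). *)
Lemma local_flow x : 4 * `|x| <= rho -> exists f : R -> E,
  [/\ forall t, 0 <= t <= 1 -> `|f t - t *: x| <= C * (t * `|x|) ^+ 2,
      forall t, 0 <= t <= 1 -> `|f t| <= rho &
      forall s t, 0 <= s -> 0 <= t -> s + t <= 1 ->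
        phi (f (s + t)) = (phi (f s) * phi (f t))%g].
Proof.
have C0 := lg_C L.
move=> xr; have X0 := normr_ge0 x.
have lim_ex t : exists l : E, 0 <= t <= 1 -> forall n, `|approx x t n - l| <= 3 * `|x| / 2 ^+ n.
  have [t01|] := boolP (0 <= t <= 1); last by exists 0.
  have [||l Hl] := @geometric_cvg R E (approx x t) (3 * `|x|).
  - by rewrite mulr_ge0.
  - by move=> n; exact: approx_step.
  by exists l.
have /choice[f Hf] := lim_ex.
have fx t : 0 <= t <= 1 -> `|f t - t *: x| <= C * (t * `|x|) ^+ 2.
  move=> t01; have /andP[t0 t1] := t01.
  (* 4 = 3 + 1: the distance to the approximant and the rounding of t 2^n. *)
  apply: (@le_geometric _ _ _ (4 * `|x|)); first by rewrite mulr_ge0.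
  move=> n; have h1 := Hf t t01 n; rewrite distrC in h1.
  have [h2 h3] := approx_index x n t0.
  have tx : t * `|x| <= `|x| by rewrite ler_piMl.
  have [|h4 _] := @pw_bound (2^-n *: x) (Num.truncn (t * 2 ^+ n)); first by lra_gen.
  have := norm_triangle3 (norm_triangle3 h1 h4) h3.
  have h5 : C * ((Num.truncn (t * 2 ^+ n))%:R * `|2^-n *: x|) ^+ 2 <= C * (t * `|x|) ^+ 2.
    apply: ler_wpM2l => //; rewrite !expr2.
    by apply: ler_pM => //; rewrite mulr_ge0.
  have -> : 3 * `|x| / 2 ^+ n = 3 * (`|x| / 2 ^+ n) by rewrite mulrA.
  have -> : 4 * `|x| / 2 ^+ n = 4 * (`|x| / 2 ^+ n) by rewrite mulrA.
  by lra_gen.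
have frho t : 0 <= t <= 1 -> `|f t| <= rho.
  move=> t01; have /andP[t0 t1] := t01.
  have tx : t * `|x| <= `|x| by rewrite ler_piMl.
  have T0 : 0 <= t * `|x| by rewrite mulr_ge0.
  have h : `|t *: x| <= `|x| by rewrite normrZ ger0_norm.
  have := norm_le_sub (fx t t01) h.
  have : C * (t * `|x|) ^+ 2 <= 1 * (t * `|x|).
    rewrite expr2 mulrA; apply: ler_wpM2r => //.
    have : C * (t * `|x|) <= C * rho by apply: ler_wpM2l => //; lra_gen.
    have : 0 <= C * rho by rewrite mulr_ge0// ltW.
    by lra_gen.
  by lra_gen.
exists f; split => // s t s0 t0 st1; apply/eqP.
have s01 : 0 <= s <= 1 by lra_gen.
have t01 : 0 <= t <= 1 by lra_gen.
have st01 : 0 <= s + t <= 1 by rewrite addr_ge0.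
have fsr := frho _ s01; have ftr := frho _ t01; have fstr := frho _ st01.
have fsr' : `|f s| < r by lra_gen.
have ftr' : `|f t| < r by lra_gen.
rewrite -(lg_M L)//; apply/eqP; congr phi; apply/eqP.
rewrite -subr_eq0 -normr_le0.
(* 17 = 3 + 2 + 6 + 6: the approximation at s + t, the rounding of the exponents, and the
   approximations at s and at t, each doubled by the Lipschitz constant 2 of [m]. *)
apply: (@le_geometric _ _ _ (17 * `|x|)); first by rewrite mulr_ge0.
move=> n; rewrite add0r.
have p0 : 0 < 2 ^+ n :> R by exact: exprn_gt0.
have h1 := Hf _ st01 n; rewrite distrC in h1.
have hs := Hf _ s01 n; have ht := Hf _ t01 n.
have [is_ _] := approx_index x n s0; have [it _] := approx_index x n t0.
have [ist _] := approx_index x n (addr_ge0 s0 t0).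
move: h1 hs ht; rewrite /approx; set u := 2^-n *: x in is_ it ist *.
set k := Num.truncn ((s + t) * _) in ist *; set ks := Num.truncn (s * _) in is_ *.
set kt := Num.truncn (t * _) in it * => h1 hs ht.
have sx : (s + t) * `|x| <= `|x| by rewrite ler_piMl.
have sx0 : 0 <= s * `|x| by rewrite mulr_ge0.
have tx0 : 0 <= t * `|x| by rewrite mulr_ge0.
rewrite mulrDl in sx ist.
have U0 := normr_ge0 u.
have ux : `|u| = `|x| / 2 ^+ n.
  by rewrite normrZ gtr0_norm ?invr_gt0// mulrC.
have ux' : `|u| <= `|x|.
  by rewrite ux ler_piMr// invf_le1// -natrX ler1n expn_gt0.
have hkk : (ks + kt)%:R * `|u| <= rho by rewrite natrD mulrDl; lra_gen.
(* Rounding s 2^n and t 2^n down separately loses at most 1. *)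
have kE : k = (ks + kt)%N \/ k = (ks + kt).+1.
  have /andP[a1 a2] := truncn_itv (mulr_ge0 s0 (ltW p0)).
  have /andP[b1 b2] := truncn_itv (mulr_ge0 t0 (ltW p0)).
  have /andP[c1 c2] := truncn_itv (mulr_ge0 (addr_ge0 s0 t0) (ltW p0)).
  rewrite -/ks in a1 a2; rewrite -/kt in b1 b2; rewrite -/k mulrDl in c1 c2.
  have d1 : (ks + kt <= k)%N.
    by rewrite -ltnS -(ltr_nat R) natrD; apply: le_lt_trans c2; exact: lerD.
  have d2 : (k <= (ks + kt).+1)%N.
    rewrite -ltnS -(ltr_nat R) -addSn -addnS natrD.
    by apply: (le_lt_trans c1); exact: ltrD.
  by move: d1; rewrite leq_eqVlt => /predU1P[->|d1]; [left|right; apply/eqP; rewrite eqn_leq d2].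
have ur : `|u| <= rho by lra_gen.
have h2 : `|pw u k - m (pw u ks) (pw u kt)| <= 2 * `|u|.
  rewrite -pw_add//; case: kE => ->; last exact: pwS_sub.
  by rewrite subrr normr0; lra_gen.
have hks : ks%:R * `|u| <= rho by lra_gen.
have hkt : kt%:R * `|u| <= rho by lra_gen.
have [_ ps] := pw_bound hks; have [_ pt] := pw_bound hkt.
have psr : `|pw u ks| < r by lra_gen.
have ptr : `|pw u kt| < r by lra_gen.
have pt2 : `|pw u kt| <= 2 * rho by lra_gen.
have fs2 : `|f s| <= 2 * rho by lra_gen.
have h3 := norm_triangle3 (lg_m_lipl psr fsr' pt2) (lg_m_lipr fs2 ptr ftr').
have h4 : (1 + C * `|pw u kt|) * `|pw u ks - f s| <= 2 * `|pw u ks - f s|.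
  apply: ler_wpM2r => //; have : C * `|pw u kt| <= C * (2 * rho) by exact: ler_wpM2l.
  by lra_gen.
have := norm_triangle3 (norm_triangle3 h1 h2) h3.
rewrite -!mulrA -!ux in hs ht h1 *.
by lra_gen.
Qed.

(** For t >= 0 the point a is the local flow at t. For t = - s < 0 it is the inverse b of f s in the
    ball; m (f s) b = 0 forces b = - f s up to a quadratic error. *)
Lemma lg_one_parameter x : 4 * `|x| <= rho ->
  (exists2 r', 0 < r' & forall a, `|a| < r' ->
     exists2 b, `|b| <= rho & phi b = ((phi a)^-1)%g) ->
  exists gamma : R -> G, (forall s t, gamma (s + t) = (gamma s * gamma t)%g) /\
  exists2 tau, 0 < tau & forall t, `|t| < tau ->
    exists a, [/\ phi a = gamma t, `|a| <= rho & `|a - t *: x| <= 9 * (C * (t * `|x|) ^+ 2)].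
Proof.
have C0 := lg_C L; move=> xr [r' r'0 inv]; have X0 := normr_ge0 x.
have [f [fx frho fD]] := local_flow xr.
have [gamma [gD gf]] := @extend_local_hom R G (phi \o f) fD.
(* For |t| below this bound the flow at |t| has norm at most 2 |t| |x| < r', so that its inverse is
   available. *)
exists gamma; split => //; exists (Num.min 1 (r' / (2 * `|x| + 1))).
  by rewrite lt_min ltr01 divr_gt0//; lra_gen.
have g0 : gamma 0 = 1%g.
  by apply: (mulgI (gamma 0)); rewrite -gD addr0 mulg1.
move=> t; rewrite lt_min => /andP[t1 tr'].
have [t0|t0] := leP 0 t.
  have t01 : 0 <= t <= 1 by rewrite t0 -(ger0_norm t0) ltW.
  exists (f t); split; [by rewrite gf|exact: frho|].
  apply: (le_trans (fx _ t01)).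
  have : 0 <= C * (t * `|x|) ^+ 2 by rewrite mulr_ge0// sqr_ge0.
  by lra_gen.
pose s := - t; have s0 : 0 < s by rewrite oppr_gt0.
have ts : `|t| = s by rewrite ltr0_norm.
rewrite ts in t1 tr'; have s01 : 0 <= s <= 1 by rewrite !ltW.
rewrite ltr_pdivlMr in tr'; last by lra_gen.
set y := s * `|x|; have Y0 : 0 <= y by rewrite mulr_ge0// ltW.
have yx : y <= `|x| by rewrite ler_piMl// ltW.
have ax := fx _ s01; rewrite -/y in ax.
have sx : `|s *: x| = y by rewrite normrZ gtr0_norm.
have Cy : C * y ^+ 2 <= 1 / 16 * y.
  rewrite expr2 mulrA; apply: ler_wpM2r => //.
  have : C * y <= C * rho by apply: ler_wpM2l => //; lra_gen.
  by lra_gen.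
have a2 : `|f s| <= 2 * y.
  by have := norm_le_sub ax (lexx _); rewrite sx; lra_gen.
have ar' : `|f s| < r'.
  apply: le_lt_trans a2 _; apply: le_lt_trans tr'.
  by rewrite mulrDr mulrCA -/y mulr1; lra_gen.
have [b br bf] := inv _ ar'.
have gb : phi b = gamma t.
  by rewrite bf; have := gf _ s01 => /= <-; apply: (mulgI (gamma s)); rewrite mulgV -gD addNr g0.
exists b; split => //.
have ar : `|f s| < r by have := frho _ s01; lra_gen.
have br2 : `|b| < r by lra_gen.
have mab : m (f s) b = 0.
  have Ca : C * `|f s| * `|b| <= 1 * `|b|.
    apply: ler_wpM2r => //; have : C * `|f s| <= C * rho by apply: ler_wpM2l => //; exact: frho.
    by lra_gen.
  apply: (lg_inj L).
  - have := norm_le_sub (lg_m_add ar br2) (ler_normD _ _); have := frho _ s01; lra_gen.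
  - by rewrite normr0 (lg_r L).
  - by rewrite (lg_M L)// bf mulgV lg_phi0.
have := lg_m_add ar br2; rewrite mab sub0r normrN => h1.
have hC : C * `|f s| * `|b| <= 1 / 2 * `|b|.
  apply: ler_wpM2r => //; have : C * `|f s| <= C * rho by apply: ler_wpM2l => //; exact: frho.
  by lra_gen.
have b2 : `|b| <= 2 * `|f s|.
  have h2 : `|b - - f s| <= 1 / 2 * `|b|.
    by rewrite opprK addrC; apply: le_trans h1 hC.
  by have := norm_le_sub h2 (lexx _); rewrite normrN; lra_gen.
have h3 : `|b - - f s| <= C * `|f s| * `|b| by rewrite opprK addrC.
have h4 : `|- f s - t *: x| <= C * y ^+ 2.
  by rewrite -opprD normrN -(opprK t) scaleNr -/s.
apply: (le_trans (norm_triangle3 h3 h4)).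
have e2 : (t * `|x|) ^+ 2 = y ^+ 2 by rewrite /y /s mulNr sqrrN.
rewrite e2.
(* 8 C y^2 from here and C y^2 from [h4] give the factor 9. *)
have : C * `|f s| * `|b| <= C * (2 * y) * (4 * y).
  apply: ler_pM => //; first by rewrite mulr_ge0.
    exact: ler_wpM2l.
  by lra_gen.
by rewrite expr2; nra_gen.
Qed.

Lemma hom_natmul (gamma : R -> G) t k :
  (forall s t, gamma (s + t) = (gamma s * gamma t)%g) ->
  gamma (k%:R * t) = (gamma t ^+ k)%g.
Proof.
move=> gD; elim: k => [|k IH].
  by rewrite mul0r expg0; apply: (mulgI (gamma 0)); rewrite -gD addr0 mulg1.
by rewrite -natr1 mulrDl mul1r gD IH expgSr.
Qed.

(** For large k the values at 1 / k are given by points within e / k of y / k. By [pw_lip] their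
    k-th powers, which represent the values at 1, differ by at most 8 e, and e is arbitrary. *)
Lemma lg_one_parameter_unique y (gamma1 gamma2 : R -> G) : 2 * `|y| <= rho ->
  (forall gamma, gamma = gamma1 \/ gamma = gamma2 ->
     (forall s t, gamma (s + t) = (gamma s * gamma t)%g) /\
     forall e, 0 < e -> exists2 tau, 0 < tau & forall t, `|t| < tau ->
       exists2 a, phi a = gamma t & `|a - t *: y| <= e * `|t|) ->
  gamma1 1 = gamma2 1.
Proof.
have C0 := lg_C L.
move=> yr H; have Y0 := normr_ge0 y.
have key e : 0 < e -> 2 * e <= rho -> exists b1 b2,
    [/\ phi b1 = gamma1 1, phi b2 = gamma2 1, `|b1| < r, `|b2| < r & `|b1 - b2| <= 8 * e].
  move=> e0 er.
  have [g1D /(_ e e0)[t1 t10 H1]] := H gamma1 (or_introl erefl).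
  have [g2D /(_ e e0)[t2 t20 H2]] := H gamma2 (or_intror erefl).
  have tm : 0 < Num.min t1 t2 by rewrite lt_min t10.
  pose k := (Num.truncn (Num.min t1 t2)^-1).+1.
  have k0 : (0 : R) < k%:R by rewrite ltr0n.
  have kt : `|k%:R^-1 : R| < Num.min t1 t2.
    rewrite gtr0_norm ?invr_gt0// -[ltRHS]invrK ltf_pV2 ?posrE ?invr_gt0//.
    exact: truncnS_gt.
  move: kt; rewrite lt_min => /andP[kt1 kt2].
  have [a1 pa1 ha1] := H1 _ kt1; have [a2 pa2 ha2] := H2 _ kt2.
  rewrite gtr0_norm ?invr_gt0// in ha1 ha2.
  have ka (a : E) : `|a - k%:R^-1 *: y| <= e * k%:R^-1 -> k%:R * `|a| <= rho.
    move=> ha; have := norm_le_sub ha (lexx _).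
    rewrite normrZ gtr0_norm ?invr_gt0// mulrC -mulrDr => /(ler_wpM2l (ltW k0)).
    by rewrite mulrA divff ?gt_eqF// mul1r; lra_gen.
  have ka1 := ka _ ha1; have ka2 := ka _ ha2.
  have [_ b1] := pw_bound ka1; have [_ b2] := pw_bound ka2.
  exists (pw a1 k), (pw a2 k); split.
  - by rewrite phi_pw// pa1 -hom_natmul// divff// gt_eqF.
  - by rewrite phi_pw// pa2 -hom_natmul// divff// gt_eqF.
  - by lra_gen.
  - by lra_gen.
  apply: (le_trans (pw_lip ka1 ka2)).
  rewrite distrC in ha2; have := norm_triangle3 ha1 ha2 => /(ler_wpM2l (ltW k0)).
  rewrite [k%:R * (_ + _)](_ : _ = 2 * e * (k%:R / k%:R)); last by ring.
  by rewrite divff ?gt_eqF//; lra_gen.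
(* A first choice of e fixes the representatives b1, b2; those found for smaller e coincide with
   them by injectivity of [phi]. *)
have [|b1 [b2 [p1 p2 r1 r2 _]]] := key (rho / 2) (divr_gt0 rho0 (ltr0Sn R 1)).
  by lra_gen.
rewrite -p1 -p2; congr phi; apply/eqP; rewrite -subr_eq0 -normr_le0.
apply/ler_addgt0Pr => e e0; rewrite add0r.
pose e' := Num.min (e / 8) (rho / 2).
have e'0 : 0 < e' by rewrite lt_min !divr_gt0.
have e'1 : e' <= e / 8 by rewrite ge_min lexx.
have e'2 : e' <= rho / 2 by rewrite ge_min lexx orbT.
have [|c1 [c2 [q1 q2 s1 s2 h]]] := key _ e'0; first by lra_gen.
have e1 : c1 = b1 by apply: (lg_inj L) => //; rewrite q1.
have e2 : c2 = b2 by apply: (lg_inj L) => //; rewrite q2.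
by rewrite e1 e2 in h; lra_gen.
Qed.

End LocalGroup.

(** * Group operations in charts *)

Lemma open_preimage_within (S T : topologicalType) (A : set S) (B : set T)
    (f : S -> T) : open A -> open B ->
  (forall x, A x -> {for x, continuous f}) -> open (A `&` f @^-1` B).
Proof.
move=> oA oB cf; rewrite openE => x [Ax Bfx]; apply: filterI.
  exact: open_nbhs_nbhs.
by apply: (cf x Ax); exact: open_nbhs_nbhs.
Qed.

Lemma Cinf_local (R : realType) (E F : normedModType R) (U : set E) (f : E -> F) :
  (forall x, U x -> exists2 U', U' x & Cinf U' f) -> Cinf U f.
Proof. by move=> H k; apply: Ck_local => x /H[U' U'x cf]; exists U'. Qed.

Lemma Cinf_ext (R : realType) (E F : normedModType R) (U : set E) (f g : E -> F) :
  open U -> (forall x, U x -> f x = g x) -> Cinf U f -> Cinf U g.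
Proof. by move=> oU fg cf k; apply: Ck_ext fg _. Qed.

Lemma Cinf_sub (R : realType) (E F : normedModType R) (U U' : set E) (f : E -> F) :
  U' `<=` U -> Cinf U f -> Cinf U' f.
Proof. by move=> UU' cf k; apply: Ck_sub UU' _. Qed.

Lemma Cinf_continuous (R : realType) (E F : normedModType R) (U : set E) (f : E -> F) x :
  Cinf U f -> U x -> {for x, continuous f}.
Proof. by move=> /(_ 0%N); apply: Ck_continuous. Qed.

Section Charts.
Context {R : realType} {E : completeNormedModType R} {G : banachLieGroupType E}.
Implicit Types (p q r g : G) (u v : E).

Local Notation dom p := (cdom (chart_at (p : G) : chart G E)).
Local Notation cod p := (ccod (chart_at (p : G) : chart G E)).
Local Notation cm p := (cmap (chart_at (p : G) : chart G E)).
Local Notation ci p := (cinv (chart_at (p : G) : chart G E)).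

Let is_chart_at p : is_chart (chart_at p : chart G E).
Proof. exact: (atlas_chart chart_at_smooth p). Qed.

Lemma chart_dom_open p : open (dom p). Proof. exact: cdom_open. Qed.
Lemma chart_cod_open p : open (cod p). Proof. exact: ccod_open. Qed.
Lemma chart_dom_self p : dom p p. Proof. exact: (atlas_mem chart_at_smooth). Qed.
Lemma chart_invK p u : cod p u -> cm p (ci p u) = u.
Proof. exact: (cinvK (is_chart_at p)). Qed.
Lemma chart_mapK p g : dom p g -> ci p (cm p g) = g.
Proof. exact: (cmapK (is_chart_at p)). Qed.
Lemma chart_map_cod p g : dom p g -> cod p (cm p g).
Proof. exact: (cmap_cod (is_chart_at p)). Qed.
Lemma chart_inv_dom p u : cod p u -> dom p (ci p u).
Proof. exact: (cinv_dom (is_chart_at p)). Qed.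

Lemma chart_inv_continuous p u : cod p u -> {for u, continuous (ci p)}.
Proof.
by move: u; apply/within_openP; [exact: chart_cod_open|exact: cinv_continuous].
Qed.

Lemma chart_map_continuous p g : dom p g -> {for g, continuous (cm p)}.
Proof.
by move: g; apply/within_openP; [exact: chart_dom_open|exact: cmap_continuous].
Qed.

Lemma lie_mul_continuous (g h : G) :
  {for (g, h), continuous (fun z : G * G => (z.1 * z.2)%g)}.
Proof. exact: (@lie_mul_smooth R E G).1. Qed.

Lemma lie_inv_continuous (g : G) : {for g, continuous (fun g : G => (g^-1)%g)}.
Proof. exact: (@lie_inv_smooth R E G).1. Qed.

Lemma continuous_lie_mul (T : topologicalType) (f h : T -> G) (t : T) :
  {for t, continuous f} -> {for t, continuous h} ->
  {for t, continuous (fun t => (f t * h t)%g)}.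
Proof.
move=> cf ch.
apply: (continuous_comp (f := fun t => (f t, h t)) (g := fun z : G * G => (z.1 * z.2)%g)).
  exact: (cvg_pair cf ch).
exact: lie_mul_continuous.
Qed.

Lemma continuous_lie_inv (T : topologicalType) (f : T -> G) (t : T) :
  {for t, continuous f} -> {for t, continuous (fun t => (f t)^-1%g)}.
Proof.
move=> cf; apply: (continuous_comp (f := f) (g := fun g : G => (g^-1)%g)) => //.
exact: lie_inv_continuous.
Qed.

Lemma continuous_chart_inv (T : topologicalType) p (f : T -> E) (t : T) :
  cod p (f t) -> {for t, continuous f} -> {for t, continuous (fun t => ci p (f t))}.
Proof.
move=> pf cf; apply: (continuous_comp (f := f) (g := ci p)) => //.
exact: chart_inv_continuous.
Qed.

Definition mul_dom p q r : set (E * E) :=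
  (cod p `*` cod q) `&` (fun z : E * E => (ci p z.1 * ci q z.2)%g) @^-1` dom r.

Lemma mul_dom_open p q r : open (mul_dom p q r).
Proof.
apply: open_preimage_within.
- by apply: open_setX; exact: chart_cod_open.
- exact: chart_dom_open.
move=> z [z1 z2]; apply: continuous_lie_mul; apply: continuous_chart_inv => //.
- exact: cvg_fst.
- exact: cvg_snd.
Qed.

Lemma Cinf_mul p q r :
  Cinf (mul_dom p q r) (fun z : E * E => cm r (ci p z.1 * ci q z.2)%g).
Proof.
apply: smooth_on_Cinf; first exact: mul_dom_open.
exact: (@lie_mul_smooth R E G).2 (p, q) r.
Qed.

Definition inv_dom p r : set E := cod p `&` (fun u => (ci p u)^-1%g) @^-1` dom r.

Lemma inv_dom_open p r : open (inv_dom p r).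
Proof.
apply: open_preimage_within; [exact: chart_cod_open|exact: chart_dom_open|].
by move=> u pu; apply: continuous_lie_inv; apply: continuous_chart_inv => //; exact: cvg_id.
Qed.

Lemma Cinf_inv p r : Cinf (inv_dom p r) (fun u => cm r (ci p u)^-1%g).
Proof.
apply: smooth_on_Cinf; first exact: inv_dom_open.
exact: (@lie_inv_smooth R E G).2 p r.
Qed.

Definition div_dom p q r : set (E * E) :=
  (cod p `*` cod q) `&` (fun z : E * E => ((ci p z.1)^-1 * ci q z.2)%g) @^-1` dom r.

Lemma div_dom_open p q r : open (div_dom p q r).
Proof.
apply: open_preimage_within.
- by apply: open_setX; exact: chart_cod_open.
- exact: chart_dom_open.
move=> z [z1 z2]; apply: continuous_lie_mul.
  by apply: continuous_lie_inv; apply: continuous_chart_inv => //; exact: cvg_fst.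
by apply: continuous_chart_inv => //; exact: cvg_snd.
Qed.

(** Near z0 the inverse is read in the chart around its value at z0, so that the map factors through
    inversion and multiplication in charts. *)
Lemma Cinf_div p q r :
  Cinf (div_dom p q r) (fun z : E * E => cm r ((ci p z.1)^-1 * ci q z.2)%g).
Proof.
apply: Cinf_local => z0 z0D; pose s := ((ci p z0.1)^-1)%g.
pose U := div_dom p q r `&` (inv_dom p s `*` setT).
have oU : open U.
  apply: openI; first exact: div_dom_open.
  by apply: open_setXT; exact: inv_dom_open.
exists U.
  split => //; split => //; split; last exact: chart_dom_self.
  by case: z0D => -[].
apply: (@Cinf_ext _ _ _ _ ((fun z : E * E => cm r (ci s z.1 * ci q z.2)%g) \o
  (fun z : E * E => (cm s (ci p z.1)^-1%g, z.2)))) => //.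
  by move=> z [_ [[_ zs] _]] /=; rewrite chart_mapK.
apply: (Cinf_comp (V := mul_dom s q r)) => //.
- exact: mul_dom_open.
- move=> z [[[_ z2] zr] [[_ zs] _]]; split.
    by split => //=; exact: chart_map_cod.
  by rewrite /preimage /= chart_mapK.
- exact: Cinf_mul.
apply: Cinf_pair => //; last exact: Cinf_snd.
apply: (Cinf_comp (V := inv_dom p s) (f := fun u => cm s (ci p u)^-1%g)) => //.
- exact: inv_dom_open.
- by move=> z [_ []].
- exact: Cinf_inv.
- exact: Cinf_fst.
Qed.

End Charts.

(** * Lipschitz estimate for a product with neutral element 0 *)

Lemma derive_fst (R : realType) (W E F : normedModType R) (H : W * E -> F) w u h :
  'D_(h, 0) H (w, u) = 'D_h (fun w => H (w, u)) w.
Proof.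
rewrite /derive (_ : (fun t => _) = (fun t => t^-1 *:
  (((fun w => H (w, u)) \o shift w) (t *: h) - H (w, u))))//.
apply/funext => t /=; congr (_ *: (H _ - _)).
by rewrite -[LHS]/(t *: h + w, t *: 0 + u) scaler0 add0r.
Qed.

Lemma segment_lt (R : realType) (E : normedModType R) (a b : E) (d t : R) :
  `|a| < d -> `|b| < d -> 0 <= t <= 1 -> `|b + t *: (a - b)| < d.
Proof.
move=> ad bd /andP[t0 t1]; have -> : b + t *: (a - b) = (1 - t) *: b + t *: a.
  by rewrite scalerBl scale1r; lmod.
apply: (le_lt_trans (ler_normD _ _)); rewrite !normrZ (ger0_norm t0).
rewrite ger0_norm ?subr_ge0//.
have [->|tN1] := eqVneq t 1; first by rewrite subrr mul0r add0r mul1r.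
have t1' : 0 < 1 - t by rewrite subr_gt0 lt_neqAle tN1.
have : (1 - t) * `|b| < (1 - t) * d by rewrite ltr_pM2l.
have : t * `|a| <= t * d by rewrite ler_wpM2l// ltW.
by lra.
Qed.

(* The mixed second derivative is bounded near 0 and [M (a, b) - a] vanishes for
   [b = 0], so its derivative in [a] is [O(|b|)]. *)
Lemma C2_lipschitz (R : realType) (E : normedModType R) (M : E * E -> E)
    (O : set (E * E)) : open O -> O (0, 0) -> Ck 2 O M ->
  (exists2 d, 0 < d & forall a : E, `|a| < d -> M (a, 0) = a) ->
  exists r C : R, [/\ 0 < r, 0 <= C & forall a a' b : E,
    `|a| < r -> `|a'| < r -> `|b| < r ->
    `|M (a, b) - M (a', b) - (a - a')| <= C * `|b| * `|a - a'|].
Proof.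
move=> oO O0 M2 [d0 d00 M0].
have M1 : Ck 1 O M by exact: Ck_le M2.
have dM x h : O x -> derivable M x h by case: M1 => _ + _; apply.
pose DM (y : (E * E) * (E * E)) := 'D_y.2 M y.1.
have cDM : Ck 1 (O `*` setT) DM by have [_ _ +] := M2.
have [_ dDM cDDM] := cDM.
have /nbhs_normP[d1 d10 dO] := open_nbhs_nbhs (conj oO O0).
pose y0 : (E * E) * (E * E) := 0.
have Oy0 : ((O `*` setT) `*` setT) ((y0, y0) : ((E * E) * (E * E)) * ((E * E) * (E * E))).
  by split => //; split.
have /continuous_atP/(_ 1 ltr01)[d2 d20 H] := cDDM _ Oy0.
have {}H w : `|w| < d2 -> `|'D_w.2 DM w.1| <= 1.
  move=> wd; rewrite -['D_w.2 DM w.1]subr0 -[X in _ - X](derive0 DM y0).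
  by apply: H; rewrite (_ : (y0, y0) = 0) ?subr0.
pose d := Num.min d0 (Num.min d1 d2).
have d_gt0 : 0 < d by rewrite !lt_min d00 d10.
have dd0 : d <= d0 by rewrite ge_min lexx.
have dd1 : d <= d1 by rewrite !ge_min lexx orbT.
have dd2 : d <= d2 by rewrite !ge_min lexx !orbT.
have inO (a b : E) : `|a| < d -> `|b| < d -> O (a, b).
  move=> ad bd; apply: dO; apply: lt_le_trans dd1.
  by rewrite prod_norm_lt /= !subr0 ad.
have c_gt0 : 0 < 2 / d by rewrite divr_gt0.
(* The second derivative is bounded by 1 only on small arguments. Rescaling b and h to norm d / 2
   makes the bound homogeneous, at the price of a factor 2 / d for each. *)
have scale (F : normedModType R) (v : F) : exists s (v0 : F),
    [/\ v = s *: v0, `|v0| < d, 0 <= s & s = 2 / d * `|v|].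
  have [->|v0] := eqVneq v 0.
    by exists 0, 0; rewrite scaler0 normr0 mulr0; split.
  have nv : 0 < `|v| by rewrite normr_gt0.
  have s0 : 0 < 2 / d * `|v| by rewrite mulr_gt0.
  exists (2 / d * `|v|), ((2 / d * `|v|)^-1 *: v); split => //.
  - by rewrite scalerA divff ?scale1r// gt_eqF.
  - rewrite normrZ gtr0_norm ?invr_gt0//.
    have -> : (2 / d * `|v|)^-1 * `|v| = d / 2 by field; rewrite !gt_eqF.
    by rewrite ltr_pdivrMr// ltr_pMr// ltr1n.
  - exact: ltW.
have claimA (a b h : E) : `|a| < d -> `|b| < d -> `|h| < d ->
    `|'D_(h, 0) M (a, b) - h| <= 2 / d * `|b|.
  move=> ad bd hd.
  have D0 : 'D_(h, 0) M (a, 0) = h.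
    rewrite derive_fst -[RHS](@derive_id _ _ a h); apply: near_eq_derive.
    apply/nbhs_normP; exists (d - `|a|); first by rewrite subr_gt0.
    move=> y ya; apply: M0; have -> : y = (y - a) + a by rewrite subrK.
    by apply: (le_lt_trans (ler_normD _ _)); lra.
  have [s [b0 [bE b0d s0 sE]]] := scale _ b.
  rewrite -sE.
  pose x : (E * E) * (E * E) := ((a, 0), (h, 0)).
  pose k : (E * E) * (E * E) := ((0, b0), (0, 0)).
  have xk t : x + t *: (s *: k) = ((a, t *: b), (h, 0)).
    rewrite [LHS](_ : _ = ((a + t *: (s *: 0), 0 + t *: (s *: b0)),
       (h + t *: (s *: 0), 0 + t *: (s *: 0))))//.
    by rewrite !scaler0 !addr0 add0r -bE.
  have := @mean_value_segment R E ((E * E) * (E * E))%type DM x (s *: k)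
    (fun t => s *: 'D_k DM (x + t *: (s *: k))) 0 s.
  have -> : DM (x + s *: k) - DM x - 0 = 'D_(h, 0) M (a, b) - h.
    by have := xk 1; rewrite !scale1r => ->; rewrite subr0 /DM /x /= D0.
  apply => t /andP[t0 t1].
    apply: is_derive_scale; apply: DeriveDef => //; apply: dDM; rewrite xk.
    split => //; apply: inO => //; apply: le_lt_trans bd.
    by rewrite normrZ ger0_norm// ler_piMl.
  rewrite subr0 normrZ ger0_norm// ler_piMr// xk.
  apply: (H (((a, t *: b), (h, 0)), k)).
  have tb : `|t *: b| < d by apply: le_lt_trans bd; rewrite normrZ ger0_norm// ler_piMl.
  apply: lt_le_trans dd2; rewrite !prod_norm_lt /= ad tb hd b0d.
  by rewrite !normr0 !d_gt0.
have claimB (a b h : E) : `|a| < d -> `|b| < d ->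
    `|'D_(h, 0) M (a, b) - h| <= (2 / d) ^+ 2 * `|b| * `|h|.
  move=> ad bd; have [s [h0 [hE h0d s0 sE]]] := scale _ h.
  have eD : 'D_(h, 0) M (a, b) = s *: 'D_(h0, 0) M (a, b).
    apply/is_deriveE; rewrite (_ : (h, 0) = s *: (h0, 0)); last first.
      by rewrite -[RHS]/(s *: h0, s *: 0) scaler0 -hE.
    apply: is_derive_scale; apply: DeriveDef => //.
    by apply: dM; exact: inO.
  rewrite eD {1}hE -scalerBr normrZ ger0_norm//.
  have -> : (2 / d) ^+ 2 * `|b| * `|h| = s * (2 / d * `|b|) by rewrite sE; ring.
  by apply: ler_wpM2l => //; exact: claimA.
exists d, ((2 / d) ^+ 2); split => //; first exact: sqr_ge0.
move=> a a' b ad a'd bd.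
have xk t : (a', b) + t *: (a - a', 0) = (a' + t *: (a - a'), b) :> E * E.
  by rewrite -[LHS]/(a' + t *: (a - a'), b + t *: 0) scaler0 addr0.
have := @mean_value_segment R E (E * E)%type M (a', b) (a - a', 0)
    (fun t => 'D_(a - a', 0) M ((a', b) + t *: (a - a', 0))) (a - a')
    ((2 / d) ^+ 2 * `|b| * `|a - a'|).
have := xk 1; rewrite !scale1r => ->; rewrite subrKC; apply => t t01.
  rewrite xk; apply: DeriveDef => //; apply: dM; apply: inO => //.
  exact: segment_lt.
by rewrite xk; apply: claimB => //; exact: segment_lt.
Qed.

(** * One-parameter subgroups and the exponential map *)

Section LieLocal.
Context {R : realType} {E : completeNormedModType R} {G : banachLieGroupType E}.

Local Notation dom p := (cdom (chart_at (p : G) : chart G E)).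
Local Notation cod p := (ccod (chart_at (p : G) : chart G E)).
Local Notation cm p := (cmap (chart_at (p : G) : chart G E)).
Local Notation ci p := (cinv (chart_at (p : G) : chart G E)).
Local Notation e := (chart_one G).

Lemma chart_one_cod : cod 1%g e.
Proof. by apply: chart_map_cod; exact: chart_dom_self. Qed.

Lemma chart_one_inv : ci 1%g e = 1%g.
Proof. by apply: chart_mapK; exact: chart_dom_self. Qed.

(** The chart at 1 is recentered, since 1 need not have coordinate 0 in it. *)
Definition lphi (a : E) : G := ci 1%g (e + a).
Definition lmul (a b : E) : E := cm 1%g (lphi a * lphi b)%g - e.

Lemma lphi0 : lphi 0 = 1%g.
Proof. by rewrite /lphi addr0 chart_one_inv. Qed.

Lemma lphi_near : exists2 d : R, 0 < d & forall a : E, `|a| < d -> cod 1%g (e + a).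
Proof.
have /nbhs_normP[d d0 dU] := open_nbhs_nbhs (conj (chart_cod_open (1%g : G)) chart_one_cod).
by exists d => // a ad; apply: dU; rewrite addrC addKr.
Qed.

Lemma lphi_continuous : {for (0 : E), continuous lphi}.
Proof.
apply: continuous_chart_inv; first by rewrite addr0; exact: chart_one_cod.
by apply: cvgD; [exact: cvg_cst|exact: cvg_id].
Qed.

Lemma lie_local_group : exists r C : R, local_group lphi lmul r C.
Proof.
pose T (z : E * E) : E * E := (e + z.1, e + z.2).
pose O := T @^-1` mul_dom 1%g 1%g (1%g : G).
have cT (U : set (E * E)) : Cinf U T.
  move=> k; apply: (@Ck_sub _ _ _ _ setT) => //; apply: Ck_pair.
  - exact: openT.
  - by apply: Ck_add; [exact: openT|exact: Ck_cst|exact: Ck_fst].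
  - by apply: Ck_add; [exact: openT|exact: Ck_cst|exact: Ck_snd].
have oO : open O.
  apply: open_comp; last exact: mul_dom_open.
  by move=> z _; exact: (Cinf_continuous (cT setT)).
have O0 : O (0, 0).
  split; first by split; rewrite /= addr0; exact: chart_one_cod.
  by rewrite /preimage /= addr0 chart_one_inv mulg1; exact: chart_dom_self.
pose M (z : E * E) := lmul z.1 z.2.
have cM : Cinf O M.
  move=> k; apply: Ck_add => //; last exact: Ck_cst.
  apply: (Ck_comp (f := fun z : E * E => cm 1%g (ci 1%g z.1 * ci 1%g z.2)%g) (g := T)
    (V := mul_dom 1%g 1%g (1%g : G))) => //.
  - exact: mul_dom_open.
  - exact: Cinf_mul.
  - exact: cT.
have [d d0 dcod] := lphi_near.
have M0 a : `|a| < d -> lmul a 0 = a.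
  move=> ad; rewrite /lmul lphi0 mulg1 (chart_invK (dcod a ad)).
  by rewrite addrAC subrr add0r.
have M0' a : `|a| < d -> lmul 0 a = a.
  move=> ad; rewrite /lmul lphi0 mul1g (chart_invK (dcod a ad)).
  by rewrite addrAC subrr add0r.
have [|r1 [C1 [r10 C10 H1]]] := C2_lipschitz oO O0 (cM 2).
  by exists d.
(* The estimate in the second argument is the one in the first for the opposite multiplication. *)
pose S (z : E * E) : E * E := (z.2, z.1).
have cS (U : set (E * E)) : Cinf U S.
  move=> k; apply: (@Ck_sub _ _ _ _ setT) => //; apply: Ck_pair.
  - exact: openT.
  - exact: Ck_snd.
  - exact: Ck_fst.
have oSO : open (S @^-1` O).
  by apply: open_comp oO => z _; exact: (Cinf_continuous (cS setT)).
have [|||r2 [C2 [r20 C20 H2]]] := @C2_lipschitz _ _ (M \o S) (S @^-1` O) oSO.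
- exact: O0.
- by apply: (Ck_comp (V := O)) => //; exact: cS.
- by exists d.
have /nbhs_normP[r3 r30 rO] := open_nbhs_nbhs (conj oO O0).
exists (Num.min d (Num.min r1 (Num.min r2 r3))), (C1 + C2); split.
- by rewrite !lt_min d0 r10 r20.
- exact: addr_ge0.
- by move=> a; rewrite lt_min => /andP[ad _]; exact: M0.
- by move=> a; rewrite lt_min => /andP[ad _]; exact: M0'.
- move=> a b; rewrite !lt_min => /and4P[_ _ _ ar] /and4P[_ _ _ br].
  rewrite /lphi /lmul subrKC chart_mapK//.
  have : O (a, b) by apply: rO; rewrite prod_norm_lt /= !subr0 ar.
  by case.
- move=> a b; rewrite !lt_min => /andP[ad _] /andP[bd _] /(congr1 (cm 1%g)).
  by rewrite !chart_invK; [move/addrI|exact: dcod|exact: dcod].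
- move=> a a' b; rewrite !lt_min => /and4P[_ ar _ _] /and4P[_ a'r _ _] /and4P[_ br _ _].
  apply: (le_trans (H1 a a' b ar a'r br)); rewrite -!mulrA ler_wpM2r ?mulr_ge0//.
  by rewrite lerDl.
- move=> a b b'; rewrite !lt_min => /and4P[_ _ ar _] /and4P[_ _ br _] /and4P[_ _ b'r _].
  apply: (le_trans (H2 b b' a br b'r ar)); rewrite -!mulrA ler_wpM2r ?mulr_ge0//.
  by rewrite lerDr.
Qed.

Lemma lie_local_group_radius : exists r C rho : R,
  [/\ local_group lphi lmul r C, 0 < rho, 16 * rho < r & 16 * (C * rho) <= 1].
Proof.
have [r [C L]] := lie_local_group; have r0 := lg_r L; have C0 := lg_C L.
have C1 : 0 < C + 1 by rewrite ltr_wpDl.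
pose rho := Num.min (r / 32) (1 / (16 * (C + 1))).
have rho0 : 0 < rho by rewrite lt_min !divr_gt0// mulr_gt0.
have rho_r : 16 * rho < r.
  have : rho <= r / 32 by rewrite ge_min lexx.
  by lra.
have rho_C : 16 * (C * rho) <= 1.
  have : rho <= 1 / (16 * (C + 1)) by rewrite ge_min lexx orbT.
  rewrite ler_pdivlMr ?mulr_gt0// => h.
  by nra.
by exists r, C, rho.
Qed.

Lemma lie_local_inv (rho : R) : 0 < rho -> exists2 r' : R, 0 < r' &
  forall a : E, `|a| < r' -> exists2 b : E, `|b| <= rho & lphi b = ((lphi a)^-1)%g.
Proof.
move=> rho0.
have D0 : inv_dom 1%g (1%g : G) e.
  split; first exact: chart_one_cod.
  by rewrite /preimage /= chart_one_inv invg1; exact: chart_dom_self.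
have oD := @inv_dom_open R E G 1%g 1%g.
have /continuous_atP/(_ _ rho0)[r1 r10 H1] := Cinf_continuous (@Cinf_inv R E G 1%g 1%g) D0.
have /nbhs_normP[r2 r20 H2] := open_nbhs_nbhs (conj oD D0).
exists (Num.min r1 r2); first by rewrite lt_min r10.
move=> a; rewrite lt_min => /andP[ar1 ar2].
exists (cm 1%g (lphi a)^-1%g - e).
  have := H1 (e + a); rewrite addrAC subrr add0r => /(_ ar1).
  by rewrite chart_one_inv invg1.
rewrite /lphi subrKC chart_mapK//.
have := H2 (e + a); rewrite addrAC subrr add0r => /(_ ar2).
by case.
Qed.

(** Velocity x at 0, stated through [lphi] so that it also provides the coordinates of gamma t for
    small t. *)
Definition tangent_at_one (x : E) (gamma : R -> G) :=
  forall d : R, 0 < d -> exists2 tau : R, 0 < tau & forall t, `|t| < tau ->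
    exists2 a : E, lphi a = gamma t & `|a - t *: x| <= d * `|t|.

Lemma tangent_scale x gamma s :
  tangent_at_one x gamma -> tangent_at_one (s *: x) (fun t => gamma (s * t)).
Proof.
move=> H d d0; have s1 : 0 < `|s| + 1 by rewrite ltr_wpDl.
have [tau tau0 Ht] := H _ (divr_gt0 d0 s1).
exists (tau / (`|s| + 1)); first exact: divr_gt0.
move=> t; rewrite ltr_pdivlMr// => tt.
have st : `|s * t| < tau.
  by apply: le_lt_trans tt; rewrite normrM mulrC ler_wpM2l// lerDl.
have [a pa ha] := Ht _ st; exists a => //; rewrite scalerA mulrC.
apply: (le_trans ha); rewrite normrM mulrA ler_wpM2r// mulrAC ler_pdivrMr//.
by rewrite ler_wpM2l ?(ltW d0)// lerDl.
Qed.

Lemma hom_one (gamma : R -> G) :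
  (forall s t, gamma (s + t) = (gamma s * gamma t)%g) -> gamma 0 = 1%g.
Proof. by move=> gD; apply: (mulgI (gamma 0)); rewrite -gD addr0 mulg1. Qed.

Lemma near_one_dom (gamma : R^o -> G) : {for (0 : R^o), continuous gamma} ->
  gamma 0 = 1%g -> exists2 r : R, 0 < r & forall t, `|t| < r -> dom 1%g (gamma t).
Proof.
move=> cg g0; have nd : nbhs (gamma 0) (dom 1%g).
  rewrite g0; apply: open_nbhs_nbhs.
  by split; [exact: chart_dom_open|exact: chart_dom_self].
have /(@nbhs_normP R R^o)[r r0 Hr] := cg _ nd.
by exists r => // t tr; apply: Hr; rewrite subr0.
Qed.

Section HomTangent.
Variables (x : E) (gamma : R^o -> G).
Hypothesis gammaD : forall s t, gamma (s + t) = (gamma s * gamma t)%g.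
Hypothesis gammaT : tangent_at_one x gamma.

Lemma tangent_chart_derive :
  is_derive (0 : R^o) 1 (cm 1%g \o gamma) x.
Proof.
apply/is_deriveP => d d0; have [r0 r00 rcod] := lphi_near.
have [tau tau0 Ht] := gammaT d0; have x1 : 0 < `|x| + d + 1.
  by have := normr_ge0 x; lra.
exists (Num.min tau (r0 / (`|x| + d + 1))); first by rewrite lt_min tau0 divr_gt0.
move=> t; rewrite lt_min ltr_pdivlMr// => /andP[/Ht[a pa ha] tr].
rewrite /= add0r [t *: _]mulr1 (hom_one gammaD) -pa /lphi chart_invK; last first.
  apply: rcod; have -> : a = (a - t *: x) + t *: x by rewrite subrK.
  apply: (le_lt_trans (ler_normD _ _)); rewrite normrZ; apply: le_lt_trans tr.
  by have := normr_ge0 t; lra.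
by rewrite -/e [e + a]addrC addrK.
Qed.

(** The velocity gives continuity at 0; left translation by gamma t carries it to t. *)
Lemma tangent_continuous : continuous gamma.
Proof.
have c0 : {for (0 : R^o), continuous gamma}.
  move=> A; rewrite (hom_one gammaD) -lphi0 => nA.
  have /nbhs_normP[r r0 rA] := lphi_continuous nA.
  have [tau tau0 Ht] := gammaT ltr01; have x1 : 0 < `|x| + 1 by rewrite ltr_wpDl.
  apply/(@nbhs_normP R R^o); exists (Num.min tau (r / (`|x| + 1))).
    by rewrite lt_min tau0 divr_gt0.
  move=> t; rewrite subr0 lt_min ltr_pdivlMr// => /andP[/Ht[a pa ha] tr].
  rewrite /= -pa; apply: rA; rewrite subr0.
  have -> : a = (a - t *: x) + t *: x by rewrite subrK.
  apply: (le_lt_trans (ler_normD _ _)); rewrite normrZ; apply: le_lt_trans tr.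
  by have := normr_ge0 t; lra.
move=> t; rewrite (_ : gamma = fun s => (gamma t * gamma (s - t))%g); last first.
  by apply/funext => s; rewrite -gammaD subrKC.
apply: continuous_lie_mul; first exact: cvg_cst.
apply: (continuous_comp (f := fun s : R^o => s - t : R^o) (g := gamma)).
  by apply: cvgB; [exact: cvg_id|exact: cvg_cst].
by rewrite subrr.
Qed.

Let U q := gamma @^-1` dom q.

Let U_open q : open (U q).
Proof.
apply: open_comp; last exact: chart_dom_open.
by move=> t _; exact: tangent_continuous.
Qed.

Let mulq q (z : E * E) := cm q (ci q z.1 * ci 1%g z.2)%g.

Let mulq_dom q u : cod q u -> mul_dom q 1%g q (u, e).
Proof.
move=> qu; split; first by split => //; exact: chart_one_cod.
by rewrite /preimage /= chart_one_inv mulg1; exact: chart_inv_dom.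
Qed.

(** As gamma (t + s) = gamma t gamma s, the derivative at t is the velocity at 0 moved by left
    translation, that is, a partial derivative of the multiplication at (gamma t, 1). *)
Lemma tangent_derive q t h : U q t -> is_derive t h (cm q \o gamma)
  ('D_(0, h *: x) (mulq q) (cm q (gamma t), e)).
Proof.
move=> Ut; have Uq := mulq_dom (chart_map_cod Ut).
have d0 : is_derive (0 : R^o) 1 (cm 1%g \o gamma) x by exact: tangent_chart_derive.
have c0 : is_derive (0 : R^o) 1 (fun=> cm q (gamma t)) 0 by exact: is_derive_cst.
have dp : is_derive (0 : R^o) 1 (fun s => (cm q (gamma t), cm 1%g (gamma s))) (0, x).
  exact: is_derive_pair.
have oD := @mul_dom_open R E G q 1%g q.
have Uq' : mul_dom q 1%g q (cm q (gamma t), cm 1%g (gamma 0)).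
  by rewrite (hom_one gammaD).
have dm := is_derive_comp (f := mulq q) oD (@Cinf_mul R E G q 1%g q 1%N) Uq' dp.
rewrite /= (hom_one gammaD) -/e in dm.
have dh : is_derive t h (cm q \o gamma) (h *: 'D_(0, x) (mulq q) (cm q (gamma t), e)).
  rewrite -[X in is_derive _ X](mulr1 h); apply: is_derive_scale.
  apply/is_deriveP => d d_gt0; move/is_deriveP : dm => /(_ d d_gt0)[r r0 Hr].
  have [r' r'0 Hr'] := near_one_dom (@tangent_continuous (0 : R^o)) (hom_one gammaD).
  exists (Num.min r r'); first by rewrite lt_min r0.
  move=> s; rewrite lt_min => /andP[sr sr'].
  have := Hr s sr; have ds := Hr' s sr'.
  rewrite /= add0r [s *: 1]mulr1 /mulq /= !chart_mapK//; last first.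
    by rewrite (hom_one gammaD); exact: chart_dom_self.
  by rewrite -!gammaD addr0.
rewrite (_ : (0, h *: x) = h *: (0, x)); last first.
  by rewrite -[RHS]/(h *: 0, h *: x) scaler0.
have dq := Cinf_is_derive (0, x) (@Cinf_mul R E G q 1%g q) Uq.
by rewrite (is_deriveE (is_derive_scale h dq)).
Qed.

(** Bootstrapping: by [tangent_derive] the tangent map is a smooth function of gamma and h, hence as
    regular as gamma. *)
Lemma tangent_Ck k q : Ck k (U q) (cm q \o gamma).
Proof.
have cc t : U q t -> {for t, continuous (cm q \o gamma)}.
  move=> Ut; apply: continuous_comp; first exact: tangent_continuous.
  exact: chart_map_continuous.
elim: k => [//|k IH]; split => //.
  by move=> t h Ut; have [] := tangent_derive h Ut.
have oUT : open (U q `*` [set: R^o]) by exact: open_setXT.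
apply: (@Ck_ext _ _ _ _ _ ((fun y : (E * E) * (E * E) => 'D_y.2 (mulq q) y.1) \o
  (fun z : R^o * R^o => ((cm q (gamma z.1), e), (0, z.2 *: x))))) => //.
  by move=> [t h] [Ut _] /=; apply/esym/is_deriveE; exact: tangent_derive.
apply: (Ck_comp (V := mul_dom q 1%g q `*` setT)) => //.
- by apply: open_setXT; exact: mul_dom_open.
- move=> z [Uz _]; split => //; apply: mulq_dom; exact: chart_map_cod.
- by apply: Cinf_derive; exact: Cinf_mul.
apply: Ck_pair => //; apply: Ck_pair => //; try exact: Ck_cst.
  apply: (Ck_comp (V := U q) (f := cm q \o gamma)) => //.
    by move=> z [].
  exact: Ck_fst.
apply: Ck_lin.
  move=> z; apply: (continuous_comp (f := snd) (g := fun h : R^o => h *: x)).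
    exact: cvg_snd.
  exact: scalel_continuous.
by move=> a y z /=; rewrite scalerDl scalerA.
Qed.

Lemma tangent_one_parameter_subgroup : one_parameter_subgroup x gamma.
Proof.
split => //; last exact: tangent_chart_derive.
split; first exact: tangent_continuous.
move=> p q; apply: Cinf_smooth_on.
  by rewrite setTI; exact: U_open.
by move=> k; rewrite setTI; exact: tangent_Ck.
Qed.

End HomTangent.

Lemma one_parameter_subgroup_tangent (x : E) (gamma : R^o -> G) :
  one_parameter_subgroup x gamma -> tangent_at_one x gamma.
Proof.
move=> [[cg _] gD /is_deriveP dg] d d0; have [r r0 Hr] := dg d d0.
have g0 := hom_one gD.
have [r' r'0 Hr'] := near_one_dom (cg (0 : R^o)) g0.
exists (Num.min r r'); first by rewrite lt_min r0.
move=> t; rewrite lt_min => /andP[tr tr'].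
have dt : dom 1%g (gamma t) by exact: Hr'.
exists (cm 1%g (gamma t) - e); first by rewrite /lphi subrKC chart_mapK.
by have := Hr t tr; rewrite /= add0r [t *: 1]mulr1 g0.
Qed.

(** The local construction handles a small multiple s x; the time change t -> t / s restores x. *)
Lemma one_parameter_subgroup_ex (x : E) : exists gamma : R^o -> G, one_parameter_subgroup x gamma.
Proof.
have [r [C [rho [L rho0 rho_r rho_C]]]] := lie_local_group_radius.
have C0 := lg_C L.
have x1 : 0 < 4 * (`|x| + 1) by rewrite mulr_gt0// ltr_wpDl.
pose s := rho / (4 * (`|x| + 1)).
have s0 : 0 < s by exact: divr_gt0.
have sx : 4 * `|s *: x| <= rho.
  have x1' : 0 < `|x| + 1 by rewrite ltr_wpDl.
  rewrite normrZ gtr0_norm// /s.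
  have -> : 4 * (rho / (4 * (`|x| + 1)) * `|x|) = rho * (`|x| / (`|x| + 1)).
    by field; rewrite gt_eqF.
  by rewrite ler_piMr ?(ltW rho0)// ler_pdivrMr// mul1r lerDl.
have [gamma [gD [tau tau0 Ht]]] :=
  lg_one_parameter L rho0 rho_r rho_C sx (lie_local_inv rho0).
have gT : tangent_at_one (s *: x) gamma.
  (* The error of the local construction is (K - 1) t^2, which is at most d |t| for |t| < d / K. *)
  move=> d d0; pose K := 9 * (C * `|s *: x| ^+ 2) + 1.
  have K0 : 0 < K by rewrite ltr_wpDl// mulr_ge0// mulr_ge0// sqr_ge0.
  exists (Num.min tau (d / K)); first by rewrite lt_min tau0 divr_gt0.
  move=> t; rewrite lt_min => /andP[/Ht[a [pa _ ha]] td]; exists a => //.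
  apply: (le_trans ha); rewrite ltr_pdivlMr// in td.
  rewrite exprMn -[t ^+ 2](real_normK (num_real t)).
  have -> : 9 * (C * (`|t| ^+ 2 * `|s *: x| ^+ 2)) = (K - 1) * `|t| * `|t|.
    by rewrite /K; ring.
  by rewrite ler_wpM2r//; have := normr_ge0 t; lra.
exists (fun t => gamma (s^-1 * t)); apply: tangent_one_parameter_subgroup.
  by move=> t u; rewrite mulrDr gD.
rewrite -[X in tangent_at_one X](scale1r x) -(mulVf (lt0r_neq0 s0)) -scalerA.
exact: tangent_scale.
Qed.

Lemma one_parameter_subgroup_unique : exists2 d : R, 0 < d &
  forall y (gamma1 gamma2 : R^o -> G), `|y| < d ->
    one_parameter_subgroup y gamma1 -> one_parameter_subgroup y gamma2 ->
    gamma1 1 = gamma2 1.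
Proof.
have [r [C [rho [L rho0 rho_r rho_C]]]] := lie_local_group_radius.
exists (rho / 2); first exact: divr_gt0.
move=> y gamma1 gamma2; rewrite ltr_pdivlMr// mulrC => /ltW yr g1 g2.
apply: (lg_one_parameter_unique L rho0 rho_r rho_C yr) => gamma [] ->; split.
- exact: (ops_morph g1).
- exact: one_parameter_subgroup_tangent.
- exact: (ops_morph g2).
- exact: one_parameter_subgroup_tangent.
Qed.

(** [lie_exp] picks some subgroup with velocity t x. For small t uniqueness identifies its value at
    1 with that of s -> gamma (t s), which is gamma t. *)
Lemma lie_exp_chart (x : E) : exists2 beta : R^o -> E, is_derive (0 : R^o) 1 beta x &
  beta 0 = e /\ \forall t \near (0 : R), lie_exp G (t *: x) = ci 1%g (beta t).
Proof.
have [gamma ops] := one_parameter_subgroup_ex x.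
have gD := ops_morph ops; have g0 := hom_one gD.
have gT := one_parameter_subgroup_tangent ops.
have [d d0 uniq_] := one_parameter_subgroup_unique.
exists (cm 1%g \o gamma); first exact: (ops_deriv ops).
split; first by rewrite /= g0.
have [r r0 Hr] := near_one_dom ((ops_smooth ops).1 (0 : R^o)) g0.
have x1 : 0 < `|x| + 1 by rewrite ltr_wpDl.
apply/(@nbhs_normP R R^o); exists (Num.min r (d / (`|x| + 1))).
  by rewrite lt_min r0 divr_gt0.
move=> t; rewrite subr0 lt_min ltr_pdivlMr// => /andP[tr td].
rewrite /= chart_mapK; last exact: Hr.
have tops : one_parameter_subgroup (t *: x) (fun s : R^o => gamma (t * s)).
  apply: tangent_one_parameter_subgroup; first by move=> s u; rewrite mulrDr gD.
  exact: tangent_scale.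
have : [set g | exists2 gamma : R^o -> G, one_parameter_subgroup (t *: x) gamma & gamma 1 = g]
    (gamma t).
  by exists (fun s : R^o => gamma (t * s)); rewrite ?mulr1.
move=> /(xgetI 1%g) [gamma' ops' geq].
have -> : lie_exp G (t *: x) = gamma' 1 by exact/esym.
rewrite (uniq_ (t *: x) gamma' _ _ ops' tops) ?mulr1//.
by apply: le_lt_trans td; rewrite normrZ ler_wpM2l// lerDl.
Qed.

End LieLocal.

(** * Smooth vectors and the derived representation *)

Lemma is_derive_linear_comp (R : realType) (W E F : normedModType R) (L : E -> F)
    (f : W -> E) w h d : continuous L -> linear L ->
  is_derive w h f d -> is_derive w h (L \o f) (L d).
Proof.
move=> cL lL df.
have L1 : Ck 1 setT L by exact: Ck_lin.
have := is_derive_comp (f := L) openT L1 I df.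
rewrite (_ : 'D_d L (f w) = L d)//; apply: is_deriveE; apply/is_deriveP => e e0.
by exists 1 => // t _; rewrite (addrC (f w)) lL addrK subrr normr0 mulr_ge0// ltW.
Qed.

(** Rescaling x to q-size r / 2 gives the factor 2 / r; the vectors with q x = 0 cannot be rescaled
    and have their own hypothesis. *)
Lemma homogeneous_dominated (R : realType) (E : lmodType R) (p q : E -> R) (r : R) :
  0 < r -> (forall a x, p (a *: x) = `|a| * p x) ->
  (forall a x, q (a *: x) = `|a| * q x) -> (forall x, 0 <= q x) ->
  (forall x, q x = 0 -> p x = 0) -> (forall x, q x < r -> p x <= 1) ->
  forall x, p x <= 2 / r * q x.
Proof.
move=> r0 pZ qZ q_ge0 qp H x; have [q0|q0] := eqVneq (q x) 0.
  by rewrite (qp _ q0) q0 mulr0.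
have {}q0 : 0 < q x by rewrite lt_neqAle eq_sym q0 q_ge0.
pose a := r / (2 * q x); have a0 : 0 < a by rewrite divr_gt0// mulr_gt0.
have : p (a *: x) <= 1.
  apply: H; rewrite qZ gtr0_norm// /a.
  have -> : r / (2 * q x) * q x = r / 2 by field; rewrite gt_eqF.
  by rewrite ltr_pdivrMr// ltr_pMr// ltr1n.
rewrite pZ gtr0_norm// mulrC -ler_pdivlMr// => /le_trans; apply.
by rewrite /a le_eqVlt; apply/orP; left; apply/eqP; field; rewrite !gt_eqF.
Qed.

Lemma alls_rev (T : Type) (P : T -> Prop) (s : seq T) : alls P s -> alls P (rev s).
Proof.
elim: s => [//|x s IH] [Px /IH ss]; rewrite rev_cons -cats1.
exact: alls_cat.
Qed.

Lemma map_cst_seq (S T : Type) (s : S) (xs : seq T) :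
  [seq a s | a <- [seq (fun=> x) | x <- xs]] = xs.
Proof. by elim: xs => //= x xs ->. Qed.

Lemma alls_cst_Cinf (R : realType) (E F : normedModType R) (U : set E) (xs : seq F) :
  alls (Cinf U) [seq (fun=> x) | x <- xs].
Proof. by elim: xs => //= x xs IH; split => //; exact: Cinf_cst. Qed.

Section Rep.
Context {R : realType} {E : completeNormedModType R}
  {G : banachLieGroupType E} {V : completeNormedModType R}.
Variable pi : G -> {linear V -> V}.
Hypothesis hpi : continuous_representation pi.
Implicit Types (p q r g : G) (u : E) (v : V).

Local Notation dom p := (cdom (chart_at (p : G) : chart G E)).
Local Notation cod p := (ccod (chart_at (p : G) : chart G E)).
Local Notation cm p := (cmap (chart_at (p : G) : chart G E)).
Local Notation ci p := (cinv (chart_at (p : G) : chart G E)).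
Local Notation e := (chart_one G).

Definition orbit_map p v u : V := pi (ci p u) v.

Lemma rep_continuous_vec g : continuous (pi g).
Proof.
move=> v; apply: (continuous_comp (f := fun v => (g, v))
  (g := fun z : G * V => pi z.1 z.2)); last exact: (rep_continuous hpi).
exact: (cvg_pair (cvg_cst _) cvg_id).
Qed.

Lemma rep_continuous_group v : continuous (fun g => pi g v).
Proof.
move=> g; apply: (continuous_comp (f := fun g => (g, v))
  (g := fun z : G * V => pi z.1 z.2)); last exact: (rep_continuous hpi).
exact: (cvg_pair cvg_id (cvg_cst _)).
Qed.

Lemma rep_linear g : linear (pi g).
Proof. by move=> a x y; rewrite linearP. Qed.

(** Joint continuity of the action at (g, 0), made homogeneous in v. *)
Lemma rep_bounded_near g : exists2 C : R, 0 < C &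
  nbhs g [set g' | forall v, `|pi g' v| <= C * `|v|].
Proof.
have c0 := @rep_continuous _ _ _ _ _ hpi (g, 0).
have : nbhs (pi g 0) [set w : V | `|w| < 1].
  by rewrite linear0; apply/nbhs_normP; exists 1 => // w; rewrite subr0.
move=> /c0 [[A B] /= [gA /nbhs_normP[d d0 dB]] AB].
exists (2 / d); first exact: divr_gt0.
apply: filterS gA => g' Ag'.
apply: (homogeneous_dominated (p := fun v => `|pi g' v|) d0) => //.
- by move=> a v; rewrite linearZ normrZ.
- exact: normrZ.
- by move=> v /normr0_eq0 ->; rewrite linear0 normr0.
move=> v vd; apply/ltW; apply: (AB (g', v)); split => //.
by apply: dB; rewrite subr0.
Qed.

Lemma rep_bounded_chart p u : cod p u -> exists C r : R, [/\ 0 < C, 0 < r &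
  forall u', `|u' - u| < r -> cod p u' /\ forall v, `|pi (ci p u') v| <= C * `|v|].
Proof.
move=> pu; have [C C0 nC] := rep_bounded_near (ci p u).
have n1 : nbhs u (cod p) by apply: open_nbhs_nbhs; split => //; exact: chart_cod_open.
have n2 : nbhs u (ci p @^-1` [set g' | forall v, `|pi g' v| <= C * `|v|]).
  exact: (chart_inv_continuous pu nC).
move/nbhs_normP : n1 => [r1 r10 H1]; move/nbhs_normP : n2 => [r2 r20 H2].
exists C, (Num.min r1 r2); split => //; first by rewrite lt_min r10.
by move=> u'; rewrite lt_min => /andP[/H1 ? /H2].
Qed.

Definition rep_smooth v := forall p, Cinf (cod p) (orbit_map p v).

(** V has one global chart and orbit maps are continuous since the action is; what remains is
    smoothness in the charts of G. *)
Lemma rep_smoothP v : smooth_vector pi v <-> rep_smooth v.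
Proof.
split=> [[_ H] p|H].
  have := H p v; rewrite /= preimage_setT setIT => /smooth_on_Cinf; apply.
  exact: chart_cod_open.
split=> [|p q]; first exact: rep_continuous_group.
rewrite /= preimage_setT setIT; apply: Cinf_smooth_on; first exact: chart_cod_open.
exact: H.
Qed.

(** From here on the exponential function is gone: [dpi] is a directional derivative in the chart at
    1, which makes it linear in x. *)
Lemma dpiE x v : rep_smooth v -> dpi pi x v = 'D_x (orbit_map 1%g v) e.
Proof.
move=> sv; rewrite /dpi derive1E.
have [beta dbeta [b0 bexp]] := lie_exp_chart (G := G) x.
rewrite (near_eq_derive (g := orbit_map 1%g v \o (beta : R -> E))); last first.
  by apply: filterS bexp => t /= ->.
apply: is_deriveE; rewrite -b0.
apply: (is_derive_comp (W := R^o) (U := cod 1%g)) => //.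
- exact: chart_cod_open.
- exact: (sv 1%g 1%N).
- by rewrite b0; exact: chart_one_cod.
Qed.

Lemma dpi_linear v a x y : rep_smooth v ->
  dpi pi (a *: x + y) v = a *: dpi pi x v + dpi pi y v.
Proof.
move=> sv; rewrite !dpiE//; apply: (C1_derive_linear _ _ _ (@chart_cod_open R E G 1%g)).
- exact: (sv 1%g 1%N).
- exact: chart_one_cod.
Qed.

Lemma rep_smooth_lin a v w : rep_smooth v -> rep_smooth w -> rep_smooth (a *: v + w).
Proof.
move=> sv sw p; have oU := @chart_cod_open R E G p.
apply: (@Cinf_ext _ _ _ _ (fun u => a *: orbit_map p v u + orbit_map p w u)) => //.
  by move=> u _; rewrite /orbit_map linearP.
move=> k; apply: Ck_add => //; last exact: sw.
apply: (Ck_comp (V := setT) (f := fun y : V => a *: y)) => //; last exact: sv.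
  exact: openT.
apply: Ck_lin; first exact: scaler_continuous.
by move=> b x y; rewrite scalerDr !scalerA mulrC.
Qed.

Lemma dpi_linear_vec x a v w : rep_smooth v -> rep_smooth w ->
  dpi pi x (a *: v + w) = a *: dpi pi x v + dpi pi x w.
Proof.
move=> sv sw; rewrite !dpiE//; last exact: rep_smooth_lin.
have dv u := Cinf_is_derive x (sv 1%g) chart_one_cod.
have dw u := Cinf_is_derive x (sw 1%g) chart_one_cod.
apply: is_deriveE.
rewrite (_ : orbit_map 1%g _ = (a \*: orbit_map 1%g v) \+ orbit_map 1%g w).
  by apply: is_deriveD; [apply: is_deriveZ; exact: dv|exact: dw].
by apply/funext => u; rewrite /orbit_map linearP.
Qed.

Definition rep_word v (xs : seq E) : V := foldr (dpi pi) v xs.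

(** The outermost letter of a word is a derivative at 1 of the orbit map of the remaining word.
    Pulled through pi, it is a partial derivative of a function of (w, u) that is smooth by the
    induction hypothesis. *)
Lemma rep_word_Cinf v (W : normedModType R) (O : set W) (kappa : W -> E)
    (as_ : seq (W -> E)) p : rep_smooth v -> open O -> Cinf O kappa ->
  (forall w, O w -> cod p (kappa w)) -> alls (Cinf O) as_ ->
  Cinf O (fun w => pi (ci p (kappa w)) (rep_word v [seq a w | a <- as_])).
Proof.
move=> sv; have [n] : exists n, size as_ = n by exists (size as_).
elim: n W O kappa as_ p => [|n IH] W O kappa as_ p sz oO ck kU ca.
  rewrite (size0nil sz); apply: (Cinf_comp (V := cod p) (f := orbit_map p v)) => //.
  exact: chart_cod_open.
case: as_ sz ca => // a as_ [sz] [ca cas].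
(* The induction hypothesis with constant letters: a shorter word of v is itself a smooth vector. *)
have sword w : rep_smooth (rep_word v [seq a w | a <- as_]).
  move=> q; have oq := @chart_cod_open R E G q; apply: (@Cinf_ext _ _ _ _ (fun u => pi (ci q u)
    (rep_word v [seq a u | a <- [seq (fun=> x) | x <- [seq b w | b <- as_]]]))) => //.
    by move=> u _; rewrite map_cst_seq.
  apply: (IH _ _ id) => //; first by rewrite !size_map.
    exact: Cinf_id.
  exact: alls_cst_Cinf.
(* Differentiating H in u at the coordinate of 1, in direction a w, produces the full word. *)
pose H (z : W * E) :=
  pi (ci p (kappa z.1) * ci 1%g z.2)%g (rep_word v [seq a z.1 | a <- as_]).
have oOU : open (O `*` cod 1%g) by apply: open_setX => //; exact: chart_cod_open.
have cH : Cinf (O `*` cod 1%g) H.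
  apply: Cinf_local => -[w0 u0] [/= Ow0 Uu0].
  (* Near (w0, u0) the product is read in the chart around its value there, which brings H to the
     form of the induction hypothesis. *)
  pose r := (ci p (kappa w0) * ci 1%g u0)%g.
  pose K (z : W * E) := (kappa z.1, z.2).
  have cK : Cinf (O `*` cod 1%g) K.
    apply: Cinf_pair => //; last exact: Cinf_snd.
    apply: (Cinf_comp (V := O)) => //; first by move=> z [].
    exact: Cinf_fst.
  pose O' := (O `*` cod 1%g) `&` K @^-1` mul_dom p 1%g r.
  have oO' : open O'.
    apply: open_preimage_within => //; first exact: mul_dom_open.
    by move=> z Oz; exact: (Cinf_continuous cK).
  exists O'.
    split => //; split; first by split => //; exact: kU.
    exact: chart_dom_self.
  apply: (@Cinf_ext _ _ _ _ (fun z => pi (ci r (cm r (ci p (kappa z.1) * ci 1%g z.2)%g))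
     (rep_word v [seq b z | b <- [seq a \o fst | a <- as_]]))) => //.
    by move=> z [_ [_ zr]]; rewrite chart_mapK// -map_comp.
  apply: IH => //.
  - by rewrite size_map.
  - apply: (Cinf_comp (V := mul_dom p 1%g r) (g := K)
      (f := fun y : E * E => cm r (ci p y.1 * ci 1%g y.2)%g)) => //.
    + exact: mul_dom_open.
    + by move=> z [].
    + exact: Cinf_mul.
    + by apply: Cinf_sub cK => z [].
  - by move=> z [_ [_ zr]]; exact: chart_map_cod.
  - apply: alls_map cas => b cb; apply: (Cinf_comp (V := O)) => //.
      by move=> z [[]].
    exact: Cinf_fst.
apply: (@Cinf_ext _ _ _ _ ((fun z => 'D_z.2 H z.1) \o
   (fun w => ((w, e), (0, a w))))) => //.
  move=> w Ow /=; rewrite derive_snd (dpiE _ (sword w)).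
  apply: is_deriveE; rewrite /H /=.
  rewrite (_ : (fun u => _) = pi (ci p (kappa w)) \o
     orbit_map 1%g (rep_word v [seq a w | a <- as_])); last first.
    by apply/funext => u; rewrite (repM hpi).
  apply: is_derive_linear_comp.
  - exact: rep_continuous_vec.
  - exact: rep_linear.
  - exact: (Cinf_is_derive _ (sword w 1%g) chart_one_cod).
apply: (Cinf_comp (V := (O `*` cod 1%g) `*` setT)) => //.
- exact: open_setXT.
- by move=> w Ow; do !split => //; exact: chart_one_cod.
- exact: Cinf_derive.
- apply: Cinf_pair => //; apply: Cinf_pair => //.
  + exact: Cinf_id.
  + exact: Cinf_cst.
  + exact: Cinf_cst.
Qed.

Lemma rep_word_smooth v xs : rep_smooth v -> rep_smooth (rep_word v xs).
Proof.
move=> sv q; have oq := @chart_cod_open R E G q.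
apply: (@Cinf_ext _ _ _ _ (fun u => pi (ci q u)
  (rep_word v [seq a u | a <- [seq (fun=> x) | x <- xs]]))) => //.
  by move=> u _; rewrite map_cst_seq.
apply: (rep_word_Cinf (kappa := id)) => //; first exact: Cinf_id.
exact: alls_cst_Cinf.
Qed.

Lemma rep_word_linear v xs ys a x y : rep_smooth v ->
  rep_word v (xs ++ (a *: x + y) :: ys) =
  a *: rep_word v (xs ++ x :: ys) + rep_word v (xs ++ y :: ys).
Proof.
move=> sv; elim: xs => [|z xs IH] /=.
  by rewrite dpi_linear//; exact: rep_word_smooth.
by rewrite IH dpi_linear_vec//; exact: rep_word_smooth.
Qed.

Lemma rep_word_scale v c xs : rep_smooth v ->
  rep_word v [seq c *: x | x <- xs] = c ^+ size xs *: rep_word v xs.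
Proof.
move=> sv; have s0 : rep_smooth (0 : V).
  by move=> p k; rewrite (_ : orbit_map p 0 = fun=> 0);
    [exact: Ck_cst|apply/funext => u; exact: linear0].
have d0 x : dpi pi x (0 : V) = 0.
  have := dpi_linear_vec x 1 s0 s0; rewrite !scale1r addr0 => /eqP.
  by rewrite addrC -subr_eq subrr => /eqP <-.
elim: xs => [|x xs IH] /=; first by rewrite expr0 scale1r.
have sw := rep_word_smooth xs sv.
have -> : dpi pi (c *: x) (rep_word v [seq c *: x | x <- xs]) =
    c *: dpi pi x (rep_word v [seq c *: x | x <- xs]).
  have sw' := rep_word_smooth [seq c *: x | x <- xs] sv.
  have := dpi_linear c x 0 sw'; rewrite addr0 => ->.
  have := dpi_linear 1 0 0 sw'; rewrite !scale1r addr0 => /eqP.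
  by rewrite addrC -subr_eq subrr => /eqP <-; rewrite addr0.
rewrite IH; have := dpi_linear_vec x (c ^+ size xs) sw s0; rewrite addr0 => ->.
by rewrite d0 addr0 scalerA exprS.
Qed.

Lemma slot_point_near n u (r : nat -> E) (d : R) : 0 < d ->
  (forall i, `|r i| < d) -> `|slot_point n u r - slot_point n u (fun=> 0)| < d.
Proof.
move=> d0 rd; elim: n => [|n IH] /=; first by rewrite subrr normr0.
by rewrite prod_norm_lt /= IH subr0 rd.
Qed.

(** Words are jointly continuous in their letters at 0 and homogeneous in each letter, hence bounded
    on the unit ball. This is the finiteness of p_n for the norm of V. *)
Lemma rep_word_bounded v n : rep_smooth v -> exists2 C : R, 0 <= C &
  forall xs : seq E, size xs = n -> alls (fun x => `|x| <= 1) xs ->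
    `|rep_word v xs| <= C.
Proof.
move=> sv; pose O := @slot_base R E n @^-1` cod 1%g.
have oO : open O.
  apply: open_comp; last exact: chart_cod_open.
  by move=> y _; apply: (Cinf_continuous (slot_base_Cinf setT)).
pose F (y : slot_space n) := pi (ci 1%g (slot_base y)) (rep_word v [seq a y | a <- slots n]).
have cF : Cinf O F.
  apply: rep_word_Cinf => //; first exact: slot_base_Cinf.
  by have := @slots_Cinf R E n; elim: (slots n) => //= a s IH [ca /IH cs]; split => //;
    apply: Cinf_sub ca.
pose y0 := slot_point n e (fun=> 0).
have Oy0 : O y0 by rewrite /O /preimage /= slot_base_point; exact: chart_one_cod.
have FE (r : nat -> E) : F (slot_point n e r) = rep_word v (mkseq r n).
  by rewrite /F slot_base_point slots_point chart_one_inv (rep1 hpi).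
have /continuous_atP/(_ 1 ltr01)[d d0 Hd] := Cinf_continuous cF Oy0.
have d2 : 0 < 2 / d by exact: divr_gt0.
(* Scaling the n letters by d / 2 brings them into the d-ball, where F is within 1 of F y0. *)
exists ((2 / d) ^+ n * (`|F y0| + 1)).
  by rewrite mulr_ge0 ?exprn_ge0 ?ltW// addr_ge0.
move=> xs sz xs1.
pose ys := [seq (d / 2) *: x | x <- xs].
have -> : rep_word v xs = (2 / d) ^+ n *: rep_word v ys.
  rewrite rep_word_scale// sz scalerA -exprMn.
  have -> : 2 / d * (d / 2) = 1 by field; rewrite gt_eqF.
  by rewrite expr1n scale1r.
rewrite normrZ ger0_norm ?exprn_ge0 ?(ltW d2)// ler_wpM2l ?exprn_ge0 ?(ltW d2)//.
have ysn : ys = mkseq (nth 0 ys) n.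
  by rewrite -[LHS](mkseq_nth 0) /ys size_map sz.
rewrite ysn -FE (addrC _ 1); apply: norm_le_sub (lexx `|F y0|); apply: Hd.
apply: slot_point_near => // i.
have : alls (fun y => `|y| < d) ys.
  rewrite /ys; apply: alls_map xs1 => x x1.
  rewrite normrZ gtr0_norm ?divr_gt0//.
  have : d / 2 * `|x| <= d / 2 * 1 by apply: ler_wpM2l => //; rewrite divr_ge0// ltW.
  by lra.
elim: (ys) i => [|y s IH] [|i] //=; rewrite ?normr0// => -[yd /IH]; exact.
Qed.

End Rep.

(** * Limits of smooth vectors *)

Lemma alls_sub (T : Type) (P Q : T -> Prop) (s : seq T) :
  (forall x, P x -> Q x) -> alls P s -> alls Q s.
Proof. by move=> PQ; elim: s => //= x s IH [/PQ ? /IH]. Qed.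

Lemma alls_norm_bound (R : realType) (E : normedModType R) (xs : seq E) :
  exists2 M : R, 0 < M & alls (fun x => `|x| <= M) xs.
Proof.
elim: xs => [|x xs [M M0 HM]]; first by exists 1.
exists (M + `|x|); first by rewrite ltr_wpDr.
split; first by rewrite lerDr ltW.
by apply: alls_sub HM => y /le_trans; apply; rewrite lerDl.
Qed.

Lemma alls_norm_bound_near (R : realType) (W E : normedModType R) (as_ : seq (W -> E)) w :
  alls (fun a => {for w, continuous a}) as_ ->
  exists M r : R, [/\ 0 < M, 0 < r & forall w', `|w' - w| < r ->
    alls (fun x => `|x| <= M) [seq a w' | a <- as_]].
Proof.
elim: as_ => [|a s IH] /=; first by exists 1, 1; split.
move=> [/continuous_atP/(_ 1 ltr01)[r1 r10 H1] /IH[M [r2 [M0 r20 H2]]]].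
exists (M + (1 + `|a w|)), (Num.min r1 r2); split.
- by rewrite ltr_wpDr// addr_ge0.
- by rewrite lt_min r10.
move=> w'; rewrite lt_min => /andP[/H1 h1 /H2 h2]; split.
  apply: (le_trans (norm_le_sub h1 (lexx _))); by rewrite lerDr ltW.
by apply: alls_sub h2 => y /le_trans; apply; rewrite lerDl addr_ge0.
Qed.

Section Limit.
Context {R : realType} {E : completeNormedModType R}
  {G : banachLieGroupType E} {V : completeNormedModType R}.
Variable pi : G -> {linear V -> V}.
Hypothesis hpi : continuous_representation pi.
Implicit Types (p q r g : G) (u : E) (v : V).

Local Notation dom p := (cdom (chart_at (p : G) : chart G E)).
Local Notation cod p := (ccod (chart_at (p : G) : chart G E)).
Local Notation cm p := (cmap (chart_at (p : G) : chart G E)).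
Local Notation ci p := (cinv (chart_at (p : G) : chart G E)).
Local Notation e := (chart_one G).

Definition chart_div p (z : E * E) : E := cm 1%g ((ci p z.1)^-1 * ci p z.2)%g.

(* Left logarithmic derivative of the parametrization [ci p] of G. *)
Definition left_log p (z : E * E) : E := 'D_(0, z.2) (chart_div p) (z.1, z.1).

Lemma chart_div_dom p u : cod p u -> div_dom p p 1%g (u, u).
Proof.
move=> pu; split; first by split.
by rewrite /preimage /= mulVg; exact: chart_dom_self.
Qed.

Lemma left_log_Cinf p : Cinf (cod p `*` [set: E]) (left_log p).
Proof.
have oU : open (cod p `*` [set: E]) by apply: open_setXT; exact: chart_cod_open.
apply: (Cinf_comp (f := fun y : (E * E) * (E * E) => 'D_y.2 (chart_div p) y.1)
  (g := fun z : E * E => ((z.1, z.1), (0, z.2))) (V := div_dom p p 1%g `*` setT)) => //.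
- by apply: open_setXT; exact: div_dom_open.
- by move=> z [pz _]; split => //; exact: chart_div_dom.
- by apply: Cinf_derive; exact: Cinf_div.
- apply: Cinf_pair => //; apply: Cinf_pair => //.
  + exact: Cinf_fst.
  + exact: Cinf_fst.
  + exact: Cinf_cst.
  + exact: Cinf_snd.
Qed.

Lemma chart_div_derive p u h : cod p u ->
  is_derive u h (fun u' => chart_div p (u, u')) (left_log p (u, h)).
Proof.
move=> pu; have Du := chart_div_dom pu.
have oD := @div_dom_open R E G p p 1%g.
apply: (is_derive_comp (f := chart_div p) (g := fun u' => (u, u')) oD) => //.
  exact: (@Cinf_div R E G p p 1%g 1%N).
exact: is_derive_pair.
Qed.

Lemma left_log_one h : left_log 1%g (e, h) = h.
Proof.
have d := chart_div_derive h chart_one_cod.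
rewrite -(is_deriveE d) -[RHS](@derive_id _ _ e h); apply: near_eq_derive.
have : open_nbhs e (cod 1%g : set E).
  by split; [exact: chart_cod_open|exact: chart_one_cod].
move=> /open_nbhs_nbhs; apply: filterS => u pu.
by rewrite /chart_div /= chart_one_inv invg1 mul1g chart_invK.
Qed.

(** The orbit map at u' is pi (ci p u) applied to the orbit of the quotient of ci p u' by ci p u.
    This quotient stays near 1, where [dpiE] applies. *)
Lemma orbit_map_derive p v u h : rep_smooth pi v -> cod p u ->
  is_derive u h (orbit_map pi p v) (pi (ci p u) (dpi pi (left_log p (u, h)) v)).
Proof.
move=> sv pu; have Du := chart_div_dom pu.
have oD := @div_dom_open R E G p p 1%g.
apply: (@near_eq_is_derive _ _ _ (pi (ci p u) \o
  (orbit_map pi 1%g v \o (fun u' => chart_div p (u, u'))))).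
  have : nbhs u [set u' | div_dom p p 1%g (u, u')].
    have cu : {for u, continuous (fun u' : E => (u, u'))}.
      exact: (cvg_pair (cvg_cst _) cvg_id).
    have n : nbhs (u, u) (div_dom p p 1%g) by exact: open_nbhs_nbhs.
    exact: (cu _ n).
  apply: filterS => u' [_ Du'].
  by rewrite /= /orbit_map /chart_div /= chart_mapK// -(repM hpi) mulgA mulgV mul1g.
apply: is_derive_linear_comp.
- exact: rep_continuous_vec.
- exact: rep_linear.
have d0 : chart_div p (u, u) = e by rewrite /chart_div /= mulVg.
rewrite (dpiE _ sv) -d0; apply: (is_derive_comp (U := cod 1%g)).
- exact: chart_cod_open.
- exact: (sv 1%g 1%N).
- by rewrite d0; exact: chart_one_cod.
- exact: chart_div_derive.
Qed.

(** The limits of the words. The convergence enters as uniform approximation by one smooth vector,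
    over words of bounded length with bounded letters. *)
Variable tau : seq E -> V.
Hypothesis tau_approx : forall n (M d : R), 0 < M -> 0 < d -> exists2 v, rep_smooth pi v &
  forall xs, (size xs <= n)%N -> alls (fun x => `|x| <= M) xs ->
    `|rep_word pi v xs - tau xs| <= d.

Lemma tau_linear xs ys a x y : tau (xs ++ (a *: x + y) :: ys) =
  a *: tau (xs ++ x :: ys) + tau (xs ++ y :: ys).
Proof.
set A := xs ++ _; set B := xs ++ x :: ys; set C := xs ++ y :: ys.
have [M M0 HM] := alls_norm_bound (A ++ B ++ C).
have [n sz] : exists n, size A = n /\ size B = n /\ size C = n.
  by exists (size A); rewrite !size_cat.
have [HA HB HC] : [/\ alls (fun x => `|x| <= M) A, alls (fun x => `|x| <= M) B
    & alls (fun x => `|x| <= M) C].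
  have alls_catE (s t : seq E) (P : E -> Prop) : alls P (s ++ t) -> alls P s /\ alls P t.
    by elim: s => //= z s IH [Pz /IH[]].
  by have [? /alls_catE[]] := alls_catE _ _ _ HM.
apply/eqP; rewrite -subr_eq0 -normr_le0; apply/ler_addgt0Pr => d d0; rewrite add0r.
(* The three approximation errors have weights 1, |a| and 1. *)
have a2 : 0 < `|a| + 2 by rewrite ltr_wpDl.
have [v sv Hv] := tau_approx n M0 (divr_gt0 d0 a2).
have hA := Hv A; have hB := Hv B; have hC := Hv C.
case: sz hA hB hC => -> [-> ->] hA hB hC.
have {}hA := hA (leqnn _) HA; have {}hB := hB (leqnn _) HB; have {}hC := hC (leqnn _) HC.
have eA : rep_word pi v A = a *: rep_word pi v B + rep_word pi v C.
  exact: rep_word_linear.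
have -> : tau A - (a *: tau B + tau C) = - (rep_word pi v A - tau A) +
    a *: (rep_word pi v B - tau B) + (rep_word pi v C - tau C).
  by rewrite eA; lmod.
apply: (le_trans (ler_normD _ _)); apply: (le_trans (lerD (ler_normD _ _) (lexx _))).
rewrite normrN normrZ.
have := ler_wpM2l (normr_ge0 a) hB => hB'.
have -> : d = d / (`|a| + 2) + `|a| * (d / (`|a| + 2)) + d / (`|a| + 2).
  by field; rewrite gt_eqF.
by rewrite !lerD.
Qed.

Lemma tau_continuous p (W : normedModType R) (O : set W) (kappa : W -> E)
    (as_ : seq (W -> E)) : open O -> Cinf O kappa ->
  (forall w, O w -> cod p (kappa w)) -> alls (Cinf O) as_ ->
  forall w, O w -> {for w, continuous (fun w => pi (ci p (kappa w)) (tau [seq a w | a <- as_]))}.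
Proof.
move=> oO ck kU ca w Ow; apply/continuous_atP => d d0.
have cas : alls (fun a => {for w, continuous a}) as_.
  by apply: alls_sub ca => a ca; exact: (Cinf_continuous ca Ow).
have [M [r1 [M0 r10 H1]]] := alls_norm_bound_near cas.
have [C [r2 [C0 r20 H2]]] := rep_bounded_chart hpi (kU w Ow).
have /continuous_atP/(_ (r2 / 2))[|r3 r30 H3] := Cinf_continuous ck Ow.
  exact: divr_gt0.
have d3 : 0 < d / 3 by exact: divr_gt0.
have [v sv Hv] := tau_approx (size as_) M0 (divr_gt0 d3 C0).
have cw := rep_word_Cinf hpi (p := p) sv oO ck kU ca.
have /continuous_atP/(_ _ d3)[r4 r40 H4] := Cinf_continuous cw Ow.
exists (Num.min r1 (Num.min r3 r4)); first by rewrite !lt_min r10 r30.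
have diff w' : `|w' - w| < r1 -> `|w' - w| < r3 ->
    `|pi (ci p (kappa w')) (rep_word pi v [seq a w' | a <- as_]) -
      pi (ci p (kappa w')) (tau [seq a w' | a <- as_])| <= d / 3.
  move=> w1 w3; rewrite -linearB.
  have kr : `|kappa w' - kappa w| < r2.
    by apply: (le_lt_trans (H3 _ w3)); rewrite ltr_pdivrMr// ltr_pMr// ltr1n.
  have [_ hC] := H2 _ kr; apply: (le_trans (hC _)).
  have := Hv [seq a w' | a <- as_]; rewrite size_map => /(_ (leqnn _) (H1 _ w1)).
  by rewrite ler_pdivlMr// mulrC.
move=> w'; rewrite !lt_min => /and3P[w1 w3 w4].
have h1 := diff _ w1 w3; rewrite distrC in h1.
have h2 := diff w; rewrite subrr normr0 in h2; have {}h2 := h2 r10 r30.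
have := norm_triangle3 (norm_triangle3 h1 (H4 _ w4)) h2.
by move/le_trans; apply; lra.
Qed.

(** Exchange of limit and derivative. The radius r depends on the limit alone, so for each t in it a
    smooth vector v may be chosen whose errors are small against |t|; the mean value inequality is
    applied to v. *)
Lemma tau_derive p u h xs : cod p u ->
  is_derive u h (fun u => pi (ci p u) (tau xs))
    (pi (ci p u) (tau (left_log p (u, h) :: xs))).
Proof.
move=> pu; apply/is_deriveP => d d0.
have oU := @chart_cod_open R E G p.
pose as_ : seq (E -> E) := (fun u' => left_log p (u', h)) :: [seq (fun=> x) | x <- xs].
have clog : Cinf (cod p) (fun u' => left_log p (u', h)).
  apply: (Cinf_comp (f := left_log p) (g := fun u' => (u', h)) (V := cod p `*` setT)) => //.
  - exact: open_setXT.
  - exact: left_log_Cinf.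
  - by apply: Cinf_pair => //; [exact: Cinf_id|exact: Cinf_cst].
have cas : alls (Cinf (cod p)) as_.
  by split => //; exact: alls_cst_Cinf.
pose Dinf u' := pi (ci p u') (tau (left_log p (u', h) :: xs)).
have d2 : 0 < d / 2 by exact: divr_gt0.
have [r1 r10 H1] : exists2 r : R, 0 < r & forall u', `|u' - u| < r ->
    `|Dinf u' - Dinf u| <= d / 2.
  have := tau_continuous (kappa := id) oU (@Cinf_id _ _ _) (fun _ => id) cas pu.
  move=> /continuous_atP/(_ _ d2)[r r0 Hr]; exists r => // u' /Hr.
  by rewrite /= !map_cst_seq.
have [C [r2 [C0 r20 H2]]] := rep_bounded_chart hpi pu.
have cas' : alls (fun a : E -> E => {for u, continuous a}) as_.
  by apply: alls_sub cas => a ca; exact: (Cinf_continuous ca pu).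
have [M [r3 [M0 r30 H3]]] := alls_norm_bound_near cas'.
pose r := Num.min r1 (Num.min r2 r3).
have r0 : 0 < r by rewrite !lt_min r10 r20.
have h1 : 0 < `|h| + 1 by rewrite ltr_wpDl.
exists (r / (`|h| + 1)); first exact: divr_gt0.
move=> t; rewrite ltr_pdivlMr// => tr.
have [->|t0] := eqVneq t 0.
  by rewrite !scale0r addr0 subrr subr0 !normr0 mulr0.
have nt : 0 < `|t| by rewrite normr_gt0.
have near_u s : 0 <= s <= 1 -> `|u + s *: (t *: h) - u| < r.
  move=> /andP[s0 s1]; rewrite addrAC subrr add0r scalerA normrZ normrM (ger0_norm s0).
  apply: le_lt_trans tr; apply: ler_pM; rewrite ?lerDl ?mulr_ge0//.
  by rewrite ler_piMl.
(* The derivatives are off by d / 4 + d / 2, which contributes 3/4 d |t|; the two values are off by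
   d / 8 |t| each. The sum is d |t|. *)
pose eta := Num.min (d / 4) (d / 8 * `|t|).
have eta0 : 0 < eta by rewrite lt_min divr_gt0// mulr_gt0// divr_gt0.
have eta1 : eta <= d / 4 by rewrite ge_min lexx.
have eta2 : eta <= d / 8 * `|t| by rewrite ge_min lexx orbT.
have [v sv Hv] := tau_approx (size xs).+1 M0 (divr_gt0 eta0 C0).
have err u' ys : `|u' - u| < r -> (size ys <= (size xs).+1)%N ->
    alls (fun x => `|x| <= M) ys ->
    `|pi (ci p u') (rep_word pi v ys) - pi (ci p u') (tau ys)| <= eta.
  rewrite !lt_min => /and3P[_ ur2 _] sz HM; rewrite -linearB.
  have [_ hC] := H2 _ ur2; apply: (le_trans (hC _)).
  by have := Hv ys sz HM; rewrite ler_pdivlMr// mulrC.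
have bnd u' : `|u' - u| < r -> alls (fun x => `|x| <= M) (left_log p (u', h) :: xs).
  rewrite !lt_min => /and3P[_ _ ur3]; have := H3 _ ur3.
  by rewrite /= map_cst_seq.
have sw := rep_word_smooth hpi xs sv.
pose F u' := pi (ci p u') (rep_word pi v xs).
pose DF u' := pi (ci p u') (rep_word pi v (left_log p (u', h) :: xs)).
have mv : `|F (u + t *: h) - F u - t *: Dinf u| <= 3 / 4 * d * `|t|.
  apply: (mean_value_segment (d := fun s => t *: DF (u + s *: (t *: h)))).
    move=> s s01; apply: is_derive_scale; apply: orbit_map_derive => //.
    have := near_u s s01; rewrite !lt_min => /and3P[_ ur2 _].
    by have [] := H2 _ ur2.
  move=> s s01; rewrite -scalerBr normrZ [leRHS]mulrC ler_wpM2l//.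
  have ur := near_u s s01.
  have e1 := err _ (left_log p (u + s *: (t *: h), h) :: xs) ur (leqnn _) (bnd _ ur).
  have := ur; rewrite !lt_min => /and3P[ur1 _ _].
  have := norm_triangle3 e1 (H1 _ ur1).
  by move/le_trans; apply; lra.
have u0r : `|u - u| < r by rewrite subrr normr0.
have utr : `|u + t *: h - u| < r.
  by have := near_u 1; rewrite scale1r; apply; rewrite ler01 lexx.
have bx : alls (fun x => `|x| <= M) xs by have [] := bnd _ u0r.
have e1 := err _ xs utr (leqnSn _) bx; have e2 := err _ xs u0r (leqnSn _) bx.
rewrite -/(F _) distrC in e1; rewrite -/(F _) in e2.
have -> : pi (ci p (u + t *: h)) (tau xs) - pi (ci p u) (tau xs) - t *: Dinf u =
  (pi (ci p (u + t *: h)) (tau xs) - F (u + t *: h)) +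
  (F (u + t *: h) - F u - t *: Dinf u) + (F u - pi (ci p u) (tau xs)).
  by zmod.
apply: (le_trans (ler_normD _ _)); apply: (le_trans (lerD (ler_normD _ _) (lexx _))).
apply: (le_trans (lerD (lerD e1 mv) e2)).
lra.
Qed.

(** The words are reversed because differentiation adds its letter in front, whereas a ladder fills
    a new last slot. *)
Lemma tau_ladder p :
  ladder (cod p) (left_log p) (fun u xs => pi (ci p u) (tau (rev xs))).
Proof.
split.
- move=> u xs ys a x y pu.
  by rewrite !rev_cat !rev_cons -!cats1 -!catA /= tau_linear linearP.
- move=> u h xs pu; rewrite rev_rcons; exact: tau_derive.
- move=> W O kappa as_ oO ck kU ca w Ow.
  have -> : (fun w => pi (ci p (kappa w)) (tau (rev [seq a w | a <- as_]))) =
      (fun w => pi (ci p (kappa w)) (tau [seq a w | a <- rev as_])).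
    by apply/funext => w'; rewrite map_rev.
  exact: (tau_continuous oO ck kU (alls_rev ca) Ow).
Qed.

Lemma tau_smooth : rep_smooth pi (tau [::]).
Proof.
move=> p k; have oU := @chart_cod_open R E G p.
apply: (ladder_Ck k (kappa := id) (as_ := [::]) oU _ (tau_ladder p) oU) => //.
  exact: left_log_Cinf.
exact: Cinf_id.
Qed.

(** By induction tau xs is a word of the smooth limit vector, hence smooth; [tau_derive] at 1, where
    the logarithmic derivative is the identity, adds the next letter. *)
Lemma tau_word xs : rep_word pi (tau [::]) xs = tau xs.
Proof.
elim: xs => [//|x xs IH] /=.
have sx : rep_smooth pi (tau xs) by rewrite -IH; apply: rep_word_smooth => //; exact: tau_smooth.
rewrite IH dpiE//; apply: is_deriveE.
have := tau_derive x xs chart_one_cod.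
by rewrite left_log_one chart_one_inv (rep1 hpi).
Qed.

End Limit.

(** * Topologies defined by countably many seminorms *)

Section CountableSeminorms.
Context {R : realType} {W : lmodType R} (P : set (W -> \bar R)).
Variable s : nat -> W -> R.
Hypothesis s_triangle : forall n v w, s n (v + w) <= s n v + s n w.
Hypothesis s_scale : forall n a v, s n (a *: v) = `|a| * s n v.
Hypothesis s_mem : forall n, P (fun v => (s n v)%:E).
Hypothesis s_dominates : forall q, P q -> exists n (C : R),
  0 <= C /\ forall v, (q v <= (C * s n v)%:E)%E.
Implicit Types (v w x y : W) (m n : nat).

Local Notation X := (lc_space P).

Lemma seminorm_seq0 n : s n 0 = 0.
Proof. by have := s_scale n 0 0; rewrite scaler0 normr0 mul0r. Qed.

Lemma seminorm_seqN n v : s n (- v) = s n v.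
Proof. by rewrite -scaleN1r s_scale normrN1 mul1r. Qed.

Lemma seminorm_seq_ge0 n v : 0 <= s n v.
Proof.
have := s_triangle n v (- v); rewrite subrr seminorm_seq0 seminorm_seqN => h.
by lra.
Qed.

Lemma seminorm_seqB n v w : s n (v - w) = s n (w - v).
Proof. by rewrite -seminorm_seqN opprB. Qed.

Lemma seminorm_seq_sub n u v w : s n (u - w) <= s n (u - v) + s n (v - w).
Proof. by apply: le_trans (s_triangle _ _ _); rewrite subrKA. Qed.

Definition seminorm_ball m (d : R) v : set X :=
  [set w | forall n, (n <= m)%N -> s n ((w : W) - v) < d].

Lemma seminorm_ball_center m d v : 0 < d -> seminorm_ball m d v v.
Proof. by move=> d0 n _; rewrite subrr seminorm_seq0. Qed.

Lemma finite_min_gt0 m (f : nat -> R) : (forall n, (n <= m)%N -> 0 < f n) ->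
  exists2 d : R, 0 < d & forall n, (n <= m)%N -> d <= f n.
Proof.
elim: m => [|m IH] f0.
  by exists (f 0%N); [exact: f0|move=> n; rewrite leqn0 => /eqP ->].
have [|d d0 Hd] := IH; first by move=> n nm; apply: f0; exact: leqW.
exists (Num.min d (f m.+1)); first by rewrite lt_min d0 f0.
move=> n; rewrite leq_eqVlt ltnS ge_min => /predU1P[->|/Hd ->//].
by rewrite lexx orbT.
Qed.

Lemma seminorm_ball_open m d v : open (seminorm_ball m d v).
Proof.
move=> w Bw.
have [|e e0 He] := @finite_min_gt0 m (fun n => d - s n (w - v)).
  by move=> n nm; rewrite subr_gt0; exact: Bw.
exists [set (fun v => (s n v)%:E) | n in [set n | (n <= m)%N]], e; split => //.
- by apply: finite_image; rewrite [X in finite_set X](_ : _ = `I_m.+1).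
- by move=> q [n _ <-]; exact: s_mem.
  move=> w' Hw' n nm; have := He n nm.
  have : ((s n (w' - w)%R)%:E < e%:E)%E by apply: (Hw' (fun v => (s n v)%:E)); exists n.
  rewrite lte_fin => h1 h2; apply: (le_lt_trans (seminorm_seq_sub n w' w v)).
  by lra.
Qed.

(** Each of the finitely many seminorms of a basic neighborhood is dominated by one s n; the largest
    index and the smallest radius serve them all. *)
Lemma nbhs_lcP v (A : set X) : nbhs (v : X) A <->
  exists m (d : R), 0 < d /\ seminorm_ball m d v `<=` A.
Proof.
split=> [|[m [d [d0 BA]]]]; last first.
  rewrite nbhsE /=; exists (seminorm_ball m d v) => //.
  by split; [exact: seminorm_ball_open|exact: seminorm_ball_center].
rewrite nbhsE => -[B [oB Bv] BA].
have [S [e [fS SP e0 SB]]] := oB v Bv.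
suff [m [d [d0 Hd]]] : exists m (d : R), 0 < d /\
    forall q, S q -> forall x, (forall n, (n <= m)%N -> s n x < d) -> (q x < e%:E)%E.
  exists m, d; split => // w Bw; apply/BA/SB => q Sq; exact: Hd.
have [t St] := (@finite_seqP {classic (W -> \bar R)} S).1 fS.
have {SP} : {subset t <= P}.
  by move=> q qt; rewrite inE; apply: SP; rewrite St.
suff H : {subset t <= P} -> exists m (d : R), 0 < d /\
    forall q, q \in t -> forall x, (forall n, (n <= m)%N -> s n x < d) -> (q x < e%:E)%E.
  move=> /H[m [d [d0 Hd]]]; exists m, d; split => // q Sq; apply: Hd.
  by move: Sq; rewrite St.
elim: (t) => [|q0 t' IH] tP; first by exists 0%N, 1.
have [|m [d [d0 Hd]]] := IH; first by move=> q qt; apply: tP; rewrite inE qt orbT.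
have : P q0 by have := tP q0; rewrite !inE eqxx => /(_ isT).
move=> /s_dominates[n0 [C [C0 HC]]].
have C1 : 0 < C + 1 by rewrite ltr_wpDl.
exists (maxn m n0), (Num.min d (e / (C + 1))); split.
  by rewrite lt_min d0 divr_gt0.
move=> q; rewrite inE => /predU1P[->|qt] x Hx.
  apply: (le_lt_trans (HC x)); rewrite lte_fin.
  have := Hx n0 (leq_maxr _ _); rewrite lt_min ltr_pdivlMr// => /andP[_].
  by have := seminorm_seq_ge0 n0 x; lra.
apply: Hd => // n nm; have := Hx n (leq_trans nm (leq_maxl _ _)).
by rewrite lt_min => /andP[].
Qed.

Lemma seminorm_ball_convex m d v : convex_set (seminorm_ball m d v).
Proof.
apply/convex_setW => x y; rewrite !inE => xB yB l l0 l1; rewrite inE => n nm.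
set t := l%:num in l0 l1 *.
rewrite [X in s n X](_ : _ = t *: ((x : W) - v) + (1 - t) *: ((y : W) - v)); last first.
  rewrite -[LHS]/(t *: (x : W) + (1 - t) *: (y : W) - v).
  by rewrite !scalerBr addrACA -opprD -scalerDl subrKC scale1r.
apply: (le_lt_trans (s_triangle _ _ _)); rewrite !s_scale.
rewrite (gtr0_norm l0) gtr0_norm ?subr_gt0//.
have hx := xB n nm; have hy := yB n nm.
have : t * s n ((x : W) - v) < t * d by rewrite ltr_pM2l.
have : (1 - t) * s n ((y : W) - v) < (1 - t) * d by rewrite ltr_pM2l// subr_gt0.
by lra.
Qed.

Lemma lc_add_continuous : continuous (fun z : X * X => z.1 + z.2).
Proof.
move=> [v w] A /nbhs_lcP[m [d [d0 BA]]].
have d2 : 0 < d / 2 by exact: divr_gt0.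
exists (seminorm_ball m (d / 2) v, seminorm_ball m (d / 2) w).
  by split; apply/nbhs_lcP; exists m, (d / 2); split.
move=> [x y] /= [Bx By]; apply: BA => n nm.
have -> : (x : W) + y - ((v : W) + w) = ((x : W) - v) + ((y : W) - w).
  by rewrite opprD addrACA.
apply: (le_lt_trans (s_triangle _ _ _)).
by have := Bx n nm; have := By n nm; lra.
Qed.

Lemma lc_scale_continuous : continuous (fun z : R^o * X => z.1 *: z.2).
Proof.
move=> [a v] A /nbhs_lcP[m [d [d0 BA]]].
have [M M0 HM] : exists2 M : R, 0 < M & forall n, (n <= m)%N -> s n v <= M.
  elim: (m) => [|k [M M0 IH]].
    exists (s 0 v + 1); first by rewrite ltr_wpDl// seminorm_seq_ge0.
    by move=> n; rewrite leqn0 => /eqP ->; rewrite lerDl.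
  exists (M + s k.+1 v); first by rewrite ltr_wpDr// seminorm_seq_ge0.
  move=> n; rewrite leq_eqVlt ltnS => /predU1P[->|/IH h]; first by rewrite lerDr ltW.
  by apply: (le_trans h); rewrite lerDl seminorm_seq_ge0.
have a1 : 0 < `|a : R| + 1 by rewrite ltr_wpDl.
have d1 : 0 < d / (2 * (`|a : R| + 1)) by rewrite divr_gt0// mulr_gt0.
have d2 : 0 < Num.min 1 (d / (2 * M)) by rewrite lt_min ltr01 divr_gt0// mulr_gt0.
exists ([set b : R^o | `|b - a| < Num.min 1 (d / (2 * M))],
        seminorm_ball m (d / (2 * (`|a : R| + 1))) v).
  split; last by apply/nbhs_lcP; exists m, (d / (2 * (`|a : R| + 1))); split.
  by apply/(@nbhs_normP R R^o); eexists; [exact: d2|].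
move=> [b y] /= []; rewrite lt_min => /andP[b1 b2] By; apply: BA => n nm.
have -> : (b *: (y : W) : W) - a *: (v : W) = (b : R) *: ((y : W) - v) + ((b : R) - a) *: (v : W).
  by rewrite scalerBr scalerBl subrKA.
apply: (le_lt_trans (s_triangle _ _ _)); rewrite !s_scale.
have hb : `|b : R| <= `|a : R| + 1.
  have -> : (b : R) = (b - a) + a by rewrite subrK.
  by apply: (le_trans (ler_normD _ _)); rewrite addrC lerD2l ltW.
have h1 : `|b : R| * s n ((y : W) - v) <= (`|a : R| + 1) * s n ((y : W) - v).
  by apply: ler_wpM2r => //; exact: seminorm_seq_ge0.
have h2 : (`|a : R| + 1) * s n ((y : W) - v) < d / 2.
  have := By n nm; rewrite invfM mulrA ltr_pdivlMr// => h.
  by rewrite mulrC.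
have h3 : `|(b : R) - a| * s n v <= `|(b : R) - a| * M.
  by apply: ler_wpM2l => //; exact: HM.
have h4 : `|(b : R) - a| * M < d / 2.
  by move: b2; rewrite invfM mulrA ltr_pdivlMr.
by lra.
Qed.

(** Capping s n at 1 / (n + 1) allows a metric given by a supremum instead of a weighted series: a
    ball of radius d constrains only the finitely many n with 1 / (n + 1) >= d. *)
Definition seminorm_seq_cut v n : R := Num.min n.+1%:R^-1 (s n v).

Definition seminorm_seq_metric v w : R := sup (range (seminorm_seq_cut (v - w))).

Lemma seminorm_seq_cut_ge0 v n : 0 <= seminorm_seq_cut v n.
Proof. by rewrite le_min invr_ge0 ler0n seminorm_seq_ge0. Qed.

Lemma seminorm_seq_cut_le v w n : seminorm_seq_cut (v - w) n <= seminorm_seq_metric v w.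
Proof.
apply: ub_le_sup; last by exists n.
exists 1 => _ [k _ <-]; apply: (@le_trans _ _ k.+1%:R^-1).
  by rewrite ge_min lexx.
by rewrite invf_le1 ?ltr0n// ler1n.
Qed.

Lemma seminorm_seq_metric_le v w (d : R) :
  (forall n, seminorm_seq_cut (v - w) n <= d) -> seminorm_seq_metric v w <= d.
Proof.
move=> H; apply: ge_sup; first by exists (seminorm_seq_cut (v - w) 0); exists 0%N.
by move=> _ [n _ <-].
Qed.

Lemma nbhs_seminorm_seq_metric v (A : set X) : nbhs (v : X) A <->
  exists2 d : R, 0 < d & [set w | seminorm_seq_metric v w < d] `<=` A.
Proof.
split=> [/nbhs_lcP[m [d [d0 BA]]]|[d d0 dA]].
  exists (Num.min d m.+1%:R^-1); first by rewrite lt_min d0 invr_gt0 ltr0n.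
  move=> w; rewrite /= lt_min => /andP[wd wm]; apply: BA => n nm.
  have := seminorm_seq_cut_le v w n; rewrite /seminorm_seq_cut seminorm_seqB.
  have mn : m.+1%:R^-1 <= n.+1%:R^-1 :> R.
    by rewrite lef_pV2 ?posrE ?ltr0n// ler_nat.
  rewrite ge_min => /orP[h|h]; last exact: le_lt_trans wd.
  by have := lt_le_trans wm (le_trans mn h); rewrite ltxx.
pose m := Num.truncn (2 / d).
have md : m.+1%:R^-1 <= d / 2 :> R.
  rewrite -[leRHS]invrK lef_pV2 ?posrE ?invr_gt0 ?divr_gt0 ?ltr0n//.
  by rewrite invf_div ltW// truncnS_gt.
have d2 : 0 < d / 2 by exact: divr_gt0.
apply/nbhs_lcP; exists m, (d / 2); split => // w Bw; apply: dA => /=.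
apply: (@le_lt_trans _ _ (d / 2)); last by lra.
apply: seminorm_seq_metric_le => n; rewrite ge_min.
have [nm|mn] := leqP n m.
  by apply/orP; right; rewrite seminorm_seqB; apply/ltW; exact: Bw.
by apply/orP; left; apply: le_trans md; rewrite lef_pV2 ?posrE ?ltr0n// ler_nat ltnW.
Qed.

Lemma lc_frechet : (forall v, (forall n, s n v = 0) -> v = 0) ->
  (forall F : set_system W, ProperFilter F ->
    (forall n (d : R), 0 < d -> exists2 A, F A & forall v w, A v -> A w -> s n (v - w) <= d) ->
    exists l, forall n (d : R), 0 < d -> F [set w | s n (w - l) < d]) ->
  frechet_space X.
Proof.
move=> sep complete; split.
- exact: lc_add_continuous.
- exact: lc_scale_continuous.
- exists [set B | exists m (d : R) v, 0 < d /\ B = seminorm_ball m d v].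
    by move=> B; rewrite inE => -[m [d [v [_ ->]]]]; exact: seminorm_ball_convex.
  split; first by move=> _ [m [d [v [_ ->]]]]; exact: seminorm_ball_open.
  move=> v A /nbhs_lcP[m [d [d0 BA]]]; exists (seminorm_ball m d v) => //.
  by split; [exists m, d, v|exact: seminorm_ball_center].
- exists seminorm_seq_metric; split.
  + move=> v; apply/le_anti/andP; split.
      apply: seminorm_seq_metric_le => n.
      by rewrite /seminorm_seq_cut subrr seminorm_seq0 ge_min lexx orbT.
    by apply: le_trans (seminorm_seq_cut_le _ _ 0%N); exact: seminorm_seq_cut_ge0.
  + move=> v w d0; apply/eqP; rewrite -subr_eq0; apply/eqP; apply: sep => n.
    have := seminorm_seq_cut_le v w n; rewrite d0 ge_min => /orP[|h].
      by rewrite leNgt invr_gt0 ltr0n.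
    by apply/le_anti; rewrite h seminorm_seq_ge0.
  + move=> v w; rewrite /seminorm_seq_metric.
    rewrite (_ : seminorm_seq_cut (v - w) = seminorm_seq_cut (w - v))//.
    by apply/funext => n; rewrite /seminorm_seq_cut seminorm_seqB.
  + move=> u v w; apply: seminorm_seq_metric_le => n.
    have h1 := seminorm_seq_cut_le v u n; have h2 := seminorm_seq_cut_le u w n.
    apply: le_trans (lerD h1 h2); rewrite /seminorm_seq_cut.
    have h := seminorm_seq_sub n v u w; set c : R := n.+1%:R^-1.
    have c0 : 0 < c by rewrite invr_gt0 ltr0n.
    have a0 := seminorm_seq_ge0 n (v - u); have b0 := seminorm_seq_ge0 n (u - w).
    rewrite ge_min; case: (leP c (s n (v - u))) => ?; case: (leP c (s n (u - w))) => ?;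
      apply/orP; first [by right; lra | by left; lra].
  + exact: nbhs_seminorm_seq_metric.
- move=> F PF cF; have [n d d0|l Hl] := complete F PF.
    have n0 : nbhs (0 : X) (seminorm_ball n d 0) by apply/nbhs_lcP; exists n, d; split.
    have [A FA HA] := cF _ n0; exists A => // v w Av Aw.
    by have := HA v w Av Aw n (leqnn n); rewrite subr0 => /ltW.
  exists l => A /nbhs_lcP[m [d [d0 BA]]].
  apply: filterS BA _; rewrite /seminorm_ball; elim: (m) => [|k IH].
    by apply: filterS (Hl 0%N d d0) => w h n; rewrite leqn0 => /eqP ->.
  apply: filterS (filterI IH (Hl k.+1 d d0)) => w [h1 h2] n.
  by rewrite leq_eqVlt ltnS => /predU1P[->//|]; exact: h1.
Qed.

End CountableSeminorms.

(** * Seminorms of the space of smooth vectors *)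

Lemma allsP (T : Type) (x0 : T) (P : T -> Prop) (s : seq T) :
  alls P s <-> forall i, (i < size s)%N -> P (nth x0 s i).
Proof.
elim: s => [|x s IH]; first by split.
split=> [[Px /IH H] [|i] //|H]; first exact: H.
by split; [exact: (H 0%N)|apply/IH => i; exact: (H i.+1)].
Qed.

Lemma alls_tuple (T : Type) (P : T -> Prop) n (x : n.-tuple T) :
  (forall i, P (tnth x i)) <-> alls P x.
Proof.
split=> H; last first.
  move=> i; rewrite (tnth_nth (tnth x i)).
  by move/(allsP (tnth x i)) : H; apply; rewrite size_tuple.
case: n x H => [|n] x H; first by rewrite tuple0.
apply/(allsP (thead x)) => i; rewrite size_tuple => ni.
by rewrite -(tnth_nth _ x (Ordinal ni)).
Qed.

(** This reduces the seminorms p_n for arbitrary p to those for the norm of V. *)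
Lemma continuous_seminorm_bounded (R : realType) (V : completeNormedModType R)
    (p : V -> R) : continuous_seminorm p ->
  exists2 C : R, 0 <= C & forall y, p y <= C * `|y|.
Proof.
move=> [pD pZ pc].
have p0 : p 0 = 0 by have := pZ 0 0; rewrite scaler0 normr0 mul0r.
have /(@continuous_atP R V R^o)/(_ 1 ltr01)[r r0 Hr] := pc 0.
exists (2 / r); first by rewrite ltW// divr_gt0.
apply: homogeneous_dominated => // [a x|x /normr0_eq0 ->|x xr]; rewrite ?normrZ//.
by have := le_trans (ler_norm _) (Hr x _); rewrite p0 !subr0; apply.
Qed.

Lemma norm_continuous_seminorm (R : realType) (V : completeNormedModType R) :
  continuous_seminorm (fun v : V => `|v|).
Proof.
split; [exact: ler_normD|exact: normrZ|exact: norm_continuous].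
Qed.

Section Seminorms.
Context {R : realType} {E : completeNormedModType R}
  {G : banachLieGroupType E} {V : completeNormedModType R}.
Variables (N : E -> R) (pi : G -> {linear V -> V}).
Hypothesis hN : lie_algebra_norm G N.
Hypothesis hpi : continuous_representation pi.

Lemma lie_norm0 : N 0 = 0.
Proof. by have := lnormZ hN 0 0; rewrite scaler0 normr0 mul0r. Qed.

Lemma lie_norm_ge0 x : 0 <= N x.
Proof.
have NN : N (- x) = N x by rewrite -scaleN1r (lnormZ hN) normrN1 mul1r.
have := lnorm_triangle hN x (- x); rewrite subrr lie_norm0 NN => h.
by lra.
Qed.

Lemma lie_norm_dominates : exists2 K : R, 0 < K & forall x, `|x| <= K * N x.
Proof.
have n1 : nbhs (0 : E) [set x | `|x| < 1].
  by apply/nbhs_normP; exists 1 => // x; rewrite subr0.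
have [d d0 Hd] := (lnorm_nbhs0 hN _).1 n1.
exists (2 / d); first exact: divr_gt0.
apply: (homogeneous_dominated d0 (@normrZ _ _) (lnormZ hN) lie_norm_ge0).
  by move=> x /(lnorm_eq0 hN) ->; rewrite normr0.
by move=> x /Hd /ltW.
Qed.

Lemma lie_norm_dominated : exists2 K : R, 0 < K & forall x, N x <= K * `|x|.
Proof.
have /nbhs_normP[d d0 Hd] : nbhs (0 : E) [set x | N x < 1].
  by apply/(lnorm_nbhs0 hN); exists 1.
exists (2 / d); first exact: divr_gt0.
apply: (homogeneous_dominated d0 (lnormZ hN) (@normrZ _ _)) => //.
  by move=> x /normr0_eq0 ->; rewrite lie_norm0.
by move=> x xd; apply/ltW/Hd; rewrite subr0.
Qed.

Definition unit_words n : set (n.-tuple E) := [set x | forall i, N (tnth x i) <= 1].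
Arguments unit_words : clear implicits.

(** The seminorm p_n for p the norm of V, as a real number; by [word_norm_ub] the supremum is a
    genuine one on smooth vectors. *)
Definition word_norm n (v : V) : R := sup [set `|rep_word pi v x| | x in unit_words n].

Lemma unit_words_neq0 n : unit_words n !=set0.
Proof.
exists (nseq_tuple n 0) => i; rewrite (tnth_nth 0) nth_nseq.
by case: ifP => _; rewrite lie_norm0.
Qed.

Lemma word_norm_ub n v : rep_smooth pi v ->
  has_ubound [set `|rep_word pi v x| | x in unit_words n].
Proof.
move=> sv; have [K K0 HK] := lie_norm_dominates.
have [C C0 HC] := rep_word_bounded hpi n sv.
exists (K ^+ n * C) => _ [x Dx <-].
pose y := [seq K^-1 *: z | z <- x].
have -> : rep_word pi v x = K ^+ n *: rep_word pi v y.
  rewrite rep_word_scale// size_tuple scalerA -exprMn divff ?gt_eqF//.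
  by rewrite expr1n scale1r.
rewrite normrZ ger0_norm ?exprn_ge0 ?(ltW K0)// ler_wpM2l ?exprn_ge0 ?(ltW K0)//.
apply: HC; first by rewrite size_map size_tuple.
have : alls (fun z => N z <= 1) x by apply/alls_tuple.
apply: alls_map => z Nz; rewrite normrZ gtr0_norm ?invr_gt0// ler_pdivrMl//.
by apply: (le_trans (HK z)); rewrite ler_wpM2l// ltW.
Qed.

Lemma le_word_norm n v x : rep_smooth pi v -> unit_words n x ->
  `|rep_word pi v x| <= word_norm n v.
Proof. by move=> sv Dx; apply: ub_le_sup; [exact: word_norm_ub|exists x]. Qed.

Lemma word_norm_le n v d : (forall x, unit_words n x -> `|rep_word pi v x| <= d) ->
  word_norm n v <= d.
Proof.
move=> H; apply: ge_sup; last by move=> _ [x Dx <-]; exact: H.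
by have [x Dx] := unit_words_neq0 n; exists `|rep_word pi v x|, x.
Qed.

Lemma word_norm_ge0 n v : rep_smooth pi v -> 0 <= word_norm n v.
Proof.
move=> sv; have [x Dx] := unit_words_neq0 n.
exact: le_trans (le_word_norm sv Dx).
Qed.

Lemma dseminorm_norm n v : rep_smooth pi v ->
  dseminorm pi N (fun v => `|v|) n v = (word_norm n v)%:E.
Proof.
move=> sv; rewrite /dseminorm /word_norm -ereal_sup_EFin; last first.
- by have [x Dx] := unit_words_neq0 n; exists `|rep_word pi v x|, x.
- exact: word_norm_ub.
by congr ereal_sup; rewrite -image_comp.
Qed.

Lemma rep_word_linear_vec xs a v w : rep_smooth pi v -> rep_smooth pi w ->
  rep_word pi (a *: v + w) xs = a *: rep_word pi v xs + rep_word pi w xs.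
Proof.
move=> sv sw; elim: xs => [//|x xs IH] /=.
by rewrite IH dpi_linear_vec//; exact: rep_word_smooth.
Qed.

Lemma word_norm_triangle n v w : rep_smooth pi v -> rep_smooth pi w ->
  word_norm n (v + w) <= word_norm n v + word_norm n w.
Proof.
move=> sv sw; apply: word_norm_le => x Dx.
have := rep_word_linear_vec x 1 sv sw; rewrite !scale1r => ->.
by apply: (le_trans (ler_normD _ _)); apply: lerD; exact: le_word_norm.
Qed.

Lemma rep_smooth0 : rep_smooth pi (0 : V).
Proof.
move=> p k; rewrite (_ : orbit_map pi p 0 = fun=> 0); first exact: Ck_cst.
by apply/funext => u; exact: linear0.
Qed.

Lemma rep_smoothZ a v : rep_smooth pi v -> rep_smooth pi (a *: v).
Proof. by move=> sv; rewrite -[a *: v]addr0; exact: (rep_smooth_lin a sv rep_smooth0). Qed.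

Lemma word_norm_scale_le n a v : rep_smooth pi v ->
  word_norm n (a *: v) <= `|a| * word_norm n v.
Proof.
move=> sv; apply: word_norm_le => x Dx.
have w0 : rep_word pi 0 x = 0.
  have := rep_word_linear_vec x 1 rep_smooth0 rep_smooth0.
  by rewrite !scale1r addr0 => /eqP; rewrite addrC -subr_eq subrr => /eqP <-.
have := rep_word_linear_vec x a sv rep_smooth0; rewrite addr0 w0 addr0 => ->.
by rewrite normrZ ler_wpM2l//; exact: le_word_norm.
Qed.

(** The reverse inequality is the same bound for the inverse of a. *)
Lemma word_norm_scale n a v : rep_smooth pi v ->
  word_norm n (a *: v) = `|a| * word_norm n v.
Proof.
move=> sv; apply/le_anti; rewrite word_norm_scale_le//=.
have [->|a0] := eqVneq a 0.
  by rewrite normr0 mul0r word_norm_ge0//; exact: rep_smoothZ.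
rewrite -ler_pdivlMl ?normr_gt0// -normfV.
rewrite -{1}[v]scale1r -(mulVf a0) -scalerA; apply: word_norm_scale_le.
exact: rep_smoothZ.
Qed.

Lemma rep_word_norm_le v (xs : seq E) (K M : R) : 0 < K -> 0 < M ->
  (forall x, N x <= K * `|x|) -> rep_smooth pi v ->
  alls (fun x => `|x| <= M) xs ->
  `|rep_word pi v xs| <= (K * M) ^+ size xs * word_norm (size xs) v.
Proof.
move=> K0 M0 HK sv xM; have KM : 0 < K * M by exact: mulr_gt0.
pose y := [seq (K * M)^-1 *: x | x <- xs].
have sy : size y == size xs by rewrite size_map.
have -> : rep_word pi v xs = (K * M) ^+ size xs *: rep_word pi v y.
  rewrite rep_word_scale// scalerA -exprMn divff ?gt_eqF//.
  by rewrite expr1n scale1r.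
rewrite normrZ ger0_norm ?exprn_ge0 ?(ltW KM)// ler_wpM2l ?exprn_ge0 ?(ltW KM)//.
apply: (le_word_norm (x := Tuple sy) sv).
apply: (alls_tuple (fun x => N x <= 1) (Tuple sy)).2 => /=.
apply: alls_map xM => x xM; rewrite (lnormZ hN) gtr0_norm ?invr_gt0//.
rewrite ler_pdivrMl// mulr1; apply: (le_trans (HK x)).
by rewrite ler_wpM2l// ltW.
Qed.

Local Notation W := (smooth_space pi).

Lemma smooth_val_smooth (v : W) : rep_smooth pi (smooth_val v).
Proof. by apply/rep_smoothP => //; have := smooth_valP v => /asboolP. Qed.

Lemma smooth_valD (v w : W) : smooth_val (v + w) = smooth_val v + smooth_val w.
Proof. by []. Qed.

Lemma smooth_valB (v w : W) : smooth_val (v - w) = smooth_val v - smooth_val w.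
Proof. by []. Qed.

Lemma smooth_valZ a (v : W) : smooth_val (a *: v) = a *: smooth_val v.
Proof. by []. Qed.

Lemma rep_wordB xs v w : rep_smooth pi v -> rep_smooth pi w ->
  rep_word pi (v - w) xs = rep_word pi v xs - rep_word pi w xs.
Proof.
move=> sv sw; have := rep_word_linear_vec xs (-1) sw sv.
by rewrite !scaleN1r addrC [RHS]addrC.
Qed.

(** Each word converges along F by completeness of V. The Cauchy condition makes this uniform on
    bounded words, so the limits satisfy the approximation hypothesis of the preceding section. *)
Lemma smooth_space_complete (F : set_system W) : ProperFilter F ->
  (forall n (d : R), 0 < d -> exists2 A, F A &
    forall v w, A v -> A w -> word_norm n (smooth_val (v - w)) <= d) ->
  exists l : W, forall n (d : R), 0 < d -> F [set w | word_norm n (smooth_val (w - l)) < d].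
Proof.
move=> PF cF; have [K K0 HK] := lie_norm_dominated.
have sval := smooth_val_smooth.
have close xs (M : R) (v w : W) : 0 < M -> alls (fun x => `|x| <= M) xs ->
    `|rep_word pi (smooth_val v) xs - rep_word pi (smooth_val w) xs| <=
    (K * M) ^+ size xs * word_norm (size xs) (smooth_val (v - w)).
  by move=> M0 xM; rewrite -rep_wordB// -smooth_valB; exact: rep_word_norm_le.
pose ev xs (v : W) := rep_word pi (smooth_val v) xs.
have lim_ex xs : exists l : V, ev xs @ F --> l.
  apply/cvg_ex/cauchy_cvgP/cauchy_exP => d d0; rewrite /cauchy_ex.
  have [M M0 xM] := alls_norm_bound xs.
  have KM : 0 < (K * M) ^+ size xs by rewrite exprn_gt0// mulr_gt0.
  have d2 : 0 < d / (2 * (K * M) ^+ size xs) by rewrite divr_gt0// mulr_gt0.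
  have [A FA HA] := cF (size xs) _ d2; have [v Av] := filter_ex FA.
  exists (ev xs v); suff : F [set w | ball (ev xs v) d (ev xs w)] by [].
  apply: filterS FA => w Aw.
  rewrite -ball_normE /ball_ /=.
  apply: (le_lt_trans (close xs M v w M0 xM)).
  apply: (le_lt_trans (ler_wpM2l (ltW KM) (HA v w Av Aw))).
  have -> : (K * M) ^+ size xs * (d / (2 * (K * M) ^+ size xs)) = d / 2.
    by field; rewrite gt_eqF.
  by rewrite ltr_pdivrMr// ltr_pMr// ltr1n.
have /choice[tau Htau] := lim_ex.
(* The Cauchy estimate for v and w is kept while the word of w tends to its limit. *)
have tau_close n (A : set W) (M d : R) : F A -> 0 < M ->
    (forall v w, A v -> A w -> word_norm n (smooth_val (v - w)) <= d) ->
    forall (v : W) xs, A v -> size xs = n -> alls (fun x => `|x| <= M) xs ->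
    `|ev xs v - tau xs| <= (K * M) ^+ n * d.
  move=> FA M0 HA v xs Av sz xM; apply/ler_addgt0Pr => e e0.
  have /cvgrPdist_le/(_ e e0) h := Htau xs.
  have [w [Aw hw]] := filter_ex (filterI FA h).
  rewrite /= distrC in hw.
  have KM : 0 <= (K * M) ^+ n by rewrite exprn_ge0// mulr_ge0// ltW.
  apply: norm_triangle3 hw; apply: (le_trans (close xs M v w M0 xM)); rewrite sz.
  by apply: ler_wpM2l => //; exact: HA.
(* The same for words that are unit for N: this one bounds the word norms of w - l, the preceding
   one yields [tau_approx]. *)
have unit_close n (A : set W) (d : R) : F A ->
    (forall v w, A v -> A w -> word_norm n (smooth_val (v - w)) <= d) ->
    forall (v : W) (x : n.-tuple E), A v -> unit_words n x -> `|ev x v - tau x| <= d.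
  move=> FA HA v x Av Dx; apply/ler_addgt0Pr => e e0.
  have /cvgrPdist_le/(_ e e0) h := Htau x.
  have [w [Aw hw]] := filter_ex (filterI FA h); rewrite /= distrC in hw.
  apply: norm_triangle3 hw; rewrite /ev -rep_wordB// -smooth_valB.
  by apply: le_trans (HA v w Av Aw); exact: le_word_norm.
have tau_approx n (M d : R) : 0 < M -> 0 < d -> exists2 v, rep_smooth pi v &
    forall xs, (size xs <= n)%N -> alls (fun x => `|x| <= M) xs ->
    `|rep_word pi v xs - tau xs| <= d.
  move=> M0 d0; have KM : 0 < K * M by exact: mulr_gt0.
  suff [A FA HA] : exists2 A : set W, F A & forall (v : W) xs, A v -> (size xs <= n)%N ->
      alls (fun x => `|x| <= M) xs -> `|ev xs v - tau xs| <= d.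
    have [v Av] := filter_ex FA; exists (smooth_val v) => // xs; exact: HA.
  have step k : exists2 A : set W, F A & forall (v : W) xs, A v -> size xs = k ->
      alls (fun x => `|x| <= M) xs -> `|ev xs v - tau xs| <= d.
    have KMk : 0 < (K * M) ^+ k by exact: exprn_gt0.
    have [A FA HA] := cF k _ (divr_gt0 d0 KMk).
    exists A => // v xs Av sz xM; apply: (le_trans (tau_close k A M _ FA M0 HA v xs Av sz xM)).
    by rewrite mulrCA divff ?mulr1// gt_eqF.
  (* Intersecting the sets found for each length gives one set of the filter for all lengths up to
     n. *)
  elim: n => [|n [A FA HA]].
    have [A FA HA] := step 0%N; exists A => // v xs Av; rewrite leqn0 => /eqP.
    exact: HA.
  have [B FB HB] := step n.+1; exists (A `&` B); first exact: filterI.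
  move=> v xs [Av Bv]; rewrite leq_eqVlt ltnS => /predU1P[|]; first exact: HB.
  exact: HA.
have st : rep_smooth pi (tau [::]) by exact: (tau_smooth hpi tau_approx).
have lP : tau [::] \in smooth_pred pi.
  by apply/asboolP/rep_smoothP.
exists (SmoothSpace lP) => n d d0; have d2 : 0 < d / 2 by exact: divr_gt0.
have [A FA HA] := cF n _ d2; have FA' := FA; apply: filterS FA => w Aw.
apply: (@le_lt_trans _ _ (d / 2)); last by rewrite ltr_pdivrMr// ltr_pMr// ltr1n.
rewrite smooth_valB; apply: word_norm_le => x Dx; rewrite rep_wordB//.
have := unit_close n A (d / 2) FA' HA w x Aw Dx.
by rewrite -(tau_word hpi tau_approx).
Qed.

End Seminorms.

Theorem proposition5p4 (R : realType) (E : completeNormedModType R)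
    (G : banachLieGroupType E) (N : E -> R) (V : completeNormedModType R)
    (pi : G -> {linear V -> V}) :
  lie_algebra_norm G N ->
  continuous_representation pi ->
  frechet_space (smooth_vectors N pi).
Proof.
move=> hN hpi; have sval := smooth_val_smooth hpi.
apply: (@lc_frechet R (smooth_space pi) _
  (fun n (v : smooth_space pi) => word_norm N pi n (smooth_val v))).
- by move=> n v w; rewrite smooth_valD; exact: word_norm_triangle.
- by move=> n a v; rewrite smooth_valZ; exact: word_norm_scale.
(* The word norms belong to the defining family, and by the next item they dominate it. *)
- move=> n; exists (fun v => `|v|), n; split; first exact: norm_continuous_seminorm.
  by apply/funext => v; rewrite dseminorm_norm.
- move=> q [p [n [cp ->]]]; exists n.
  have [C C0 HC] := continuous_seminorm_bounded cp; exists C; split => // v.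
  apply: ge_ereal_sup => _ [x Dx <-]; rewrite lee_fin.
  apply: (le_trans (HC _)); apply: ler_wpM2l => //; exact: le_word_norm.
(* The topology is separated already by n = 0: the empty word is v itself. *)
- move=> v /(_ 0%N) v0; apply: val_inj; apply/eqP; rewrite -normr_le0 /=.
  have D0 : @unit_words R E N 0%N (nil_tuple E) by move=> [].
  have := le_word_norm hN hpi (sval v) D0.
  by rewrite v0.
- by move=> F PF cF; exact: smooth_space_complete.
Qed.
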